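(* For all integers $k,\gamma>0$ there exists an integer $w=w(k,\gamma)$ such that every graph $G$ with $\gamma_3(G)\le\gamma$ and treewidth more than $w$ contains, as an induced subgraph, a subdivision of $W_{k\times k}$ or the line graph of a subdivision of $W_{k\times k}$.
   Context: For a graph $G$ and positive integer $d$, $\gamma_d(G)$ denotes the maximum degree of the subgraph of $G$ induced by the set of vertices of degree at least $d$ in $G$. Walls: for $k\ge1$, $\Gamma_k$ has vertex set $\{(i,j):1\le i\le k,0\le j\le 2k-1\}$, with $(i,j)\sim(i,j+1)$ for $0\le j\le 2k-2$ and $(i,j)\sim(i+1,j)$ whenever $1\le i\le k-1$ and $i+j$ is odd, and no other edges; $W_{k\times k}$ is obtained from $\Gamma_k$ by deleting vertices of degree one and then suppressing each remaining vertex of row $1$ or row $k$ with no neighbor in another row (deleting it and joining its two neighbors). A subdivision replaces edges by paths. The line graph of $F$ has vertex set $E(F)$, two vertices adjacent iff the edges share an end. *)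

(* Defs.v *)
From mathcomp Require Import all_boot.
From mathcomp Require Import boolp.

Set Implicit Arguments.
Unset Strict Implicit.
Unset Printing Implicit Defensive.

(* Finite simple graphs, over the Mathematical Components library. *)
Record sgraph := SGraph {
  svertex :> finType;
  sedge : rel svertex;
  sedge_sym : symmetric sedge;
  sedge_irr : irreflexive sedge }.

Notation "x -- y" := (sedge x y) (at level 30, no associativity).

Definition degree (G : sgraph) (x : G) : nat := #|[set y | x -- y]|.

Definition max_degree (G : sgraph) : nat := \max_(x : G) degree x.

Section Induced.
Variables (G : sgraph) (S : {set G}).

Definition induced_rel : rel {x : G | x \in S} := [rel x y | val x -- val y].

Fact induced_sym : symmetric induced_rel.
Proof. by move=> x y; apply: sedge_sym. Qed.

Fact induced_irr : irreflexive induced_rel.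
Proof. by move=> x; apply: sedge_irr. Qed.

Definition induced : sgraph := SGraph induced_sym induced_irr.
End Induced.

Definition gamma (d : nat) (G : sgraph) : nat :=
  max_degree (induced [set x : G | d <= degree x]).

Definition isomorphic (G H : sgraph) : Prop :=
  exists f : G -> H, bijective f /\ forall x y, (f x -- f y) = (x -- y).

Definition contains_induced (G H : sgraph) : Prop :=
  exists S : {set G}, isomorphic H (induced S).

(* The graph without vertices is not connected. *)
Definition connected (G : sgraph) : Prop :=
  0 < #|G| /\ forall x y : G, connect (@sedge G) x y.

(* [ucycle] also holds of [:: x; y] for an edge xy, hence the bound 2. *)
Definition acyclic (G : sgraph) : Prop :=
  forall c : seq G, ucycle (@sedge G) c -> size c <= 2.

Definition is_tree (T : sgraph) : Prop := connected T /\ acyclic T.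

Definition tree_decomposition (G T : sgraph) (B : T -> {set G}) : Prop :=
  [/\ is_tree T,
      forall v : G, exists t, v \in B t,
      forall u v : G, u -- v -> exists t, u \in B t /\ v \in B t
    & forall v : G, connected (induced [set t | v \in B t])].

(* Truncated predecessor: only the graph without vertices is affected, where
   the width is 0 instead of -1. *)
Definition width (G T : sgraph) (B : T -> {set G}) : nat :=
  (\max_(t : T) #|B t|).-1.

Definition has_decomposition (G : sgraph) (w : nat) : Prop :=
  exists (T : sgraph) (B : T -> {set G}), tree_decomposition B /\ width B = w.

Definition one_vertex_graph : sgraph :=
  @SGraph unit (fun _ _ => false) (fun _ _ => erefl) (fun _ => erefl).

Fact has_some_decomposition (G : sgraph) :
  exists w, `[< has_decomposition G w >].
Proof.
exists (width (fun _ : one_vertex_graph => [set: G])); apply/asboolP.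
exists one_vertex_graph, (fun _ => [set: G]); split=> //; split.
- split; first by split; [rewrite card_unit | case; case; apply: connect0].
  by move=> c /andP[_ /card_uniqP <-]; rewrite (leq_trans (max_card _)) // card_unit.
- by move=> v; exists tt.
- by move=> u v _; exists tt.
- move=> v; have tt_in : tt \in [set t : one_vertex_graph | v \in [set: G]] by rewrite !inE.
  split; first by apply/card_gt0P; exists (exist _ tt tt_in).
  by move=> [[] p] [[] q]; rewrite (bool_irrelevance p q); apply: connect0.
Qed.

Definition treewidth (G : sgraph) : nat := ex_minn (has_some_decomposition G).

(* [F] is a subdivision of [H]: [f] embeds the vertices of [H], and [p x y] lists
   the interior vertices of the path of [F], from [f x] to [f y], that replaces the
   edge xy of [H]; no interior vertex is shared, and [F] has no other vertices or
   edges. The values of [p] at non-adjacent pairs are irrelevant. *)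
Definition is_subdivision (H F : sgraph) : Prop :=
  exists (f : H -> F) (p : H -> H -> seq F),
    injective f /\
    [/\ forall x y, x -- y -> p y x = rev (p x y),
        forall x y, x -- y -> uniq (p x y),
        forall x y z, x -- y -> f z \notin p x y,
        forall x y x' y' v, x -- y -> x' -- y' -> v \in p x y -> v \in p x' y' ->
          [set x; y] = [set x'; y']
      & (forall v : F, (exists x, v = f x) \/ (exists x y, x -- y /\ v \in p x y)) /\
        (forall u v : F, u -- v <->
          exists x y, x -- y /\ infix [:: u; v] (f x :: rcons (p x y) (f y)))].

Section LineGraph.
Variable F : sgraph.

Definition is_edge (e : {set F}) : bool :=
  [exists x, exists y, (x -- y) && (e == [set x; y])].

Definition line_rel : rel {e : {set F} | is_edge e} :=
  [rel a b | (a != b) && (val a :&: val b != set0)].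

Fact line_sym : symmetric line_rel.
Proof. by move=> a b; rewrite /line_rel /= eq_sym setIC. Qed.

Fact line_irr : irreflexive line_rel.
Proof. by move=> a; rewrite /line_rel /= eqxx. Qed.

Definition line_graph : sgraph := SGraph line_sym line_irr.
End LineGraph.

(* Suppression of all vertices of [S] at once. It agrees with suppressing them one
   after the other (delete, then join the two neighbours) when they are pairwise
   non-adjacent and of degree two, as is the case in [wall]. *)
Section Suppress.
Variables (G : sgraph) (S : {set G}).

Definition suppress_rel : rel {x : G | x \in ~: S} :=
  [rel x y | (x != y) &&
     ((val x -- val y) || [exists s in S, (s -- val x) && (s -- val y)])].

Fact suppress_sym : symmetric suppress_rel.
Proof.
move=> x y; rewrite /suppress_rel /= eq_sym sedge_sym; congr (_ && (_ || _)).
by apply: eq_existsb => s; rewrite [X in _ && X]andbC.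
Qed.

Fact suppress_irr : irreflexive suppress_rel.
Proof. by move=> x; rewrite /suppress_rel /= eqxx. Qed.

Definition suppress : sgraph := SGraph suppress_sym suppress_irr.
End Suppress.

Section Wall.
Variable k : nat.

(* The ordinal component [x.1] starts at 0, the rows are numbered from 1 to k. *)
Definition grid_vertex : finType := ('I_k * 'I_(2 * k))%type.
Definition row_of (x : grid_vertex) : nat := x.1.+1.
Definition col_of (x : grid_vertex) : nat := x.2.

Definition Gamma_arc : rel grid_vertex := fun x y =>
  [&& row_of y == row_of x & col_of y == (col_of x).+1] ||
  [&& row_of y == (row_of x).+1, col_of y == col_of x & odd (row_of x + col_of x)].

Definition Gamma_rel : rel grid_vertex := [rel x y | Gamma_arc x y || Gamma_arc y x].

Fact Gamma_sym : symmetric Gamma_rel.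
Proof. by move=> x y; rewrite /Gamma_rel /= orbC. Qed.

Fact Gamma_irr : irreflexive Gamma_rel.
Proof. by move=> x; rewrite /Gamma_rel /= /Gamma_arc !(ltn_eqF (ltnSn _)) andbF. Qed.

Definition Gamma : sgraph := SGraph Gamma_sym Gamma_irr.

Definition trimmed_Gamma : sgraph := induced [set x : Gamma | degree x != 1].

Definition suppressed_set : {set trimmed_Gamma} :=
  [set x : trimmed_Gamma | ((row_of (val x) == 1) || (row_of (val x) == k)) &&
           [forall y : trimmed_Gamma, (x -- y) ==> (row_of (val y) == row_of (val x))]].

(* For k = 1 this is the graph without vertices. *)
Definition wall : sgraph := suppress suppressed_set.
End Wall.

(* Main.v *)
(* A graph of large treewidth has a bramble of large order and therefore a large hexagonal
   grid as a minor. Let D be the set of vertices of degree at least 3. Inside D the degrees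
   are at most g, so D splits into boundedly many classes whose members are pairwise far
   apart in D. For one class at a time, contract the balls of radius 2 in D around its
   vertices, choose a subcubic subgraph h of large bramble order in the result, and replace
   every ball by a minimal connected set which meets the at most three neighbours chosen by
   h. After all classes, an induced subgraph of large bramble order is left in which each
   vertex of degree 3 is either a claw whose neighbours have degree at most 2, or has two
   adjacent neighbours and a third one of degree at most 2. A hexagonal grid drawn with hooks
   on a Ramsey subgrid branches at only one of the two types, so that one type suffices. For
   claws, deleting the middle vertices of some triangles makes every subgraph of minimum
   degree 2 induced, hence also a subdivided wall. For triangles, the graph is a line graph:
   a subdivided wall is found in the intersection graph of its maximal cliques. *)
Require Import Defs.
From mathcomp Require Import all_boot.
From mathcomp Require Import boolp zify.
Set Implicit Arguments.
Unset Strict Implicit.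
Unset Printing Implicit Defensive.

(** Degrees in the graph are unbounded: a vertex of D may have any number of neighbours outside D.
    Only distances inside D are under control. A ball of radius 2 in D has at most (g + 1)^2
    vertices, so contracting balls costs a bounded factor of the bramble order. Radius 2 is what the
    local analysis at a centre v sees: the neighbours in D of v, and of the neighbours of v kept
    with it, all lie in the ball, so an unwanted edge near v could only come from a vertex outside
    D. Such a vertex has degree at most 2, and h is first stripped of its vertices of degree 1, so h
    already uses every edge there. Balls that touch have centres at distance at most 2 + 1 + 2,
    whence the distance 5 in the colouring of D. The classes can be treated in sequence because the
    local structure gained at a vertex survives in every induced subgraph. Treewidth enters only
    once, through the bramble; afterwards each step is a map of connected sets with bounded overlap,
    and every factor in the bounds is such an overlap. *)

(** * Connected sets, brambles and minors *)

Section Connected.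
Variable T : finType.
Implicit Types (e h : rel T) (A B C : {set T}) (x y z : T) (p : seq T).

Definition restr e A : rel T := [rel x y | [&& x \in A, y \in A & e x y]].

Definition conn e A : bool :=
  (A != set0) && [forall x in A, forall y in A, connect (restr e A) x y].

Definition component e A x : {set T} := [set y | connect (restr e A) x y].

Lemma restr_sym e A : symmetric e -> symmetric (restr e A).
Proof. by move=> es x y; rewrite /restr /= es andbCA. Qed.

Lemma connect_restr_sym e A : symmetric e -> connect_sym (restr e A).
Proof. by move=> es; apply: sym_connect_sym; apply: restr_sym. Qed.

Lemma sub_restr e h A B : subrel e h -> A \subset B -> subrel (restr e A) (restr h B).
Proof.
move=> eh /subsetP sAB x y /and3P[/sAB xB /sAB yB /eh hxy].
by apply/and3P; split.
Qed.

Lemma connect_mono (e h : rel T) x y : subrel e h -> connect e x y -> connect h x y.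
Proof. by move=> eh; apply: connect_sub => u v /eh; apply: connect1. Qed.

Lemma connect_restr_mono e h A B x y : subrel e h -> A \subset B ->
  connect (restr e A) x y -> connect (restr h B) x y.
Proof. by move=> eh sAB; apply: connect_mono; apply: sub_restr. Qed.

Lemma connect_restr_mem e A x y : x \in A -> connect (restr e A) x y -> y \in A.
Proof.
move=> xA /connectP[p]; elim: p x xA => [|z p IH] x xA /=; first by move=> _ ->.
by case/andP=> /and3P[_ zA _]; apply: IH.
Qed.

Lemma connP e A :
  reflect (A != set0 /\ {in A &, forall x y, connect (restr e A) x y}) (conn e A).
Proof.
apply: (iffP andP) => [] [A0 cA]; split=> //.
  by move=> x y xA yA; move/forall_inP/(_ x xA)/forall_inP/(_ y yA): cA.
by apply/forall_inP=> x xA; apply/forall_inP=> y yA; apply: cA.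
Qed.

Lemma conn_connect e A x y : conn e A -> x \in A -> y \in A -> connect (restr e A) x y.
Proof. by case/connP=> _; apply. Qed.

Lemma conn_neq0 e A : conn e A -> exists x, x \in A.
Proof. by case/connP=> /set0Pn. Qed.

Lemma conn_from e A x : symmetric e -> x \in A ->
  {in A, forall y, connect (restr e A) x y} -> conn e A.
Proof.
move=> es xA cA; apply/connP; split; first by apply/set0Pn; exists x.
move=> y z yA zA; apply: connect_trans (cA z zA).
by rewrite (connect_restr_sym A es) cA.
Qed.

Lemma conn1 e x : conn e [set x].
Proof.
apply/connP; split; first by apply/set0Pn; exists x; rewrite set11.
by move=> y z /set1P-> /set1P->; apply: connect0.
Qed.

Lemma conn_mono e h A : subrel e h -> conn e A -> conn h A.
Proof.
move=> eh /connP[A0 cA]; apply/connP; split=> // x y xA yA.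
exact: connect_restr_mono eh (subxx _) (cA x y xA yA).
Qed.

Lemma conn_restr e A B : A \subset B -> conn (restr e B) A = conn e A.
Proof.
move=> sAB; rewrite /conn; congr (_ && _).
apply: eq_forallb_in => x xA; apply: eq_forallb_in => y yA.
apply: eq_connect => u v; rewrite /restr /=.
by case uA: (u \in A); case vA: (v \in A) => //=; rewrite !(subsetP sAB).
Qed.

Lemma conn_union e A B : symmetric e -> conn e A -> conn e B ->
  (exists2 x, x \in A & x \in B) \/ (exists x y, [/\ x \in A, y \in B & e x y]) ->
  conn e (A :|: B).
Proof.
move=> es cA cB touch.
have [x [y [xA yB cxy]]] : exists x y, [/\ x \in A, y \in B &
    connect (restr e (A :|: B)) x y].
  case: touch => [[x xA xB]|[x [y [xA yB exy]]]].
    by exists x, x; split=> //; apply: connect0.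
  exists x, y; split=> //; apply: connect1.
  by apply/and3P; split; rewrite // inE ?xA ?yB ?orbT.
apply: (conn_from (x := x)) => //; first by rewrite inE xA.
move=> z /setUP[zA|zB].
  exact: connect_restr_mono (fun _ _ => id) (subsetUl _ _) (conn_connect cA xA zA).
apply: connect_trans cxy _.
exact: connect_restr_mono (fun _ _ => id) (subsetUr _ _) (conn_connect cB yB zB).
Qed.

Lemma conn_unionI e A B x : symmetric e -> conn e A -> conn e B ->
  x \in A -> x \in B -> conn e (A :|: B).
Proof. by move=> es cA cB xA xB; apply: conn_union => //; left; exists x. Qed.

Lemma conn_unionE e A B x y : symmetric e -> conn e A -> conn e B ->
  x \in A -> y \in B -> e x y -> conn e (A :|: B).
Proof. by move=> es cA cB xA yB exy; apply: conn_union => //; right; exists x, y. Qed.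

Lemma conn_edge e x y : symmetric e -> e x y -> conn e [set x; y].
Proof.
move=> es exy.
exact: conn_unionE es (conn1 _ _) (conn1 _ _) (set11 _) (set11 _) exy.
Qed.

Lemma conn_boundary e A B x y : conn e A -> x \in A -> x \in B -> y \in A -> y \notin B ->
  exists u v, [/\ u \in A, u \in B, v \in A, v \notin B & e u v].
Proof.
move=> cA xA xB yA; have /connectP[p] := conn_connect cA xA yA.
elim: p x xA xB => [|z p IH] x xA xB /=; first by move=> _ ->; rewrite xB.
case/andP=> /and3P[_ zA exz] pz lst yB.
case zB: (z \in B); first exact: (IH z).
by exists x, z; rewrite zB.
Qed.

Lemma component_sub e A x : x \in A -> component e A x \subset A.
Proof. by move=> xA; apply/subsetP=> y; rewrite inE => /connect_restr_mem; apply. Qed.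

Lemma mem_component e A x : x \in component e A x.
Proof. by rewrite inE connect0. Qed.

Lemma conn_component e A x : symmetric e -> conn e (component e A x).
Proof.
move=> es; apply: (conn_from es (mem_component e A x)) => y; rewrite inE => /connectP[p].
elim/last_ind: p y => [|p z IH] y /=; first by move=> _ ->; apply: connect0.
rewrite rcons_path last_rcons => /andP[pp ez] ->.
apply: connect_trans (IH _ pp erefl) _; apply: connect1.
have cl : connect (restr e A) x (last x p) by apply/connectP; exists p.
rewrite /restr /= !inE cl /=; case/and3P: (ez) => _ _ ->; rewrite andbT.
exact: connect_trans cl (connect1 ez).
Qed.

Lemma component_edge e A x y z : y \in component e A x -> y \in A -> z \in A -> e y z -> z \in component e A x.
Proof.
rewrite !inE => cxy yA zA eyz; apply: connect_trans cxy (connect1 _).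
by apply/and3P.
Qed.

Lemma path_conn e x p : symmetric e -> path e x p -> conn e [set z in x :: p].
Proof.
move=> es; elim: p x => [|y p IH] x /=.
  suff -> : [set z in [:: x]] = [set x] by rewrite conn1.
  by apply/setP=> z; rewrite !inE.
case/andP=> exy /IH cp.
have -> : [set z in x :: y :: p] = [set x] :|: [set z in y :: p].
  by apply/setP=> z; rewrite !inE.
apply: (conn_unionE es (conn1 _ _) cp _ _ exy); first exact: set11.
by rewrite inE mem_head.
Qed.

Lemma path_restr e A x p : x \in A ->
  path (restr e A) x p = path e x p && all (mem A) p.
Proof.
elim: p x => //= y p IH x xA; rewrite /restr /= -/(restr e A) xA /=.
case yA: (y \in A) => /=; last by rewrite andbF.
by rewrite IH // andbA.
Qed.

Lemma conn_path e A x y : conn e A -> x \in A -> y \in A ->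
  exists p, [/\ path e x p, last x p = y, uniq (x :: p) & {subset x :: p <= A}].
Proof.
move=> cA xA yA; have /connectP[p pp ->] := conn_connect cA xA yA.
case/shortenP: pp => q; rewrite path_restr // => /andP[pq /allP qA] uq _.
by exists q; split=> // z; rewrite inE => /predU1P[->|/qA].
Qed.

Lemma conn_connect_sub e A B x y :
  conn e B -> B \subset A -> x \in B -> y \in B -> connect (restr e A) x y.
Proof.
move=> cB sBA xB yB.
exact: connect_restr_mono (fun _ _ => id) sBA (conn_connect cB xB yB).
Qed.

End Connected.

(* A family of pairwise intersecting connected sets is a bramble, so that [big e n]
   bounds the treewidth from below, and it is easily transported along minors. *)
Definition big (T : finType) (e : rel T) (n : nat) : Prop :=
  exists F : {set {set T}},
  [/\ {in F, forall S, conn e S},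
      {in F &, forall S1 S2, S1 :&: S2 != set0}
    & forall Y : {set T}, {in F, forall S, S :&: Y != set0} -> n <= #|Y|].

Lemma big_le (T : finType) (e : rel T) m n : m <= n -> big e n -> big e m.
Proof.
move=> mn [F [cF iF oF]]; exists F; split=> // Y /oF; exact: leq_trans.
Qed.

Lemma big_mono (T : finType) (e h : rel T) n : subrel e h -> big e n -> big h n.
Proof.
by move=> eh [F [cF iF oF]]; exists F; split=> // S /cF; apply: conn_mono.
Qed.

Section Transfer.
Variables (T' T : finType) (e' : rel T') (e : rel T).

Lemma conn_bigcup (Phi : T' -> {set T}) (S : {set T'}) :
  symmetric e -> (forall a, conn e (Phi a)) ->
  (forall a b, e' a b -> conn e (Phi a :|: Phi b)) ->
  conn e' S -> conn e (\bigcup_(a in S) Phi a).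
Proof.
move=> es cP cE cS; have [a aS] := conn_neq0 cS; have [x xa] := conn_neq0 (cP a).
have sub b : b \in S -> Phi b \subset \bigcup_(a in S) Phi a by move=> bS; apply: bigcup_sup.
apply: (conn_from (x := x)) => //; first by apply/bigcupP; exists a.
move=> y /bigcupP[b bS yb]; have /connectP[p] := conn_connect cS aS bS.
elim: p a aS x xa => [|c p IH] a aS x xa /=.
  by move=> _ eb; subst b; apply: conn_connect_sub (cP a) (sub _ aS) xa yb.
case/andP=> /and3P[_ cS' eac] pp lst; have [z zc] := conn_neq0 (cP c).
apply: connect_trans (IH c cS' z zc pp lst).
apply: (conn_connect_sub (cE _ _ eac)); rewrite ?inE ?xa ?zc ?orbT //.
by rewrite subUset !sub.
Qed.

(** The images of the bramble sets form the new bramble. A set Y hitting all of them pulls back to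
    the set of all a whose bag meets Y; it hits the old bramble and has at most c times as many
    elements, as each vertex lies in at most c bags. *)
Lemma big_transfer (Phi : T' -> {set T}) c n :
  symmetric e -> (forall a, conn e (Phi a)) ->
  (forall a b, e' a b -> conn e (Phi a :|: Phi b)) ->
  (forall x, #|[set a | x \in Phi a]| <= c) ->
  0 < c -> big e' (c * n) -> big e n.
Proof.
move=> es cP cE cc c0 [F [cF iF oF]].
exists [set \bigcup_(a in S) Phi a | S : {set T'} in F]; split.
- by move=> _ /imsetP[S SF ->]; apply: conn_bigcup => //; apply: cF.
- move=> _ _ /imsetP[S1 F1 ->] /imsetP[S2 F2 ->].
  have /set0Pn[a /setIP[a1 a2]] := iF _ _ F1 F2.
  have [x xa] := conn_neq0 (cP a).
  by apply/set0Pn; exists x; rewrite inE; apply/andP; split; apply/bigcupP; exists a.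
move=> Y hY; rewrite -(leq_pmul2l c0).
apply: leq_trans (oF (\bigcup_(x in Y) [set a | x \in Phi a]) _) _.
  move=> S SF.
  have /set0Pn[x /setIP[/bigcupP[a aS xa] xY]] :=
    hY _ (imset_f (fun S : {set T'} => \bigcup_(a in S) Phi a) SF).
  by apply/set0Pn; exists a; rewrite inE aS; apply/bigcupP; exists x; rewrite ?inE.
rewrite mulnC -sum_nat_const.
apply: leq_trans (_ : _ <= \sum_(x in Y) #|[set a | x \in Phi a]|) _.
  elim/big_rec2: _ => [|x m A _ IH]; first by rewrite cards0.
  by apply: leq_trans (leq_card_setU _ _) _; rewrite leq_add2l.
by apply: leq_sum => x _; apply: cc.
Qed.

Definition minor : Prop :=
  exists Phi : T' -> {set T},
  [/\ forall a, conn e (Phi a),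
      forall a b, a != b -> [disjoint Phi a & Phi b]
    & forall a b, e' a b -> exists x y, [/\ x \in Phi a, y \in Phi b & e x y]].

End Transfer.

Lemma minor_trans (T2 T1 T : finType) (e2 : rel T2) (e1 : rel T1) (e : rel T) :
  symmetric e -> minor e2 e1 -> minor e1 e -> minor e2 e.
Proof.
move=> es [Psi [c2 d2 a2]] [Phi [c1 d1 a1]].
exists (fun a => \bigcup_(b in Psi a) Phi b); split.
- move=> a; apply: (conn_bigcup (e' := e1)) => // x y /a1[u [v [xu yv euv]]].
  exact: conn_unionE es (c1 _) (c1 _) xu yv euv.
- move=> a b ab; rewrite -setI_eq0; apply/eqP/setP=> x; rewrite !inE.
  apply/negP=> /andP[/bigcupP[u ua xu] /bigcupP[v vb xv]].
  have uv : u != v.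
    apply: contraTneq vb => <-; have := d2 _ _ ab; rewrite disjoint_subset.
    by move/subsetP/(_ u ua).
  by have := d1 _ _ uv; rewrite disjoint_subset => /subsetP/(_ x xu); rewrite inE xv.
move=> a b /a2[u [v [ua vb /a1[x [y [xu yv exy]]]]]].
by exists x, y; split=> //; apply/bigcupP; [exists u | exists v].
Qed.

(** * Menger's theorem *)

Section Menger.
Variable T : finType.
Implicit Types (e h : rel T) (A B X Y Z R : {set T}) (x y z : T) (p q : seq T).

Definition sep e A B Y : bool :=
  [forall x in A :\: Y, forall y in B :\: Y, ~~ connect (restr e (~: Y)) x y].

Definition linked e A B k : bool := [forall Y : {set T}, sep e A B Y ==> (k <= #|Y|)].

Definition abpath e A B p : bool :=
  if p is x :: q then [&& x \in A, path e x q & last x q \in B] else false.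

Definition linkage e A B k (P : nat -> seq T) : Prop :=
  [/\ forall i, i < k -> abpath e A B (P i), forall i, i < k -> uniq (P i)
    & forall i j v, i < k -> j < k -> v \in P i -> v \in P j -> i = j].

(** A closed side R certifies a separation, so that checking a separator becomes a condition on
    single edges and no paths have to be handled. *)
Lemma sepP e A B Y : reflect (exists R,
   [/\ A :\: Y \subset R, R :&: Y = set0, R :&: B = set0
     & forall u v, u \in R -> v \notin Y -> e u v -> v \in R]) (sep e A B Y).
Proof.
apply: (iffP forall_inP) => [sAB|[R [sAR RY RB clR]] x xAY]; last first.
  apply/forall_inP=> y /setDP[yB _]; apply/negP=> cxy.
  have : y \in R.
    have := subsetP sAR x xAY; case/connectP: cxy => p.
    elim: p x {xAY} => [|z p IH] x /=; first by move=> _ ->.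
    case/andP=> /and3P[_ zY exz] pz lz xR; apply: IH pz lz (clR _ _ xR _ exz).
    by rewrite inE in zY.
  by move=> yR; move/setP/(_ y): RB; rewrite !inE yR yB.
exists [set v | [exists a in A :\: Y, connect (restr e (~: Y)) a v]]; split.
- by apply/subsetP=> a aA; rewrite inE; apply/exists_inP; exists a.
- apply/setP=> v; rewrite !inE; apply/negP=> /andP[/exists_inP[a aA cav] vY].
  have aY : a \in ~: Y by case/setDP: aA => _; rewrite inE.
  by have := connect_restr_mem aY cav; rewrite inE vY.
- apply/setP=> v; rewrite !inE; apply/negP=> /andP[/exists_inP[a aA cav] vB].
  have aY : a \in ~: Y by case/setDP: aA => _; rewrite inE.
  have vY := connect_restr_mem aY cav; rewrite inE in vY.
  by move/forall_inP/(_ v): (sAB a aA); rewrite inE vB vY cav => /(_ isT).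
move=> u v; rewrite !inE => /exists_inP[a aA cau] vY euv.
have aY : a \in ~: Y by case/setDP: aA => _; rewrite inE.
have uY := connect_restr_mem aY cau.
apply/exists_inP; exists a => //; apply: connect_trans cau (connect1 _).
by apply/and3P; split=> //; rewrite inE.
Qed.

Lemma linkedP e A B k :
  reflect (forall Y, sep e A B Y -> k <= #|Y|) (linked e A B k).
Proof. by apply: (iffP forallP) => l Y; apply/implyP; apply: l. Qed.

Lemma linked_le e A B k k' : k <= k' -> linked e A B k' -> linked e A B k.
Proof. by move=> kk /linkedP l; apply/linkedP=> Y /l; apply: leq_trans. Qed.

Lemma abpathE x0 e A B p :
  abpath e A B p = [&& p != [::], head x0 p \in A, sorted e p & last x0 p \in B].
Proof. by case: p. Qed.

Lemma inj_onto k (f : nat -> T) X : #|X| <= k ->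
  (forall i, i < k -> f i \in X) -> (forall i j, i < k -> j < k -> f i = f j -> i = j) ->
  forall z, z \in X -> exists2 i, i < k & f i = z.
Proof.
move=> Xk fX fi z zX.
have sub : [set f i | i : 'I_k] \subset X by apply/subsetP=> _ /imsetP[i _ ->]; apply: fX.
have inj : injective (fun i : 'I_k => f i) by move=> i j /fi eq; apply: val_inj; apply: eq.
have := eqEcard [set f i | i : 'I_k] X.
rewrite sub card_imset // card_ord Xk /= => /eqP eX.
by move: zX; rewrite -eX => /imsetP[i _ ->]; exists i.
Qed.

Lemma linkage_mono e h A B k P : subrel e h -> linkage e A B k P -> linkage h A B k P.
Proof.
move=> eh [a b c]; split=> // i /a; case: (P i) => // x q /= /and3P[-> pq ->].
by rewrite andbT; apply: sub_path pq.
Qed.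

(** A path that avoids the separator would stay in the side R of A and never reach B. Disjoint paths
    meet the separator in distinct vertices. *)
Lemma linkage_linked e A B k P : linkage e A B k P -> linked e A B k.
Proof.
move=> [ab un dj]; apply/linkedP=> Y /sepP[R [sAR RY RB clR]].
have hit i : i < k -> exists v, (v \in P i) && (v \in Y).
  move=> /ab; case: (P i) => // x p /= /and3P[xA pp lB].
  apply/existsP; apply: contraT; rewrite negb_exists => /forallP nY.
  have xR : x \in R.
    by apply: (subsetP sAR); rewrite !inE xA andbT; have:= nY x; rewrite mem_head.
  suff : last x p \in R by move=> lR; move/setP/(_ (last x p)): RB; rewrite !inE lR lB.
  elim: p x {xA lB} pp nY xR => //= y p IH x /andP[exy pp] nY xR.
  apply: IH pp _ _ => [z|].
    by apply: contra (nY z) => /andP[zp ->]; rewrite inE zp orbT.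
  by apply: clR exy => //; have := nY y; rewrite !inE eqxx orbT.
(* [None] is the default for the indices from k on, since T may be empty. *)
have /choice[f fP] : forall i, exists o : option T, i < k ->
    exists2 v, o = Some v & (v \in P i) && (v \in Y).
  move=> i; have [ik|] := ltnP i k; last by exists None.
  by have [v vv] := hit i ik; exists (Some v) => _; exists v.
have -> : k = #|[set f i | i : 'I_k]|.
  rewrite card_imset ?card_ord // => i j; have [v -> /andP[vi _]] := fP i (ltn_ord i).
  have [w -> /andP[wj _]] := fP j (ltn_ord j); case=> vw; subst w.
  by apply: val_inj; apply: dj vi wj; apply: ltn_ord.
have sI : injective (@Some T) by move=> ? ? [].
rewrite -(card_imset (mem Y) sI); apply: subset_leq_card.
apply/subsetP=> _ /imsetP[i _ ->]; have [v -> /andP[_ vY]] := fP i (ltn_ord i).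
exact: imset_f.
Qed.

(* Goring's induction on the edges: if deleting xy creates a separator Y with fewer
   than k vertices, then k paths from A to Y + x and k paths from Y + y to B exist
   without xy, and they can be glued along Y and xy. *)
Theorem menger e A B k : symmetric e -> linked e A B k -> exists P, linkage e A B k P.
Proof.
have [n] := ubnP #|[set xy : T * T | e xy.1 xy.2]|.
elim: n e A B => // n IH e A B eN es lk.
have [/existsP[[x0 y0] /= exy0]|] := boolP [exists xy : T * T, e xy.1 xy.2]; last first.
  rewrite negb_exists => /forallP noe.
  (* Without edges the intersection of A and B is a separator, and its vertices are the paths. *)
  have : sep e A B (A :&: B).
    apply/sepP; exists (A :\: B); split.
    - by apply/subsetP=> z; rewrite !inE; case: (z \in A) => //=; case: (z \in B).
    - by apply/setP=> z; rewrite !inE; case: (z \in A); case: (z \in B).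
    - by apply/setP=> z; rewrite !inE; case: (z \in A); case: (z \in B).
    by move=> u v _ _ euv; have := noe (u, v); rewrite euv.
  move/(linkedP _ _ _ _ lk) => kAB; exists (fun i => take 1 (drop i (enum (A :&: B)))).
  have E i : i < k -> exists2 z, take 1 (drop i (enum (A :&: B))) = [:: z] &
      (z \in A :&: B) && (index z (enum (A :&: B)) == i).
    move=> ik; have il : i < size (enum (A :&: B)) by rewrite -cardE (leq_trans ik).
    have [z _] : exists z, z \in A :&: B by apply/set0Pn; rewrite -card_gt0; lia.
    exists (nth z (enum (A :&: B)) i); first by rewrite (drop_nth z) //= take0.
    by rewrite -mem_enum mem_nth //= index_uniq ?enum_uniq.
  split=> i; first by move=> /E[z -> /andP[/setIP[zA zB] _]] /=; rewrite zA zB.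
    by move=> /E[z ->].
  move=> j v /E[z -> /andP[_ /eqP iz]] /E[w -> /andP[_ /eqP jw]].
  by rewrite !inE => /eqP vz /eqP vw; rewrite -iz -jw -vz -vw.
pose e' := [rel u v | e u v && ([set u; v] != [set x0; y0])].
have es' : symmetric e' by move=> u v; rewrite /= es setUC.
have sub' : subrel e' e by move=> u v /andP[].
have {}IH A' B' : linked e' A' B' k -> exists P, linkage e' A' B' k P.
  apply: IH => //; rewrite ltnS in eN; apply: leq_trans eN; apply: proper_card.
  apply/properP; split; first by apply/subsetP=> -[u v]; rewrite !inE => /andP[].
  by exists (x0, y0); rewrite !inE /= ?eqxx ?andbF.
have [/IH[P lP]|] := boolP (linked e' A B k); first by exists P; apply: linkage_mono lP.
rewrite negb_forall => /existsP[Y]; rewrite negb_imply -ltnNge => /andP[sY Yk].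
have [R [sAR RY RB clR]] := sepP _ _ _ _ sY.
(* Since Y is too small to separate in e, some edge of e leaves R outside Y; it must be the deleted
   one, here oriented so that x lies on the side of A. *)
have [x [y [xR yR yY exy exy']]] : exists x y,
    [/\ x \in R, y \notin R, y \notin Y, e x y & [set x; y] = [set x0; y0]].
  have : ~~ sep e A B Y.
    by apply: contraTN Yk => /(linkedP _ _ _ _ lk); rewrite -leqNgt.
  move=> ns; have [/existsP[[x y] /= /and4P[a b c d]]|] :=
    boolP [exists xy : T * T, [&& xy.1 \in R, xy.2 \notin R, xy.2 \notin Y & e xy.1 xy.2]].
    exists x, y; split=> //; apply/eqP; apply: contraNT b => ne.
    by apply: clR a c _; rewrite /= d ne.
  rewrite negb_exists => /forallP ne; case/negP: ns; apply/sepP; exists R; split=> // u v uR vY euv.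
  by have := ne (u, v); rewrite /= uR vY euv /= andbT negbK.
have xY : x \notin Y by apply/negP=> xY; move/setP/(_ x): RY; rewrite !inE xR xY.
have other u v : e u v -> ~~ e' u v -> (u = x /\ v = y) \/ (u = y /\ v = x).
  move=> euv; rewrite /= euv /= negbK -exy' => /eqP uv.
  have := set21 u v; rewrite uv => /set2P[] eu; have := set22 u v; rewrite uv => /set2P[] ev; auto.
  - have := set22 x y; rewrite -uv eu ev setUid => /set1P eyx.
    by rewrite eyx xR in yR.
  - have := set21 x y; rewrite -uv eu ev setUid => /set1P eyx.
    by rewrite -eyx xR in yR.
have dR u B' : R :&: B' = set0 -> u \in R -> u \notin B'.
  by move=> RB' uR; apply/negP=> uB; move/setP/(_ u): RB'; rewrite !inE uR uB.
have {}RY u : u \in R -> u \notin Y by apply: dR.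
have {}RB u : u \in R -> u \notin B by apply: dR.
(* A set Z separating A from Y + x in e' separates A from B in e, with side S intersected with R:
   the only edge of e missing in e' starts in x, which S avoids. *)
have l1 : linked e' A (x |: Y) k.
  apply/linkedP=> Z /sepP[S [sAS SZ SX clS]]; apply: (linkedP _ _ _ _ lk).
  have {}SX u : u \in S -> u \notin x |: Y.
    by move=> uS; apply/negP=> uX; move/setP/(_ u): SX; rewrite in_setI uS uX inE.
  apply/sepP; exists (S :&: R); split.
  - apply/subsetP=> a aAZ; have aS := subsetP sAS a aAZ.
    have := SX a aS; rewrite !inE negb_or aS => /andP[_ aY]; apply: (subsetP sAR).
    by rewrite inE aY; case/setDP: aAZ.
  - by rewrite setIAC SZ set0I.
  - by apply/setP=> u; rewrite !inE; apply/negP=> /andP[/andP[_ /RB]] /negbTE->.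
  move=> u v /setIP[uS uR] vZ euv; case e'uv: (e' u v).
    have vS := clS _ _ uS vZ e'uv; rewrite inE vS; apply: clR uR _ e'uv.
    by have := SX v vS; rewrite inE negb_or => /andP[].
  case: (other _ _ euv (negbT e'uv)) => [[eu _]|[eu _]].
    by have := SX u uS; rewrite eu setU11.
  by rewrite eu (negbTE yR) in uR.
have l2 : linked e' (y |: Y) B k.
  apply/linkedP=> Z /sepP[S [sAS SZ SB clS]]; apply: (linkedP _ _ _ _ lk).
  apply/sepP; exists ((R :\: Z) :|: S); split.
  - apply/subsetP=> a /setDP[aA aZ]; rewrite !inE aZ /=; apply/orP.
    case aY: (a \in Y); first by right; apply: (subsetP sAS); rewrite !inE aZ aY orbT.
    by left; apply: (subsetP sAR); rewrite !inE aY.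
  - by rewrite setIUl SZ setU0; apply/setP=> u; rewrite !inE; case: (u \in Z); rewrite ?andbF.
  - rewrite setIUl SB setU0; apply/setP=> u; rewrite !inE.
    by apply/negP=> /andP[/andP[_ /RB]] /negbTE->.
  move=> u v uRS vZ euv; rewrite !inE vZ /=; apply/orP; case e'uv: (e' u v).
    case/setUP: uRS => [/setDP[uR uZ]|uS]; last by right; apply: clS e'uv.
    case vY: (v \in Y); first by right; apply: (subsetP sAS); rewrite !inE vZ vY orbT.
    by left; apply: clR uR _ e'uv; rewrite vY.
  case: (other _ _ euv (negbT e'uv)) => [[_ ev]|[_ ->]]; last by left.
  rewrite ev in vZ *.
  by right; apply: (subsetP sAS); rewrite !inE eqxx andbT.
have [P [abP unP djP]] := IH _ _ l1; have [Q [abQ unQ djQ]] := IH _ _ l2.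
have cX : #|x |: Y| <= k by rewrite cardsU1 xY.
have cY : #|y |: Y| <= k by rewrite cardsU1 yY.
pose lP i := last x (P i); pose hQ j := head y (Q j).
have lPP i : i < k -> lP i \in P i.
  by move=> /abP; rewrite /lP; case: (P i) => //= a q _; apply: mem_last.
have hQQ j : j < k -> hQ j \in Q j.
  by move=> /abQ; rewrite /hQ; case: (Q j) => //= a q _; apply: mem_head.
have lPX i : i < k -> lP i \in x |: Y.
  by move=> /abP; rewrite (abpathE x) => /and4P[].
have hQY j : j < k -> hQ j \in y |: Y.
  by move=> /abQ; rewrite (abpathE y) => /and4P[].
(* The k disjoint paths use up the at most k vertices of Y + x as their ends, so none is an inner
   vertex of a path. *)
have onlyP i v : i < k -> v \in P i -> v \in x |: Y -> v = lP i.
  move=> ik vP vX; have [|j jk jv] := inj_onto cX lPX _ vX.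
    by move=> i1 i2 k1 k2 eq; apply: (djP _ _ (lP i1)) => //; rewrite ?lPP // eq lPP.
  by have := djP i j v ik jk vP; rewrite -jv lPP // => ->.
have onlyQ j v : j < k -> v \in Q j -> v \in y |: Y -> v = hQ j.
  move=> jk vQ vY; have [|i ik iv] := inj_onto cY hQY _ vY.
    by move=> i1 i2 k1 k2 eq; apply: (djQ _ _ (hQ i1)) => //; rewrite ?hQQ // eq hQQ.
  by have := djQ j i v jk ik vQ; rewrite -iv hQQ // => ->.
pose w i := if lP i == x then y else lP i.
have wY i : i < k -> w i \in y |: Y.
  move=> /lPX; rewrite /w; case: eqP => [_ _|nx]; first exact: setU11.
  by case/setU1P=> // lY; rewrite inE lY orbT.
have /choice[J JP] : forall i, exists j, i < k -> j < k /\ hQ j = w i.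
  move=> i; have [ik|] := ltnP i k; last by exists 0.
  have [|j jk jv] := inj_onto cY hQY _ (wY i ik); last by exists j.
  by move=> i1 i2 k1 k2 eq; apply: (djQ _ _ (hQ i1)) => //; rewrite ?hQQ // eq hQQ.
have PR i v : i < k -> v \in P i -> v \notin Y -> v \in R.
  move=> ik vP vY; have onl u : u \in P i -> u \in Y -> u = lP i.
    by move=> uP uY; apply: onlyP => //; rewrite inE uY orbT.
  move: vP onl (abP i ik) (unP i ik); rewrite /lP; case: (P i) => // a q vP onl /= /and3P[aA pq _].
  have : a \notin Y -> a \in R by move=> aY; apply: (subsetP sAR); rewrite inE aY.
  elim: q a {aA} vP pq onl => [|b q IHq] a /=; first by rewrite inE => /eqP<- _ _ /(_ vY).
  rewrite inE => /predU1P[<- _ _ /(_ vY)//|vq] /andP[eab pq] onl aR /andP[aq uq].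
  apply: (IHq b) => // [u uq' uY|bY]; first by apply: onl; rewrite // inE uq' orbT.
  apply: clR eab => //; apply: aR; apply/negP=> aY.
  have := onl a; rewrite mem_head => /(_ isT aY) ea; case/negP: aq.
  by rewrite [X in X \in _]ea; apply: mem_last.
have tQ j v : j < k -> v \in behead (Q j) -> v \notin Y.
  move=> jk; move: (unQ j jk) (onlyQ j v jk); rewrite /hQ; case: (Q j) => //= a q.
  case/andP=> aq _ onl vq; apply/negP=> vY; case/negP: aq; rewrite -(onl _ _) //.
    by rewrite inE vq orbT.
  by rewrite inE vY orbT.
have QR j v : j < k -> v \in Q j -> v \notin R.
  move=> jk; move: (abQ j jk) (fun v => tQ j v jk) v; case: (Q j) => //= a q /and3P[_ pq lB].
  elim: q a pq lB => [|b q IHq] a /= pq lB nY v.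
    by rewrite inE => /eqP->; apply/negP=> /RB/negP[].
  case/andP: pq => eab pq; have nY' u : u \in q -> u \notin Y.
    by move=> uq; apply: nY; rewrite inE uq orbT.
  rewrite inE => /predU1P[->|]; last exact: IHq.
  apply/negP=> aR; have bR : b \in R by apply: clR eab => //; apply: nY; apply: mem_head.
  by have := IHq b pq lB nY' b (mem_head _ _); rewrite bR.
have PQ i j v : i < k -> j < k -> v \in P i -> v \in Q j -> [/\ v \in Y, v = lP i & v = hQ j].
  move=> ik jk vP vQ; have vY : v \in Y.
    by apply: contraT => /(PR i v ik vP) vR; have := QR j v jk vQ; rewrite vR.
  by split=> //; [apply: onlyP | apply: onlyQ] => //; rewrite inE vY orbT.
(* The path ending in x goes on through the edge xy. Every other path ends in the first vertex of
   its continuation, which is dropped to avoid a repetition. *)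
pose t i := if lP i == x then Q (J i) else behead (Q (J i)).
have tsub i v : v \in t i -> v \in Q (J i) by rewrite /t; case: eqP => // _; apply: mem_behead.
have PT i i' v : i < k -> i' < k -> v \in P i -> v \notin t i'.
  move=> ik ik' vP; apply/negP=> vt; have [jk jv] := JP i' ik'.
  have [vY _ vh] := PQ i _ v ik jk vP (tsub _ _ vt).
  move: vt jv; rewrite /t /w; case: eqP => [_ _ hy|_]; first by move: vY; rewrite vh hy (negbTE yY).
  by move=> vb; have := tQ _ _ jk vb; rewrite vY.
exists (fun i => P i ++ t i); split=> [i ik|i ik|i i' v ik ik'].
- have [jk jv] := JP i ik; have := abP i ik; have := abQ _ jk.
  move: jv; rewrite /t /w /hQ /lP; case: (Q (J i)) => //= b q; case: (P i) => //= a p.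
  case: eqP => [lx -> /and3P[yY' pq lB]|_ -> /and3P[lY pq lB]] /and3P[aA pp _] /=.
    by rewrite aA cat_path last_cat /= lx exy lB !(sub_path sub').
  by rewrite aA cat_path last_cat lB !(sub_path sub').
- have [jk jv] := JP i ik; rewrite cat_uniq unP //=; apply/andP; split.
    by apply/hasPn=> v vt /=; apply: contraL vt; apply: PT.
  by rewrite /t; have := unQ _ jk; case: eqP => // _; case: (Q (J i)) => //= b q /andP[].
rewrite !mem_cat => /orP[vP|vt] /orP[vP'|vt'].
- exact: djP vP vP'.
- by have := PT _ _ _ ik ik' vP; rewrite vt'.
- by have := PT _ _ _ ik' ik vP'; rewrite vt.
have [jk jv] := JP i ik; have [jk' jv'] := JP i' ik'.
have ej := djQ _ _ _ jk jk' (tsub _ _ vt) (tsub _ _ vt').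
suff el : lP i = lP i' by apply: (djP _ _ (lP i)) => //; rewrite ?lPP // el lPP.
move: jv jv'; rewrite -ej => -> ; rewrite /w.
have lY i0 : i0 < k -> lP i0 <> x -> lP i0 <> y.
  by move=> k0 nx ly; have := lPX _ k0; rewrite ly in_setU1 (negbTE yY) orbF -ly => /eqP/nx.
case: eqP => [->|nx]; case: eqP => [->|nx'] // eq.
  by case: (lY i' ik' nx' (esym eq)).
by case: (lY i ik nx eq).
Qed.
End Menger.

(** * Brambles from treewidth *)

Section Regions.
Variables (V : finType) (e : rel V) (n : nat).
Hypothesis es : symmetric e.
Implicit Types (Z K Y W : {set V}) (L : {set {set V}}) (bag par : {set V} -> {set V}).

Definition nb Z : {set V} := [set v | (v \notin Z) && [exists u in Z, e u v]].

Lemma conn_nb Z Y : conn e Z -> Y \subset nb Z -> conn e (Z :|: Y).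
Proof.
move=> cZ YZ; have [x xZ] := conn_neq0 cZ.
apply: (conn_from (x := x) es); first by rewrite inE xZ.
move=> y /setUP[yZ|yY]; first exact: conn_connect_sub cZ (subsetUl _ _) xZ yZ.
have := subsetP YZ y yY; rewrite inE => /andP[_ /exists_inP[u uZ euy]].
apply: connect_trans (conn_connect_sub cZ (subsetUl _ _) xZ uZ) (connect1 _).
by rewrite /restr /= !inE uZ yY orbT.
Qed.

(** Connected sets that contain more than half of W pairwise intersect. As they cannot form a
    bramble of order n, fewer than n vertices hit all of them. *)
Lemma balanced W : ~ big e n -> exists2 Y : {set V}, #|Y| < n &
  forall S, conn e S -> #|W| < 2 * #|S :&: W| -> S :&: Y != set0.
Proof.
move=> nbig; apply: contrapT => nY; apply: nbig.
exists [set S | conn e S && (#|W| < 2 * #|S :&: W|)]; split.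
- by move=> S; rewrite inE => /andP[].
- move=> S1 S2; rewrite !inE => /andP[_ h1] /andP[_ h2]; apply/negP=> /eqP d.
  have := cardsUI (S1 :&: W) (S2 :&: W).
  have : #|S1 :&: W :|: S2 :&: W| <= #|W|.
    by apply: subset_leq_card; rewrite subUset !subsetIr.
  have -> : (S1 :&: W) :&: (S2 :&: W) = set0 by rewrite setIACA d set0I.
  by rewrite cards0; lia.
move=> Y hY; rewrite leqNgt; apply/negP=> Yn; apply: nY; exists Y => // S cS WS.
by apply: hY; rewrite inE cS WS.
Qed.

(* The nodes of the decomposition are the regions [K] which remain to be
   decomposed, and the bag of a region contains its boundary. *)
Definition region_decomposition Z L bag par : Prop :=
  [/\ [/\ Z \in L, nb Z \subset bag Z,
          forall K, K \in L -> K \subset Z /\ (K = Z \/ K != set0)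
        & forall K, K \in L -> K != Z -> par K \in L /\ K \proper par K],
      forall K, K \in L -> #|bag K| <= 3 * n /\ bag K \subset Z :|: nb Z,
      forall u v, u \in Z -> e u v -> exists2 K, K \in L & (u \in bag K) && (v \in bag K)
    & forall v, v \in Z :|: nb Z -> exists Kv, [/\ Kv \in L, v \in bag Kv &
        forall K, K \in L -> v \in bag K -> K != Kv -> K != Z /\ v \in bag (par K)]].

(** Let W be the boundary of Z and one vertex z of Z, which ensures progress, and let Y be balanced
    for W. The bag W + (Y in Z) has at most (2n + 1) + (n - 1) vertices. A component C of the rest
    has at most n boundary vertices outside Y, because C with these is connected and avoids Y and so
    holds at most half of W. Hence the boundary of C has at most 2n vertices again. *)
Lemma region_decomposition_exists Z : ~ big e n -> 0 < n -> #|nb Z| <= 2 * n ->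
  exists L bag par, region_decomposition Z L bag par.
Proof.
move=> nbig n0; have [m] := ubnP #|Z|; elim: m Z => // m IH Z Zm nbZ.
have [Z0|/set0Pn[z zZ]] := eqVneq Z set0.
  have nZ0 : nb Z = set0.
    by apply/setP=> v; rewrite !inE; apply/negP=> /andP[_ /exists_inP[u]]; rewrite Z0 inE.
  exists [set Z], id, id; split; first split.
  - exact: set11.
  - by rewrite nZ0 sub0set.
  - by move=> K /set1P->; split=> //; left.
  - by move=> K /set1P->; rewrite eqxx.
  - by move=> K /set1P->; rewrite subsetUl; split=> //; rewrite {1}Z0 cards0.
  - by move=> u v; rewrite {1}Z0 inE.
  - by move=> v; rewrite nZ0 {1}Z0 !inE.
pose W := z |: nb Z; have [Y Yn hY] := balanced W nbig.
pose B := W :|: (Y :&: Z); pose Z' := Z :\: B; pose C (x : V) : {set V} := component e Z' x.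
have zB : z \in B by rewrite !inE eqxx.
have WB : nb Z \subset B by rewrite /B /W -setUA setUCA subsetUl.
have Cs x : x \in Z' -> C x \subset Z' by apply: component_sub.
have sZ' : Z' \subset Z by apply: subsetDl.
have zZ' : z \notin Z' by rewrite inE zB.
have CZ x : x \in Z' -> C x \proper Z.
  move=> xZ'; apply/properP; split; first exact: subset_trans (Cs x xZ') sZ'.
  by exists z => //; apply: contra zZ' => /(subsetP (Cs x xZ')).
have cC x : conn e (C x) by apply: conn_component.
have Ceq x y : y \in C x -> C y = C x.
  rewrite inE => cxy; apply/setP=> w; rewrite !inE.
  by rewrite (same_connect (connect_restr_sym Z' es) cxy).
have nbC x : x \in Z' -> nb (C x) \subset B.
  move=> xZ'; apply/subsetP=> v; rewrite inE => /andP[vC /exists_inP[u uC euv]].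
  have uZ' := subsetP (Cs x xZ') u uC.
  have [vZ|vZ] := boolP (v \in Z); last first.
    apply: (subsetP WB); rewrite inE vZ; apply/exists_inP; exists u => //.
    exact: (subsetP sZ').
  apply: contraT => vB; case/negP: vC; apply: component_edge uC uZ' _ euv.
  by rewrite inE vB.
have nbC2 x : x \in Z' -> #|nb (C x)| <= 2 * n.
  move=> xZ'; have Yd : (C x :|: (nb (C x) :\: Y)) :&: Y = set0.
    apply/setP=> v; rewrite !inE; apply/negP=> /andP[/orP[vC|/andP[/negP]] // vY].
    have := subsetP (Cs x xZ') v _; rewrite !inE vC => /(_ isT) /andP[].
    by case/norP=> _; rewrite vY /= => /negbTE->.
  have cS := conn_nb (cC x) (subsetDl (nb (C x)) Y).
  have hW : 2 * #|(C x :|: (nb (C x) :\: Y)) :&: W| <= #|W|.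
    by rewrite leqNgt; apply/negP=> /(hY _ cS); rewrite Yd eqxx.
  have sW : nb (C x) :\: Y \subset (C x :|: (nb (C x) :\: Y)) :&: W.
    rewrite subsetI subsetUr /=; apply/subsetP=> v /setDP[/(subsetP (nbC x xZ')) vB vY].
    by move: vB; rewrite !inE (negbTE vY) orbF.
  have := subset_leq_card sW; have := cardsD (nb (C x)) Y.
  have : #|nb (C x) :&: Y| <= #|Y| by rewrite subset_leq_card ?subsetIr.
  have : #|W| <= 2 * n + 1 by rewrite cardsU1; lia.
  by lia.
have /choice[LL /choice[BB /choice[PP hC]]] : forall K, exists L bag par, forall x, x \in Z' -> K = C x ->
    region_decomposition K L bag par.
  move=> K; have [/existsP[x /andP[xZ' /eqP eK]]|] := boolP [exists x, (x \in Z') && (K == C x)].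
    have [|L [bag [par d]]] := IH (C x) _ (nbC2 x xZ').
      by apply: leq_trans (proper_card (CZ x xZ')) _.
    by exists L, bag, par => y _ _; rewrite eK.
  rewrite negb_exists => /forallP nK; exists set0, id, id => x xZ' eK.
  by have := nK x; rewrite xZ' eK eqxx.
have {}hC x : x \in Z' -> region_decomposition (C x) (LL (C x)) (BB (C x)) (PP (C x)).
  by move=> xZ'; apply: (hC _ x).
have LLC x K : x \in Z' -> K \in LL (C x) -> K \subset C x /\ exists y, y \in K.
  move=> xZ' KL; have [[_ _ h _] _ _ _] := hC x xZ'; have [sK nK] := h K KL.
  split=> //; case: nK => [->|/set0Pn//]; exists x; exact: mem_component.
(* The component to which a region belongs is recovered from any of its vertices; regions below the
   root are non-empty. *)
pose reg K := if [pick y in K] is Some y then C y else set0.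
have regE x K : x \in Z' -> K \in LL (C x) -> reg K = C x.
  move=> xZ' /(LLC x K xZ')[sK [y yK]]; rewrite /reg; case: pickP => [w wK|/(_ y)].
    by apply: Ceq; apply: (subsetP sK).
  by rewrite yK.
pose bag K := if K == Z then B else BB (reg K) K.
pose par K := if K == reg K then Z else PP (reg K) K.
have nZ x K : x \in Z' -> K \in LL (C x) -> K != Z.
  move=> xZ' /(LLC x K xZ')[sK _]; apply: contraTneq sK => ->.
  by apply: proper_subn; apply: CZ.
have bagE x K : x \in Z' -> K \in LL (C x) -> bag K = BB (C x) K.
  by move=> xZ' KL; rewrite /bag (negbTE (nZ x K xZ' KL)) (regE x).
exists (Z |: \bigcup_(x in Z') LL (C x)), bag, par; split; first split.
- exact: setU11.
- by rewrite /bag eqxx.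
- move=> K /setU1P[->|/bigcupP[x xZ' KL]]; first by split=> //; left.
  have [sK [y yK]] := LLC x K xZ' KL; split; last by right; apply/set0Pn; exists y.
  exact: subset_trans sK (proper_sub (CZ x xZ')).
- move=> K /setU1P[->|/bigcupP[x xZ' KL] _]; first by rewrite eqxx.
  rewrite /par (regE x) //; case: eqP => [->|/eqP nK]; first by rewrite setU11; split=> //; apply: CZ.
  have [[_ _ _ h] _ _ _] := hC x xZ'; have [pL pK] := h K KL nK; split=> //.
  by apply/setU1P; right; apply/bigcupP; exists x.
- move=> K /setU1P[->|/bigcupP[x xZ' KL]].
    rewrite /bag eqxx; split; last first.
      rewrite /B /W !subUset sub1set subsetUr inE zZ /=.
      by apply: subset_trans (subsetIr _ _) (subsetUl _ _).
    have := subset_leq_card (subsetIl Y Z); have := (leq_card_setU W (Y :&: Z)).1.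
    have : #|W| <= 2 * n + 1 by rewrite cardsU1; lia.
    by rewrite -/B; lia.
  rewrite (bagE x) //; have [_ h _ _] := hC x xZ'; have [hn hs] := h K KL; split=> //.
  apply: subset_trans hs _; rewrite subUset; apply/andP; split.
    exact: subset_trans (proper_sub (CZ x xZ')) (subsetUl _ _).
  apply: subset_trans (nbC x xZ') _; rewrite /B /W !subUset sub1set subsetUr inE zZ /=.
  by apply: subset_trans (subsetIr _ _) (subsetUl _ _).
- have inner x y : x \in Z' -> e x y -> exists2 K, K \in Z |: \bigcup_(x in Z') LL (C x) &
      (x \in bag K) && (y \in bag K).
    move=> xZ' exy; have [_ _ h _] := hC x xZ'.
    have [K KL hK] := h x y (mem_component _ _ _) exy; exists K; last by rewrite (bagE x).
    by apply/setU1P; right; apply/bigcupP; exists x.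
  move=> u v uZ euv; have [uB|uB] := boolP (u \in B); last by apply: inner; rewrite // inE uB.
  have [vB|vB] := boolP (v \in B).
    by exists Z; rewrite ?setU11 // /bag eqxx uB vB.
  have [vZ|vZ] := boolP (v \in Z); last first.
    case/negP: vB; apply: (subsetP WB); rewrite inE vZ; by apply/exists_inP; exists u.
  have [||K KL hK] := inner v u; first by rewrite inE vB.
    by rewrite es.
  by exists K; rewrite // andbC.
move=> v vZ; have [vB|vB] := boolP (v \in B).
  exists Z; rewrite setU11 {1}/bag eqxx; split=> // K.
  case/setU1P=> [->|/bigcupP[x xZ' KL]]; first by rewrite eqxx.
  rewrite (bagE x) // => vK _; split; first exact: nZ KL.
  have [[CL nC hs hp] hb _ ht] := hC x xZ'; have [_ hbK] := hb K KL.
  have vC : v \notin C x by apply/negP=> /(subsetP (Cs x xZ')); rewrite inE vB.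
  have vN : v \in nb (C x) by have := subsetP hbK v vK; rewrite inE (negbTE vC).
  rewrite /par (regE x) //; case: eqP => [_|/eqP nK]; first by rewrite /bag eqxx.
  have [pL _] := hp K KL nK; rewrite (bagE x) //.
  have [|Kv [KvL vKv hK]] := ht v; first by rewrite inE vN orbT.
  have eC : C x = Kv.
    apply/eqP; apply: contraT => nC'.
    by have [] := hK (C x) CL (subsetP nC v vN) nC'; rewrite eqxx.
  by apply: (proj2 (hK K KL vK _)); rewrite -eC.
have vZ' : v \in Z'.
  rewrite inE vB; case/setUP: vZ => // vN; by rewrite (subsetP WB) in vB.
have [[CL nC hs hp] hb _ ht] := hC v vZ'.
have [|Kv [KvL vKv hK]] := ht v; first by rewrite inE mem_component.
exists Kv; split; first by apply/setU1P; right; apply/bigcupP; exists v.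
  by rewrite (bagE v).
move=> K /setU1P[->|/bigcupP[x xZ' KL]]; first by rewrite {1}/bag eqxx (negbTE vB).
rewrite (bagE x) // => vK nK; split; first exact: nZ KL.
have eC : C x = C v.
  symmetry; apply: Ceq; have [_ hbx _ _] := hC x xZ'; have [_ hbK] := hbx K KL.
  have := subsetP hbK v vK; case/setUP=> // /(subsetP (nbC x xZ')) vB'.
  by rewrite vB' in vB.
rewrite eC in KL vK; have [nK' vp] := hK K KL vK nK.
rewrite /par (regE v) // (negbTE nK') (bagE v) //.
by have [] := hp K KL nK'.
Qed.

End Regions.

Lemma connect_induced (G : sgraph) (S : {set G}) (x y : G) (xS : x \in S) (yS : y \in S) :
  connect (restr (@sedge G) S) x y ->
  connect (@sedge (induced S)) (exist _ x xS) (exist _ y yS).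
Proof.
case/connectP=> p; elim: p x xS => [|z p IH] x xS /=.
  by move=> _ eyx; subst y; rewrite (bool_irrelevance xS yS) connect0.
case/andP=> /and3P[_ zS exz] pz ly.
by apply: connect_trans (connect1 _) (IH z zS pz ly).
Qed.

Lemma connected_induced (G : sgraph) (S : {set G}) :
  conn (@sedge G) S -> connected (induced S).
Proof.
move=> cS; have [x xS] := conn_neq0 cS; split.
  by apply/card_gt0P; exists (exist _ x xS).
by move=> [y yS] [z zS]; apply: connect_induced; apply: conn_connect cS yS zS.
Qed.

Lemma connected_setT (G : sgraph) : conn (@sedge G) [set: G] -> connected G.
Proof.
move=> cT; have [x _] := conn_neq0 cT; split; first by apply/card_gt0P; exists x.
move=> y z; have := conn_connect cT (in_setT y) (in_setT z).
by apply: connect_mono => u v /and3P[].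
Qed.

Lemma treewidth_le (G T : sgraph) (B : T -> {set G}) w :
  tree_decomposition B -> width B <= w -> treewidth G <= w.
Proof.
move=> dB wB; apply: leq_trans wB; rewrite /treewidth; case: ex_minnP => m _; apply.
by apply/asboolP; exists T, B.
Qed.

Section RegionTree.
Variables (V : finType) (L : {set {set V}}) (Z : {set V}) (par : {set V} -> {set V}).
Hypothesis parL : forall K, K \in L -> K != Z -> par K \in L /\ K \proper par K.

Let node : finType := {K : {set V} | K \in L}.

Definition region_rel : rel node := [rel K K' |
  ((val K != Z) && (par (val K) == val K')) || ((val K' != Z) && (par (val K') == val K))].

Fact region_sym : symmetric region_rel.
Proof. by move=> K K'; rewrite /region_rel /= orbC. Qed.

Fact region_irr : irreflexive region_rel.
Proof.
move=> K; rewrite /region_rel /= orbb; apply/negP=> /andP[nK /eqP pK].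
by have [_] := parL (valP K) nK; rewrite pK properxx.
Qed.

Definition region_tree : sgraph := SGraph region_sym region_irr.

(** Parents grow strictly, so climbing from any node of Q ends, and it can end only in [top]. *)
Lemma region_conn (Q : {set region_tree}) (top : region_tree) : top \in Q ->
  (forall K, K \in Q -> K != top -> val K != Z /\ forall K' : region_tree, val K' = par (val K) -> K' \in Q) ->
  conn (@sedge region_tree) Q.
Proof.
move=> tQ hQ; apply: (conn_from (x := top)) => //; first exact: region_sym.
move=> K KQ; rewrite (connect_restr_sym Q region_sym).
have [m] := ubnP (#|V| - #|val K|); elim: m K KQ => // m IH K KQ Km.
have [->|nK] := eqVneq K top; first exact: connect0.
have [nZ hK] := hQ K KQ nK; have [pL pK] := parL (valP K) nZ.
have KQ' := hK (exist _ (par (val K)) pL) erefl.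
apply: connect_trans (connect1 _) (IH _ KQ' _).
  by rewrite /restr /= KQ KQ' /region_rel /= nZ eqxx.
have h1 : #|par (val K)| <= #|V| by apply: max_card.
have h2 := proper_card pK; rewrite ltnS in Km; apply: leq_trans Km.
by apply: ltn_sub2l => //; apply: leq_trans h1.
Qed.

(** A smallest region on a cycle would have its parent as both of its neighbours there. *)
Lemma region_acyclic : acyclic region_tree.
Proof.
move=> c /andP[cyc un]; case: c cyc un => [//|c0 c1] cyc un.
rewrite leqNgt; apply/negP=> sz.
have [K Kc Kmin] : exists2 K, K \in c0 :: c1 & forall K', K' \in c0 :: c1 -> #|val K| <= #|val K'|.
  have hc : [pred K : node | K \in c0 :: c1] c0 by apply: mem_head.
  by case: (arg_minnP (fun K : node => #|val K|) hc) => K Kc h; exists K.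
have [i c2 rE] := rot_to Kc.
have cyc2 : cycle region_rel (K :: c2) by rewrite -rE rot_cycle.
have un2 : uniq (K :: c2) by rewrite -rE rot_uniq.
have sz2 : 2 < size (K :: c2) by rewrite -rE size_rot.
have mem2 x : x \in K :: c2 -> x \in c0 :: c1 by rewrite -rE mem_rot.
have up K' : K' \in K :: c2 -> region_rel K K' -> par (val K) = val K'.
  move=> /mem2/Kmin hK /orP[/andP[_ /eqP]//|/andP[nK /eqP pK]].
  have [_ /proper_card lt] := parL (valP K') nK; rewrite pK in lt.
  by have := leq_ltn_trans hK lt; rewrite ltnn.
case: c2 {rE} cyc2 un2 sz2 up {mem2} => [//|K1 c2] /= /andP[e1]; rewrite rcons_path.
case/andP=> _ e2 /and3P[_ n1 _] sz2 up.
have l2 : last K1 c2 \in K1 :: c2 by apply: mem_last.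
have h1 := up K1 _ e1; have h2 : par (val K) = val (last K1 c2).
  by apply: up; [rewrite inE l2 orbT | rewrite region_sym].
have {}h1 : par (val K) = val K1 by apply: h1; rewrite !inE eqxx orbT.
clear e2 up l2; case: c2 sz2 n1 h2 => // K2 c3 _ n1 /= h2; case/negP: n1.
suff -> : K1 = last K2 c3 by apply: mem_last.
by apply: val_inj; exact: etrans (esym h1) h2.
Qed.

End RegionTree.

(** The whole vertex set has an empty boundary, so the recursive decomposition can start from it. *)
Lemma treewidth_big (G : sgraph) n : 0 < n -> 3 * n < treewidth G -> big (@sedge G) n.
Proof.
move=> n0 tw; apply: contrapT => nbig; move: tw; apply/negP; rewrite -leqNgt.
have [|L [bag [par [[ZL _ _ parL] bagn edge top]]]] :=
  region_decomposition_exists (@sedge_sym G) (Z := [set: G]) nbig n0.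
  suff -> : nb (@sedge G) [set: G] = set0 by rewrite cards0.
  by apply/setP=> v; rewrite !inE.
pose T := region_tree parL.
have sub v (Kv : T) : v \in bag (val Kv) ->
    (forall K, K \in L -> v \in bag K -> K != val Kv -> K != [set: G] /\ v \in bag (par K)) ->
    conn (@sedge T) [set t : T | v \in bag (val t)].
  move=> vK hK; apply: (region_conn (top := Kv)); first by rewrite inE.
  move=> K; rewrite inE => vK' nK; have [|nZ vp] := hK (val K) (valP K) vK'.
    by rewrite (inj_eq val_inj).
  by split=> // K' eK'; rewrite inE eK'.
apply: (treewidth_le (T := T) (B := fun t => bag (val t))).
  split.
  - split; last exact: region_acyclic.
    apply: connected_setT; apply: (region_conn (top := exist _ [set: G] ZL)); first by rewrite inE.
    move=> K _ nK; split=> [|K' _]; last by rewrite inE.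
    by apply/eqP=> eK; case/eqP: nK; apply: val_inj.
  - move=> v; have [|Kv [KvL vKv _]] := top v; first by rewrite !inE.
    by exists (exist _ Kv KvL).
  - move=> u v euv; have [K KL /andP[uK vK]] := edge u v (in_setT u) euv.
    by exists (exist _ K KL).
  - move=> v; have [|Kv [KvL vKv hK]] := top v; first by rewrite !inE.
    by apply: connected_induced; apply: (sub v (exist _ Kv KvL)).
rewrite /width; apply: leq_trans (leq_pred _) _; apply/bigmax_leqP=> t _.
by have [] := bagn _ (valP t).
Qed.

(** * Linkages and pseudogrids *)

(** A grid whose columns are only connected sets: n rows are cut into d segments each, and the layer
    t meets the segment t of every row and no other segments. The order in which a layer visits the
    rows is left open. *)
Definition pseudogrid (T : finType) (e : rel T) (n d : nat) : Prop :=
  exists (seg : nat -> nat -> {set T}) (lay : nat -> {set T}),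
  [/\ forall i t, i < n -> t < d -> conn e (seg i t),
      forall i t, i < n -> t.+1 < d -> conn e (seg i t :|: seg i t.+1),
      forall t, t < d -> conn e (lay t),
      forall i t, i < n -> t < d -> exists2 x, x \in lay t & x \in seg i t
    & [/\ forall i t j s x, i < n -> t < d -> j < n -> s < d ->
            x \in seg i t -> x \in seg j s -> i = j /\ t = s,
          forall t s x, t < d -> s < d -> x \in lay t -> x \in lay s -> t = s
        & forall i t s x, i < n -> t < d -> s < d ->
            x \in lay s -> x \in seg i t -> t = s]].

Lemma pseudogrid_mono (T : finType) (e h : rel T) n d :
  subrel e h -> pseudogrid e n d -> pseudogrid h n d.
Proof.
move=> eh [seg [lay [a b c l m]]]; exists seg, lay; split=> // *; apply: conn_mono eh _; auto.
Qed.

Section Slabs.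
Variable T : finType.
Implicit Types (e g h : rel T) (A B S : {set T}) (q : seq T).

Lemma connect_steps h (f : nat -> T) a b : a <= b ->
  (forall i, a <= i < b -> h (f i) (f i.+1)) -> connect h (f a) (f b).
Proof.
elim: b => [|b IH]; first by rewrite leqn0 => /eqP->.
rewrite leq_eqVlt => /predU1P[->//|ab hf]; apply: connect_trans (connect1 (hf b _)).
  by apply: IH => // i /andP[ai ib]; apply: hf; rewrite ai ltnW.
by rewrite ltnSn andbT.
Qed.

(** Half-open, so that successive cut positions give disjoint intervals joined by one edge of the
    path. *)
Definition interval q a b : {set T} := [set z in q | a < index z q <= b].

Lemma conn_interval e q a b : symmetric e -> sorted e q -> uniq q -> a < b -> b < size q ->
  conn e (interval q a b).
Proof.
move=> es sq uq ab bq; case: q => // x0 q in sq uq bq *; set s := x0 :: q in sq uq bq *.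
have mI j : a < j -> j <= b -> nth x0 s j \in interval s a b.
  move=> aj jb; have js : j < size s by lia.
  by rewrite inE mem_nth // index_uniq // aj jb.
apply: (conn_from (x := nth x0 s a.+1) es (mI _ _ _)) => // y.
rewrite inE => /and3P[ys ay yb]; rewrite -(nth_index x0 ys).
apply: (connect_steps (f := nth x0 s)) => // i /andP[ai ib].
apply/and3P; split; [apply: mI; lia | apply: mI; lia |].
by move/(sortedP x0): sq; apply; lia.
Qed.

Definition del g u v : rel T := [rel x y | g x y && ([set x; y] != [set u; v])].

Lemma del_sym g u v : symmetric g -> symmetric (del g u v).
Proof. by move=> gs x y; rewrite /del /= gs setUC. Qed.

(** Edges outside h are deleted as long as N-linkedness survives. Each one that remains is then
    crucial and yields a separator with fewer than N vertices, from which [slabs] builds its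
    cuts. *)
Lemma thin e A B N (h : rel T) : symmetric e -> symmetric h -> subrel h e -> linked e A B N ->
  exists g, [/\ symmetric g, subrel h g, subrel g e, linked g A B N &
    forall u v, g u v -> ~~ h u v -> ~~ linked (del g u v) A B N].
Proof.
have [m] := ubnP #|[set xy : T * T | e xy.1 xy.2]|.
elim: m e => // m IH e em es hs he le.
have [/existsP[[u v] /= /and3P[euv huv ld]]|] :=
  boolP [exists xy : T * T, [&& e xy.1 xy.2, ~~ h xy.1 xy.2 & linked (del e xy.1 xy.2) A B N]].
  have [|||g [gs hg ge lg ming]] := IH (del e u v) _ _ hs _ ld.
  - rewrite ltnS in em; apply: leq_trans em; apply: proper_card; apply/properP; split.
      by apply/subsetP=> -[x y]; rewrite !inE => /andP[].
    by exists (u, v); rewrite /del !inE /= ?eqxx ?andbF.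
  - exact: del_sym.
  - move=> x y hxy; rewrite /del /= he //=; apply: contraNneq huv => eq.
    have := set21 x y; rewrite eq => /set2P[] ex; have := set22 x y; rewrite eq => /set2P[] ey.
    + have := set22 u v; rewrite -eq ex ey setUid => /set1P euv'; move: euv.
      by rewrite euv' -[X in h X]ex -[X in h _ X]ey hxy.
    + by rewrite -ex -ey.
    + by rewrite hs -ex -ey.
    + have := set21 u v; rewrite -eq ex ey setUid => /set1P euv'; move: euv.
      by rewrite euv' -[X in h X]ex -[X in h _ X]ey hxy.
  by exists g; split=> // x y /ge/andP[].
rewrite negb_exists => /forallP nex; exists e; split=> // u v euv huv.
by have := nex (u, v); rewrite /= euv huv.
Qed.

Lemma pick_disjoint_avoid (Ps : nat -> {set T}) S (l : seq nat) : uniq l ->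
  (forall k k' x, k \in l -> k' \in l -> x \in Ps k -> x \in Ps k' -> k = k') ->
  #|S| < size l -> exists2 k, k \in l & [disjoint Ps k & S].
Proof.
elim: l S => // k l IH S /= /andP[kl ul] dj Sl.
have [dk|] := boolP [disjoint Ps k & S]; first by exists k; rewrite ?mem_head.
rewrite -setI_eq0 => /set0Pn[x /setIP[xk xS]].
have [| |k' k'l dk'] := IH (S :\ x) ul.
- by move=> k1 k2 y l1 l2; apply: dj; rewrite inE ?l1 ?l2 orbT.
- by move: Sl; rewrite (cardsD1 x S) xS.
exists k'; first by rewrite inE k'l orbT.
have xk' : x \notin Ps k'.
  apply: contra kl => xk'; suff -> : k = k' by [].
  by apply: dj xk xk'; rewrite inE ?eqxx ?k'l ?orbT.
rewrite disjoint_subset; apply/subsetP=> y yk'; rewrite inE.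
move: dk'; rewrite disjoint_subset => /subsetP/(_ y yk'); rewrite !inE negb_and negbK.
by case/orP=> // /eqP eyx; rewrite eyx (negbTE xk') in yk'.
Qed.

(* An edge of the path [Q (rho 0)] which is not inside a set of [Ps] is crucial: deleting it
   leaves a separator with one vertex on each other path, and every set of [Ps] avoiding it lies
   on one side of the cut. Several such cuts along this path divide all paths into slabs. *)
Lemma slabs g A B N Q (Ps : nat -> {set T}) (same : rel T) M n d
    (rho : nat -> nat) :
  symmetric g -> linkage g A B N Q -> 0 < n ->
  (forall i, i < n -> rho i < N) ->
  (forall i j, i < n -> j < n -> rho i = rho j -> i = j) ->
  (forall k, k < M -> conn g (Ps k)) ->
  (forall k k' x, k < M -> k' < M -> x \in Ps k -> x \in Ps k' -> k = k') ->
  (forall k u v, k < M -> u \in Ps k -> same u v = (v \in Ps k)) ->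
  (forall u v, g u v -> ~~ same u v -> ~~ linked (del g u v) A B N) ->
  (forall k i, k < M -> i < n -> exists2 x, x \in Ps k & x \in Q (rho i)) ->
  d.+2 * (N * d.+1).+1 <= M -> pseudogrid g n d.
Proof.
move=> gs lQ n0 rhoN rhoI cP dP sameP crucial hits.
(* A block of K disjoint sets contains one that avoids d + 1 separators of fewer than N vertices
   each. The d + 1 cuts lie between d + 2 successive blocks. *)
set K := (N * d.+1).+1 => KM; have [abQ unQ djQ] := lQ.
have hit0 k : k < M -> has (mem (Ps k)) (Q (rho 0)).
  by move=> kM; have [x xk xq] := hits k 0 kM n0; apply/hasP; exists x.
pose f k := find (mem (Ps k)) (Q (rho 0)).
have M0 : 0 < M by lia.
have [x0 _ _] := hits 0 0 M0 n0; pose q0 := nth x0 (Q (rho 0)).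
have fs k : k < M -> f k < size (Q (rho 0)) by move=> /hit0; rewrite has_find.
have fP k : k < M -> q0 (f k) \in Ps k by move=> /hit0; apply: nth_find.
have fI k k' : k < M -> k' < M -> f k = f k' -> k = k'.
  by move=> kM kM' eq; apply: (dP _ _ (q0 (f k))) => //; rewrite ?fP // eq fP.
pose s := sort (relpre f leq) (iota 0 M).
have sM : size s = M by rewrite size_sort size_iota.
have us : uniq s by rewrite sort_uniq iota_uniq.
have ms k : (k \in s) = (k < M) by rewrite mem_sort mem_iota.
have ltM a : a < M -> nth 0 s a < M by move=> aM; rewrite -ms mem_nth ?sM.
have ss : sorted (relpre f leq) s by apply: sort_sorted => a b; apply: leq_total.
have sf a b : a < b -> b < M -> f (nth 0 s a) < f (nth 0 s b).
  move=> ab bM; have aM : a < M by lia.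
  have := @sorted_leq_nth _ (relpre f leq) (fun y x z => @leq_trans (f y) (f x) (f z))
    (fun x => leqnn (f x)) 0 s ss a b.
  rewrite !inE sM => /(_ aM bM (ltnW ab)) /=; rewrite leq_eqVlt => /predU1P[eq|//].
  have /eqP := fI _ _ (ltM a aM) (ltM b bM) eq.
  by rewrite nth_uniq ?sM //; lia.
have Q0 : rho 0 < N := rhoN 0 n0.
have adj i j : i < N -> j.+1 < size (Q i) -> g (nth x0 (Q i) j) (nth x0 (Q i) j.+1).
  by move=> iN; have := abQ i iN; rewrite (abpathE x0) => /and4P[_ _ /sortedP-/(_ x0) sq _]; apply: sq.
(* The cut edge a lies on [Q (rho 0)] between the last set of block a and the first set of block a +
   1. Were all edges in between inside one set of the family, these two sets would meet. *)
have /choice[c cP'] : forall a, exists j, a <= d ->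
    [/\ f (nth 0 s (a.+1 * K).-1) <= j, j < f (nth 0 s (a.+1 * K)) &
        ~~ same (q0 j) (q0 j.+1)].
  move=> a; have [ad|] := leqP a d; last by exists 0.
  set k1 := nth 0 s _; set k2 := nth 0 s _.
  have aK : a.+1 * K < M by rewrite (leq_trans _ KM) // ltn_pmul2r.
  have aK' : (a.+1 * K).-1 < a.+1 * K by rewrite prednK // muln_gt0.
  have f12 : f k1 < f k2 by apply: sf.
  have k1M : k1 < M by apply: ltM; apply: ltn_trans aK.
  have k2M : k2 < M by apply: ltM.
  apply: contrapT => none.
  have all1 j : f k1 <= j -> j <= f k2 -> q0 j \in Ps k1.
    elim: j => [|j IH] h1 h2.
      by have -> : 0 = f k1 by [lia]; apply: fP.
    move: h1; rewrite leq_eqVlt => /predU1P[<-|h1]; first exact: fP.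
    have jk := IH h1 (ltnW h2); apply: contraT => njk; case: none; exists j => _; split=> //.
    by rewrite (sameP k1).
  have := dP _ _ _ k1M k2M (all1 (f k2) (ltnW f12) (leqnn _)) (fP k2 k2M).
  by move=> eq; rewrite eq ltnn in f12.
have csz a : a <= d -> (c a).+1 < size (Q (rho 0)).
  move=> ad; have [_ h _] := cP' a ad; apply: leq_trans (fs (nth 0 s (a.+1 * K)) _); first by [].
  by apply: ltM; rewrite (leq_trans _ KM) // ltn_pmul2r.
pose gd a := del g (q0 (c a)) (q0 (c a).+1).
have /choice[S SP] : forall a, exists S : {set T}, a <= d -> sep (gd a) A B S && (#|S| < N).
  move=> a; have [ad|] := leqP a d; last by exists set0.
  have [_ _ h] := cP' a ad; have := crucial _ _ (adj _ _ Q0 (csz a ad)) h.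
  rewrite negb_forall => /existsP[S]; rewrite negb_imply -ltnNge => hS.
  by exists S.
have gds a : symmetric (gd a) by apply: del_sym.
have gdQ a i j : a <= d -> i < N -> i != rho 0 -> j.+1 < size (Q i) ->
    gd a (nth x0 (Q i) j) (nth x0 (Q i) j.+1).
  move=> ad iN ir js; have := adj i j iN js; rewrite /gd /del /= => ->; apply: contraNneq ir => eq.
  have : nth x0 (Q i) j \in Q (rho 0).
    have cs := csz a ad; have := set21 (nth x0 (Q i) j) (nth x0 (Q i) j.+1).
    by rewrite eq => /set2P[] ->; rewrite mem_nth // ltnW.
  by move=> m; apply/eqP; apply: djQ m => //; rewrite mem_nth // ltnW.
have gdQ0 a j : a <= d -> j != c a -> j.+1 < size (Q (rho 0)) -> gd a (q0 j) (q0 j.+1).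
  move=> ad jc js; have := adj _ j Q0 js; rewrite /gd /del /= => ->; apply: contraNneq jc => eq.
  have cs := csz a ad; have uq := unQ _ Q0.
  have nE i1 i2 : i1 < size (Q (rho 0)) -> i2 < size (Q (rho 0)) -> q0 i1 = q0 i2 -> i1 = i2.
    by move=> h1 h2 /eqP; rewrite nth_uniq // => /eqP.
  have := set21 (q0 j) (q0 j.+1); rewrite eq => /set2P[] /nE h1; first by apply/eqP; apply: h1; lia.
  have := set22 (q0 j) (q0 j.+1); rewrite eq => /set2P[] /nE h2.
    by have := h1 _ _; have := h2 _ _; lia.
  by have := h2 _ _; lia.
pose RA a x := exists y, [/\ y \in A, y \notin S a & connect (restr (gd a) (~: S a)) y x].
pose RB a x := exists y, [/\ y \in B, y \notin S a & connect (restr (gd a) (~: S a)) y x].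
have csym a : connect_sym (restr (gd a) (~: S a)) by apply: connect_restr_sym.
have RAB a x : a <= d -> RA a x -> RB a x -> False.
  move=> ad [y [yA yS yx]] [z [zB zS zx]]; have /andP[/forall_inP sp _] := SP a ad.
  have := sp y; rewrite inE yA yS => /(_ isT)/forall_inP/(_ z); rewrite inE zB zS => /(_ isT)/negP[].
  by apply: connect_trans yx _; rewrite csym.
have hitS a i : a <= d -> i < N -> i != rho 0 -> exists2 j, j < size (Q i) & nth x0 (Q i) j \in S a.
  move=> ad iN ir; apply: contrapT => none; have := abQ i iN; rewrite (abpathE x0).
  case/and4P=> Qn hA _ lB.
  have nS j : j < size (Q i) -> nth x0 (Q i) j \notin S a.
    by move=> js; apply/negP=> jS; apply: none; exists j.
  have s0 : 0 < size (Q i) by case: (Q i) Qn.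
  apply: (RAB a (last x0 (Q i)) ad); last first.
    by exists (last x0 (Q i)); rewrite lB -nth_last nS ?connect0 // prednK.
  exists (head x0 (Q i)); rewrite hA -nth0 nS // -nth_last; split=> //.
  apply: (connect_steps (f := nth x0 (Q i))) => // j /andP[_ js].
  by apply/and3P; split; [rewrite inE nS //; lia | rewrite inE nS //; lia | apply: gdQ => //; lia].
have /choice[h hP] : forall ai : nat * nat, exists j, ai.1 <= d -> ai.2 < N -> ai.2 != rho 0 ->
    j < size (Q ai.2) /\ nth x0 (Q ai.2) j \in S ai.1.
  move=> [a i] /=; have [ad|] := leqP a d; last by exists 0.
  have [iN|] := ltnP i N; last by exists 0.
  have [->|ir] := eqVneq i (rho 0); first by exists 0.
  by have [j js jS] := hitS a i ad iN ir; exists j.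
(* The N - 1 paths other than [Q (rho 0)] survive the deletion and all meet [S a], which has at most
   N - 1 vertices. So it has exactly one on each of them and none elsewhere. *)
have onS a z : a <= d -> z \in S a -> exists i, [/\ i < N, i != rho 0 & z = nth x0 (Q i) (h (a, i))].
  move=> ad zS; apply: contrapT => none.
  pose F (i : 'I_N) := if (i : nat) == rho 0 then z else nth x0 (Q i) (h (a, nat_of_ord i)).
  have FS i : F i \in S a.
    rewrite /F; case: eqP => // /eqP ir.
    by have [] := hP (a, nat_of_ord i) ad (ltn_ord i) ir.
  have Fz (i : 'I_N) : (i : nat) != rho 0 -> F i != z.
    move=> ir; apply/eqP=> eq; apply: none; exists i; split=> //.
    by rewrite -eq /F (negbTE ir).
  have FI : injective F.
    move=> i j; have [ei|ir] := eqVneq (i : nat) (rho 0); have [ej|jr] := eqVneq (j : nat) (rho 0).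
    - by move=> _; apply: val_inj; rewrite /= ei ej.
    - by rewrite {1}/F ei eqxx => /esym/eqP; rewrite (negbTE (Fz j jr)).
    - by rewrite {2}/F ej eqxx => /eqP; rewrite (negbTE (Fz i ir)).
    rewrite /F (negbTE ir) (negbTE jr) => eq; apply: val_inj; have iN := ltn_ord i; have jN := ltn_ord j.
    have [h1 _] := hP (a, nat_of_ord i) ad iN ir; have [h2 _] := hP (a, nat_of_ord j) ad jN jr.
    by apply: (djQ i j (nth x0 (Q i) (h (a, nat_of_ord i)))) => //; rewrite ?mem_nth // eq mem_nth.
  have /andP[_] := SP a ad; rewrite ltnNge => /negP[].
  rewrite -[X in X <= _]card_ord -(card_imset (mem 'I_N) FI).
  by apply: subset_leq_card; apply/subsetP=> _ /imsetP[i _ ->].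
(* The last position of row i that counts as lying before the cut a: the start of the deleted edge
   on row 0, the separator vertex on any other row. *)
pose kap a i := if i == 0 then c a else h (a, rho i).
have rne i : i < n -> i != 0 -> rho i != rho 0.
  by move=> iN i0; apply: contra i0 => /eqP/rhoI eq; rewrite eq.
have notS a i j : a <= d -> i < n -> j < size (Q (rho i)) -> (i == 0) || (j != kap a i) ->
    nth x0 (Q (rho i)) j \notin S a.
  move=> ad iN js cnd; apply/negP=> /(onS a _ ad)[i' [iN' ir' eq]].
  have [h1 _] := hP (a, i') ad iN' ir'; rewrite /= in h1.
  have ei : rho i = i'.
    by apply: (djQ _ _ (nth x0 (Q (rho i)) j)); rewrite ?rhoN ?mem_nth // eq mem_nth.
  subst i'; have i0 : i != 0 by apply: contraNneq ir' => ->.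
  move/eqP: eq; rewrite nth_uniq ?unQ ?rhoN // => /eqP ej.
  by move: cnd; rewrite /kap (negbTE i0) ej eqxx.
have gdR a i j : a <= d -> i < n -> j.+1 < size (Q (rho i)) -> (i == 0) ==> (j != c a) ->
    gd a (nth x0 (Q (rho i)) j) (nth x0 (Q (rho i)) j.+1).
  move=> ad iN js; have [i0|i0] := eqVneq i 0; last first.
    by move=> _; apply: gdQ => //; [apply: rhoN | apply: rne].
  by subst i => jc; apply: gdQ0.
have low a i j : a <= d -> i < n -> j < size (Q (rho i)) -> j <= kap a i ->
    nth x0 (Q (rho i)) j \notin S a -> RA a (nth x0 (Q (rho i)) j).
  move=> ad iN js jk jS; have := abQ _ (rhoN i iN); rewrite (abpathE x0) => /and4P[_ hA _ _].
  have nS j' : j' <= j -> nth x0 (Q (rho i)) j' \notin S a.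
    rewrite leq_eqVlt => /predU1P[->//|jj]; apply: notS => //; lia.
  exists (head x0 (Q (rho i))); rewrite hA -nth0 nS //; split=> //.
  apply: (connect_steps (f := nth x0 (Q (rho i)))) => // j' /andP[_ jj].
  apply/and3P; split; [rewrite inE nS //; lia | rewrite inE nS //; lia |].
  by apply: gdR => //; [lia | apply/implyP; move: jk; rewrite /kap => + i0; rewrite i0; lia].
have high a i j : a <= d -> i < n -> j < size (Q (rho i)) -> kap a i < j ->
    RB a (nth x0 (Q (rho i)) j).
  move=> ad iN js jk; have := abQ _ (rhoN i iN); rewrite (abpathE x0) => /and4P[_ _ _ lB].
  have nS j' : j <= j' -> j' < size (Q (rho i)) -> nth x0 (Q (rho i)) j' \notin S a.
    by move=> jj js'; apply: notS => //; lia.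
  exists (last x0 (Q (rho i))); rewrite lB -nth_last nS //; try lia; split=> //.
  rewrite csym; apply: (connect_steps (f := nth x0 (Q (rho i)))); first lia.
  move=> j' /andP[jj js']; apply/and3P; split; [rewrite inE nS //; lia | rewrite inE nS //; lia |].
  by apply: gdR => //; [lia | apply/implyP; move: jk; rewrite /kap => + i0; rewrite i0; lia].
have PsC a k x y : a <= d -> k < M -> [disjoint Ps k & S a] -> x \in Ps k -> y \in Ps k ->
    connect (restr (gd a) (~: S a)) x y.
  move=> ad kM dk xk yk; apply: connect_mono (conn_connect (cP k kM) xk yk) => u v.
  case/and3P=> uk vk guv; have := disjoint_setI0 dk => dk'.
  apply/and3P; split; rewrite ?inE.
  - by apply/negP=> uS; have := in_set0 u; rewrite -dk' inE uk uS.
  - by apply/negP=> vS; have := in_set0 v; rewrite -dk' inE vk vS.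
  rewrite /gd /del /= guv; apply/eqP=> eq; have [_ _ h3] := cP' a ad.
  have uv z : z \in [set u; v] -> z \in Ps k by case/set2P=> ->.
  by case/negP: h3; rewrite (sameP k) ?uv // eq ?set21 ?set22.
have nPS a k x : [disjoint Ps k & S a] -> x \in Ps k -> x \notin S a.
  by move=> dk xk; apply/negP=> xS; have := in_set0 x; rewrite -(disjoint_setI0 dk) inE xk xS.
(* A set of the family that avoids [S a] stays connected after the deletion, as the deleted edge is
   inside no set. Its first vertex on row 0 therefore decides on which side of the cut it meets all
   rows. *)
have sideL a k i j : a <= d -> k < M -> [disjoint Ps k & S a] -> f k <= c a -> i < n ->
    j < size (Q (rho i)) -> nth x0 (Q (rho i)) j \in Ps k -> j <= kap a i.
  move=> ad kM dk fk iN js jP; rewrite leqNgt; apply/negP=> kj.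
  apply: (RAB a _ ad) (high a i j ad iN js kj).
  have [y [yA yS yc]] := low a 0 (f k) ad n0 (fs k kM) fk (nPS _ _ _ dk (fP k kM)).
  by exists y; split=> //; apply: connect_trans yc _; apply: PsC dk (fP k kM) jP.
have sideH a k i j : a <= d -> k < M -> [disjoint Ps k & S a] -> c a < f k -> i < n ->
    j < size (Q (rho i)) -> nth x0 (Q (rho i)) j \in Ps k -> kap a i < j.
  move=> ad kM dk fk iN js jP; rewrite ltnNge; apply/negP=> kj.
  apply: (RAB a _ ad (low a i j ad iN js kj (nPS _ _ _ dk jP))).
  have [y [yA yS yc]] := high a 0 (f k) ad n0 (fs k kM) fk.
  by exists y; split=> //; apply: connect_trans yc _; apply: PsC dk (fP k kM) jP.
(* The layer t is taken from block t + 1, which lies between the cuts t and t + 1 on row 0, and it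
   avoids all separators. *)
have /choice[kt ktP] : forall t, exists k, t < d ->
    [/\ k < M, c t < f k, f k <= c t.+1 & forall a, a <= d -> [disjoint Ps k & S a]].
  move=> t; have [td|] := ltnP t d; last by exists 0.
  pose l := take K (drop (t.+1 * K) s).
  have tK : t.+2 * K <= M by apply: leq_trans KM; rewrite leq_pmul2r; lia.
  have eK : t.+2 * K = K + t.+1 * K by rewrite mulSn.
  have szl : size l = K.
    rewrite size_take size_drop sM; case: ltnP => // hh; apply/eqP; rewrite eqn_leq hh.
    have tK' : t.+1 * K <= M by apply: leq_trans tK; rewrite eK leq_addl.
    by rewrite leq_subRL // addnC -eK.
  have lE k : k \in l -> exists i, [/\ t.+1 * K <= i, i < t.+2 * K & k = nth 0 s i].
    move/(nthP 0)=> [i il <-]; exists (t.+1 * K + i); move: il.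
    rewrite szl => iK; rewrite nth_take // nth_drop leq_addr; split=> //.
    by rewrite eK addnC ltn_add2r.
  have [||| k kl dk] := @pick_disjoint_avoid Ps (\bigcup_(a < d.+1) S a) l.
  - by rewrite take_uniq // drop_uniq.
  - move=> k k' x /lE[i [_ iK ->]] /lE[j [_ jK ->]]; apply: dP; apply: ltM; lia.
  - rewrite szl ltnS mulnC; apply: leq_trans (_ : \sum_(a < d.+1) #|S a| <= _).
      elim/big_rec2: _ => [|a m X _ IH]; first by rewrite cards0.
      by apply: leq_trans (leq_card_setU _ _).1 _; rewrite leq_add2l.
    rewrite -[X in _ <= X * _]card_ord -sum_nat_const; apply: leq_sum => a _.
    by have /andP[_ /ltnW] := SP a (ltn_ord a).
  exists k => _; have [i [i1 i2 ek]] := lE k kl; have iM : i < M by lia.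
  have [_ c1 _] := cP' t (ltnW td); have [c2 _ _] := cP' t.+1 td.
  split; first by rewrite ek ltM.
  - rewrite ek; apply: leq_trans c1 _; move: i1; rewrite leq_eqVlt => /predU1P[->//|i1].
    by apply: ltnW; apply: sf.
  - rewrite ek; apply: leq_trans c2; have : i <= (t.+2 * K).-1 by lia.
    rewrite leq_eqVlt => /predU1P[->//|i3]; apply: ltnW; apply: sf => //; lia.
  move=> a ad; rewrite disjoint_sym; apply: disjointWl _ (_ : [disjoint \bigcup_(a < d.+1) S a & Ps k]).
    by apply: (bigcup_sup (Ordinal (ad : a < d.+1))).
  by rewrite disjoint_sym.
have hitI t i : t < d -> i < n -> exists j, [/\ j < size (Q (rho i)), kap t i < j, j <= kap t.+1 i &
    nth x0 (Q (rho i)) j \in Ps (kt t)].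
  move=> td iN; have [kM k1 k2 dk] := ktP t td; have [x xk xq] := hits _ i kM iN.
  have js : index x (Q (rho i)) < size (Q (rho i)) by rewrite index_mem.
  exists (index x (Q (rho i))); rewrite nth_index //; split=> //.
    by apply: (sideH t (kt t)) => //; rewrite ?nth_index ?dk // ltnW.
  by apply: (sideL t.+1 (kt t)) => //; rewrite ?nth_index ?dk.
have kapS t i : t < d -> i < n -> kap t i < kap t.+1 i.
  by move=> td iN; have [j [_ j1 j2 _]] := hitI t i td iN; apply: leq_trans j2.
have kapM t t' i : i < n -> t <= t' -> t' <= d -> kap t i <= kap t' i.
  move=> iN; elim: t' => [|t' IH]; first by rewrite leqn0 => /eqP->.
  rewrite leq_eqVlt => /predU1P[->//|tt] td; apply: leq_trans (IH tt (ltnW td)) _.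
  exact/ltnW/kapS.
have kapZ t i : t <= d -> i < n -> kap t i < size (Q (rho i)).
  move=> td iN; rewrite /kap; case: eqP => [->|/eqP i0]; first exact: ltnW (csz t td).
  by have [] := hP (t, rho i) td (rhoN i iN) (rne i iN i0).
exists (fun i t => interval (Q (rho i)) (kap t i) (kap t.+1 i)), (fun t => Ps (kt t)).
have sorted_row i : i < n -> sorted g (Q (rho i)).
  by move=> iN; have := abQ _ (rhoN i iN); rewrite (abpathE x0) => /and4P[].
have cI i t : i < n -> t < d -> conn g (interval (Q (rho i)) (kap t i) (kap t.+1 i)).
  by move=> iN td; apply: conn_interval; rewrite ?sorted_row ?unQ ?rhoN ?kapS ?kapZ.
have mI i t j : i < n -> t < d -> kap t i < j -> j <= kap t.+1 i ->
    nth x0 (Q (rho i)) j \in interval (Q (rho i)) (kap t i) (kap t.+1 i).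
  move=> iN td j1 j2; have js : j < size (Q (rho i)) by apply: leq_ltn_trans j2 (kapZ _ _ td iN).
  by rewrite inE mem_nth // index_uniq ?unQ ?rhoN // j1 j2.
split=> //.
- move=> i t iN td; have td' := ltnW td.
  apply: (conn_unionE gs (cI _ _ iN td') (cI _ _ iN td) (mI i t (kap t.+1 i) _ _ _ _)
    (mI i t.+1 (kap t.+1 i).+1 _ _ _ _)) => //; rewrite ?kapS //.
  by apply: adj; [apply: rhoN | apply: leq_ltn_trans (kapZ t.+2 i td iN); apply: kapS].
- by move=> t td; apply: cP; have [] := ktP t td.
- move=> i t iN td; have [j [js j1 j2 jP]] := hitI t i td iN.
  by exists (nth x0 (Q (rho i)) j) => //; apply: mI.
split.
- move=> i t j t' x iN td jN td'; rewrite !inE => /and3P[xi x1 x2] /and3P[xj x3 x4].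
  have ij : i = j by apply: rhoI => //; apply: djQ xi xj; rewrite rhoN.
  split=> //; subst j; have [tt|tt|//] := ltngtP t t'.
    by have := kapM _ _ _ iN tt (ltnW td'); lia.
  by have := kapM _ _ _ iN tt (ltnW td); lia.
- move=> t t' x td td' xt xt'; have [k1 k2 k3 _] := ktP t td; have [k1' k2' k3' _] := ktP t' td'.
  have ek : kt t = kt t' by apply: dP xt xt'.
  rewrite ek in k2 k3; have [tt|tt|//] := ltngtP t t'.
    by have := kapM _ _ 0 n0 tt (ltnW td'); rewrite /kap /=; lia.
  by have := kapM _ _ 0 n0 tt (ltnW td); rewrite /kap /=; lia.
move=> i t t' x iN td td' xl; rewrite inE => /and3P[xq x1 x2].
have [kM k1 k2 dk] := ktP t' td'.
have js : index x (Q (rho i)) < size (Q (rho i)) by rewrite index_mem.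
have xk : nth x0 (Q (rho i)) (index x (Q (rho i))) \in Ps (kt t') by rewrite nth_index.
have h1 := sideH t' _ i _ (ltnW td') kM (dk _ (ltnW td')) k1 iN js xk.
have h2 := sideL t'.+1 _ i _ td' kM (dk _ td') k2 iN js xk.
have [tt|tt|//] := ltngtP t t'.
  by have := kapM _ _ _ iN tt (ltnW td'); lia.
by have := kapM _ _ _ iN tt (ltnW td); lia.
Qed.

End Slabs.

Lemma pigeonhole (C : finType) (f : nat -> C) M K : #|C| * K < M ->
  exists c, K < size [seq k <- iota 0 M | f k == c].
Proof.
move=> CM; apply: contrapT => none; move: CM; apply/negP; rewrite -leqNgt.
have sumE (s : seq nat) : \sum_(c : C) count (fun k => f k == c) s = size s.
  elim: s => [|a s IH] /=; first by rewrite big1.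
  by rewrite big_split /= IH (bigD1 (f a)) //= eqxx big1 // => c; rewrite eq_sym => /negbTE->.
rewrite -[X in X <= _](size_iota 0) -sumE -sum_nat_const; apply: leq_sum => c _.
by rewrite -size_filter leqNgt; apply/negP=> h; apply: none; exists c.
Qed.

(** Many paths for the last pair are compared with an N-linkage for each earlier pair, thinned down
    to crucial edges apart from those inside these paths. Either one path meets few paths of every
    linkage and can be set aside for the induction, or many of them cross the same n rows of one
    linkage, and [slabs] applies. *)
Lemma linkage_choice n d L : 0 < n -> exists f, forall (T : finType) (e : rel T), symmetric e ->
  forall A B : nat -> {set T}, (forall l, l < L -> linked e (A l) (B l) f) ->
  pseudogrid e n d \/ exists ps : nat -> seq T,
    (forall l, l < L -> abpath e (A l) (B l) (ps l) /\ uniq (ps l)) /\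
    (forall l l' x, l < L -> l' < L -> x \in ps l -> x \in ps l' -> l = l').
Proof.
move=> n0; elim: L => [|L [f' IH]]; first by exists 0 => T e es A B _; right; exists (fun _ => [::]).
pose N := f' + n; pose K0 := d.+2 * (N * d.+1).+1.
pose M := (#|{: 'I_L.+1 * {set 'I_N}}| * K0).+1.
exists (M + N) => T e es A B lk.
have [P lP] := menger es (lk L (ltnSn L)); have [abP unP djP] := lP.
have MN k : k < M -> k < M + N by move=> kM; apply: leq_trans kM (leq_addr _ _).
pose same : rel T := fun u v => [exists k : 'I_M, (u \in P k) && (v \in P k)].
have sameP k u v : k < M -> u \in P k -> same u v = (v \in P k).
  move=> kM uk; apply/existsP/idP => [[k' /andP[uk' vk']]|vk].
    by rewrite (djP k k' u (MN _ kM) (MN _ (ltn_ord k'))).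
  by exists (Ordinal kM); rewrite uk vk.
pose h := [rel u v | e u v && same u v].
have hs : symmetric h.
  by move=> u v; rewrite /h /= es; congr (_ && _); apply: eq_existsb => k; rewrite andbC.
have /choice[g gP] : forall l, exists g : rel T, l < L -> [/\ symmetric g, subrel h g, subrel g e,
    linked g (A l) (B l) N & forall u v, g u v -> ~~ h u v -> ~~ linked (del g u v) (A l) (B l) N].
  move=> l; have [lL|] := ltnP l L; last by exists e.
  have l' : linked e (A l) (B l) N by apply: linked_le (lk l (ltnW lL)); rewrite leq_addl.
  have [|g gP] := thin es hs _ l'; first by move=> u v /andP[].
  by exists g.
have /choice[Q QP] : forall l, exists Q : nat -> seq T, l < L -> linkage (g l) (A l) (B l) N Q.
  move=> l; have [lL|] := ltnP l L; last by exists (fun _ => [::]).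
  have [gs _ _ lg _] := gP l lL; have [Q lQ] := menger gs lg; by exists Q.
pose pat k l : {set 'I_N} := [set i : 'I_N | has (mem (P k)) (Q l i)].
(* Such a [P k] is avoided by at least N - n = f' paths of each linkage, as the induction hypothesis
   requires after [P k] is deleted. *)
have [[k [kM good]]|bad] := pselect (exists k, k < M /\ forall l, l < L -> #|pat k l| < n).
  pose X := ~: [set z in P k]; pose e' := restr e X.
  have es' : symmetric e' by apply: restr_sym.
  have [|pg|[ps [ab dj]]] := IH T e' es' (fun l => A l :&: X) (fun l => B l :&: X).
  - move=> l lL; have [gs hg ge _ _] := gP l lL; have [abQ unQ djQ] := QP l lL.
    have : f' <= size (enum (~: pat k l)).
      by rewrite -cardE cardsCs setCK card_ord; have := good l lL; rewrite /N; lia.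
    move=> sz; have [i0|i0] := posnP N; first by apply/linkedP=> Y _; rewrite /N in i0; lia.
    pose r i := nth (Ordinal i0) (enum (~: pat k l)) i.
    have rP i x : i < f' -> x \in Q l (r i) -> x \in X.
      move=> fi xQ; rewrite !inE; have : r i \in ~: pat k l.
        by rewrite -mem_enum mem_nth // (leq_trans fi).
      by rewrite !inE; apply: contra => xP; apply/hasP; exists x.
    apply: (@linkage_linked _ _ _ _ _ (fun i => Q l (r i))); split.
    + move=> i fi; have := abQ (r i) (ltn_ord _); have := rP i; case: (Q l (r i)) => //= x q mX.
      case/and3P=> xA pq lB; have xX : x \in X by apply: mX; rewrite // mem_head.
      have lX := mX _ fi (mem_last x q).
      rewrite !in_setI xA lB lX xX /= andbT path_restr // (sub_path ge) //; apply/allP=> y yq.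
      by apply: mX; rewrite // inE yq orbT.
    + by move=> i fi; apply: unQ.
    move=> i j v fi fj vi vj; have /val_inj/eqP := djQ _ _ v (ltn_ord _) (ltn_ord _) vi vj.
    rewrite /r nth_uniq ?enum_uniq //; try exact: leq_trans sz.
    by move/eqP.
  - by left; apply: pseudogrid_mono pg => u v /and3P[].
  right; exists (fun l => if l == L then P k else ps l).
  have lX l x : l < L -> x \in ps l -> x \notin P k.
    move=> lL; have [abl _] := ab l lL; case: (ps l) abl => //= y q /and3P[/setIP[_ yX] pq _].
    move: pq; rewrite path_restr // => /andP[_ /allP allX]; rewrite inE => /predU1P[->|/allX].
      by move: yX; rewrite !inE.
    by rewrite !inE.
  split=> [l|l l' x].
    rewrite ltnS leq_eqVlt; case: eqP => [-> _|_ /= lL]; first by rewrite abP ?unP ?MN.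
    have [abl ul] := ab l lL; split=> //; case: (ps l) abl => //= y q.
    case/and3P=> /setIP[-> _] pq /setIP[-> _]; rewrite andbT /=.
    by apply: sub_path pq => u v /and3P[].
  rewrite !ltnS leq_eqVlt (leq_eqVlt l'); case: eqP => [-> _|_ /= lL]; case: eqP => [-> _|_ /= lL'] //.
  - by move=> xP /(lX _ _ lL'); rewrite xP.
  - by move=> /(lX _ _ lL) /negbTE->.
  exact: dj.
left; have /choice[lf lfP] : forall k, exists l, k < M -> l < L /\ n <= #|pat k l|.
  move=> k; have [kM|] := ltnP k M; last by exists 0.
  apply: contrapT => none; apply: bad; exists k; split=> // l lL; rewrite ltnNge.
  by apply/negP=> h'; apply: none; exists l.
(* Paths with the same code cross the same linkage in the same set of rows; M was chosen so that
   more than [K0] of them agree. *)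
pose code k : 'I_L.+1 * {set 'I_N} := (inord (lf k), pat k (lf k)).
have [[l0 X]] := @pigeonhole _ code M K0 (ltnSn _).
set ks := [seq k <- _ | _] => szk.
have ksP k : k \in ks -> [/\ k < M, lf k = l0, l0 < L & pat k l0 = X].
  rewrite mem_filter mem_iota /= add0n => /andP[/eqP[e1 e2] kM].
  have [lL _] := lfP k kM; have e3 : lf k = l0 by rewrite -e1 inordK // ltnW.
  by rewrite -e3.
have uks : uniq ks by rewrite filter_uniq // iota_uniq.
pose k0 := nth 0 ks 0; have k0P : k0 \in ks by rewrite mem_nth // (leq_trans _ szk).
have [k0M lk0 lL X0] := ksP _ k0P.
have Xn : n <= size (enum X).
  by rewrite -cardE -X0 -lk0; have [] := lfP k0 k0M.
have [gs hg ge lg ming] := gP l0 lL; have lQ := QP l0 lL.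
have N0 : 0 < N by rewrite /N; lia.
pose rho i : nat := nth (Ordinal N0) (enum X) i.
apply: (pseudogrid_mono ge).
apply: (slabs (Ps := fun j => [set z in P (nth 0 ks j)]) (same := same) (M := K0) (rho := rho) gs lQ n0).
- by move=> i _; apply: ltn_ord.
- move=> i j iN jN /val_inj/eqP; rewrite nth_uniq ?enum_uniq //; try exact: leq_trans Xn.
  by move/eqP.
- move=> j jK; have [kM _ _ _] := ksP _ (mem_nth 0 (ltn_trans jK szk)).
  set k := nth 0 ks j in kM *; have := abP k (MN _ kM).
  case E: (P k) => [//|x q] /= /and3P[_ pq _]; rewrite -E.
  have cP : conn e [set z in P k] by rewrite E; apply: path_conn.
  rewrite -(conn_restr _ (subxx _)) in cP; rewrite -(conn_restr _ (subxx _)).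
  apply: conn_mono cP => u v /and3P[uP vP euv]; apply/and3P; split=> //; apply: hg.
  by rewrite /h /= euv; rewrite !inE in uP vP; rewrite (sameP k).
- move=> i j x iK jK; rewrite !inE => xi xj.
  have [iM _ _ _] := ksP _ (mem_nth 0 (ltn_trans iK szk)).
  have [jM _ _ _] := ksP _ (mem_nth 0 (ltn_trans jK szk)).
  have /eqP := djP _ _ _ (MN _ iM) (MN _ jM) xi xj; rewrite nth_uniq //; try exact: ltn_trans szk.
  by move/eqP.
- move=> j u v jK; rewrite !inE; apply: sameP.
  by have [] := ksP _ (mem_nth 0 (ltn_trans jK szk)).
- by move=> u v guv ns; apply: ming; rewrite // /h /= (negbTE ns) andbF.
- move=> j i jK iN; have [_ _ _ ep] := ksP _ (mem_nth 0 (ltn_trans jK szk)).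
  have : nth (Ordinal N0) (enum X) i \in pat (nth 0 ks j) l0.
    by rewrite ep -mem_enum mem_nth // (leq_trans iN).
  rewrite inE => /hasP[x xQ xP]; by exists x; rewrite // inE.
exact: leqnn.
Qed.

(** * A path linked to a bramble by many legs *)

Section PathAndLegs.
Variables (T : finType) (e : rel T).
Hypothesis es : symmetric e.
Implicit Types (A B S X Y : {set T}) (F : {set {set T}}) (p q : seq T).

Lemma linkage_trim A B k P : linkage e A B k P -> exists2 P', linkage e A B k P' &
  forall i v, i < k -> v \in P' i -> v \in B -> forall x, last x (P' i) = v.
Proof.
case=> ab un dj.
have /choice[P' hP] : forall i, exists p, i < k ->
    [/\ abpath e A B p, uniq p, {subset p <= P i} &
        forall v, v \in p -> v \in B -> forall x, last x p = v].
  move=> i; have [ik|] := ltnP i k; last by exists [::].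
  move: (ab i ik) (un i ik); case: (P i) => // x q /and3P[xA pq lB] uq.
  have [xB|xB] := boolP (x \in B).
    exists [:: x] => _; split=> //=; first by rewrite xA xB.
      by move=> v; rewrite inE => /eqP->; apply: mem_head.
    by move=> v; rewrite inE => /eqP->.
  have hq : has (mem B) q.
    by apply/hasP; exists (last x q) => //; have := mem_last x q; rewrite inE => /predU1P[ex|//];
      rewrite ex (negbTE xB) in lB.
  case: (split_find hq) pq uq => y s1 s2; change (mem B y) with (y \in B) => yB nB pq uq.
  exists (x :: rcons s1 y) => _; split.
  - rewrite /= xA last_rcons yB andbT; move: pq; rewrite cat_path => /andP[-> _]; done.
  - by move: uq; rewrite -cat_cons cat_uniq => /andP[].
  - by move=> v; rewrite !inE mem_cat => /orP[->|->]; rewrite ?orbT.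
  move=> v; rewrite inE mem_rcons inE => /predU1P[->|/predU1P[->|vs]] vB z.
  - by rewrite vB in xB.
  - by rewrite /= last_rcons.
  by case/hasP: nB; exists v.
exists P'; last by move=> i v ik; have [_ _ _] := hP i ik; apply.
split=> [i /hP[]//|i /hP[]//|i j v ik jk vi vj].
have [_ _ si _] := hP i ik; have [_ _ sj _] := hP j jk.
by apply: dj (si _ vi) (sj _ vj).
Qed.

(** A path that meets a member [S0] only in its end is prolonged inside [S0] up to the first vertex
    of a member [S1] missed so far. It then meets [S1] only in its new end. *)
Lemma path_hits F : F != set0 -> {in F, forall S, conn e S} ->
  {in F &, forall S1 S2, S1 :&: S2 != set0} ->
  exists p, [/\ sorted e p, uniq p & {in F, forall S, has (mem S) p}].
Proof.
move=> F0 cF iF.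
have grow x p S0 : S0 \in F -> path e x p -> uniq (x :: p) ->
    (forall v, v \in x :: p -> v \in S0 -> v = last x p) -> last x p \in S0 ->
    exists q, [/\ sorted e q, uniq q & {in F, forall S, has (mem S) q}].
  have [m] := ubnP #|[set S in F | ~~ has (mem S) (x :: p)]|.
  elim: m p S0 => // m IH p S0 hm S0F pp up only lS0.
  have [/set0Pn[S1]|] := boolP ([set S in F | ~~ has (mem S) (x :: p)] != set0); last first.
    rewrite negbK => /eqP all; exists (x :: p); split=> // S SF; apply: contraT => nS.
    by have := in_set0 S; rewrite -all inE SF nS.
  rewrite inE => /andP[S1F nS1].
  have /set0Pn[z /setIP[z0 z1]] := iF _ _ S0F S1F.
  have [q [pq lq uq sq]] := conn_path (cF _ S0F) lS0 z0.
  have lS1 : last x p \notin S1.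
    by apply: contra nS1 => lS1; apply/hasP; exists (last x p); rewrite ?mem_last.
  have hq : has (mem S1) q.
    apply/hasP; exists z => //; have := mem_last (last x p) q; rewrite lq inE.
    by case/predU1P=> // ez; rewrite -ez z1 in lS1.
  case: (split_find hq) pq uq sq => y s1 s2 yS1 nB pq uq sq.
  apply: (IH (p ++ rcons s1 y) S1) => //.
  - rewrite ltnS in hm; apply: leq_trans hm; apply: proper_card; apply/properP; split.
      apply/subsetP=> S; rewrite 2!inE => /andP[SF nS]; rewrite SF; apply: contra nS.
      by rewrite -cat_cons has_cat => ->.
    exists S1; first by rewrite inE S1F.
    by rewrite inE S1F negbK -cat_cons has_cat has_rcons [mem S1 y]yS1 orbT.
  - by rewrite cat_path pp; move: pq; rewrite cat_path => /andP[].
  - have ur : uniq (last x p :: rcons s1 y) by move: uq; rewrite -cat_cons cat_uniq => /and3P[].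
    have [nl {}ur] : last x p \notin rcons s1 y /\ uniq (rcons s1 y) by apply/andP.
    rewrite -cat_cons cat_uniq up ur andbT /=; apply/hasPn=> v vr.
    apply: contra nl => vp; rewrite -(only v vp) //; apply: sq.
    by rewrite inE mem_cat vr orbT.
  - move=> v; rewrite -cat_cons mem_cat last_cat last_rcons => /orP[vp vS1|].
      by case/hasP: nS1; exists v.
    by rewrite mem_rcons inE => /predU1P[//|vs vS1]; case/hasP: nB; exists v.
  - by rewrite last_cat last_rcons.
have [S0 S0F] := set0Pn _ F0; have [x x0] := conn_neq0 (cF _ S0F).
by apply: (grow x [::] S0) => // v; rewrite inE => /eqP.
Qed.

Variables (F : {set {set T}}) (N : nat).
Hypotheses (cF : {in F, forall S, conn e S})
  (iF : {in F &, forall S1 S2, S1 :&: S2 != set0})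
  (oF : forall Y : {set T}, {in F, forall S, S :&: Y != set0} -> N <= #|Y|).

(** The haven of the bramble: all members avoiding Y lie in a single component of the complement of
    Y, and this is that component when |Y| < N. *)
Definition beta Y : {set T} :=
  [set x | [exists S in F, [disjoint S & Y] && [exists s in S, connect (restr e (~: Y)) s x]]].

Lemma bramble_avoid Y : #|Y| < N -> exists2 S, S \in F & [disjoint S & Y].
Proof.
move=> YN; apply: contrapT => none; move: YN; apply/negP; rewrite -leqNgt; apply: oF => S SF.
by apply/negP=> dSY; apply: none; exists S; rewrite // -setI_eq0.
Qed.

Lemma sub_setC_disjoint S Y : [disjoint S & Y] -> S \subset ~: Y.
Proof. by rewrite disjoints_subset. Qed.

Lemma beta_sub Y S : S \in F -> [disjoint S & Y] -> S \subset beta Y.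
Proof.
move=> SF dS; apply/subsetP=> s sS; rewrite inE; apply/exists_inP; exists S => //.
by rewrite dS; apply/exists_inP; exists s.
Qed.

Lemma beta_component Y S s : S \in F -> [disjoint S & Y] -> s \in S ->
  beta Y = component e (~: Y) s.
Proof.
move=> SF dS sS; apply/setP=> x; rewrite !inE; apply/exists_inP/idP => [[S' SF' /andP[dS']]|cx].
  case/exists_inP=> s' sS' cx; have /set0Pn[z /setIP[zS zS']] := iF SF SF'.
  apply: connect_trans (conn_connect_sub (cF SF) (sub_setC_disjoint dS) sS zS) _.
  by apply: connect_trans (conn_connect_sub (cF SF') (sub_setC_disjoint dS') zS' sS') _.
by exists S; rewrite // dS; apply/exists_inP; exists s.
Qed.

Lemma beta_conn Y : #|Y| < N -> conn e (beta Y).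
Proof.
case/bramble_avoid=> S SF dS; have [s sS] := conn_neq0 (cF SF).
by rewrite (beta_component SF dS sS); apply: conn_component.
Qed.

Lemma beta_out Y x : x \in beta Y -> x \notin Y.
Proof.
rewrite inE => /exists_inP[S SF /andP[dS /exists_inP[s sS cx]]].
have sY := subsetP (sub_setC_disjoint dS) s sS.
by have := connect_restr_mem sY cx; rewrite inE.
Qed.

Lemma beta_closed Y u v : u \in beta Y -> v \notin Y -> e u v -> v \in beta Y.
Proof.
move=> uY vY euv; have := beta_out uY; move: uY; rewrite !inE.
case/exists_inP=> S SF /andP[dS /exists_inP[s sS cu]] uY.
apply/exists_inP; exists S; rewrite // dS; apply/exists_inP; exists s => //.
by apply: connect_trans cu (connect1 _); rewrite /restr /= !inE uY vY.
Qed.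

Lemma beta_anti Y Y' : Y \subset Y' -> beta Y' \subset beta Y.
Proof.
move=> YY; apply/subsetP=> x; rewrite !inE.
case/exists_inP=> S SF /andP[dS /exists_inP[s sS cx]]; apply/exists_inP; exists S => //.
rewrite (disjointWr YY dS); apply/exists_inP; exists s => //.
by apply: connect_restr_mono cx; rewrite // setCS.
Qed.

Definition attach S X : {set T} := [set u in beta S | [exists x in X, e u x]].

Lemma tight_separator h : h < N -> exists p S,
  [/\ sorted e p, uniq p, #|S| = h, forall v, v \in p -> v \notin beta S
    & forall Y, #|Y| < h -> exists2 v, v \in p & v \in beta Y].
Proof.
move=> hN; have F0 : F != set0.
  by have [|S SF _] := @bramble_avoid set0; [rewrite cards0; lia | apply/set0Pn; exists S].
have [p [sp up hits]] := path_hits F0 cF iF.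
pose good l := exists2 Y : {set T}, #|Y| <= h & forall v, v \in take l p -> v \notin beta Y.
have g0 : good 0 by exists set0; rewrite ?cards0 // => v; rewrite take0.
have gp : ~ good (size p).
  case=> Y Yh; rewrite take_size => hY; have [S SF dS] := bramble_avoid (leq_ltn_trans Yh hN).
  have /hasP[v vp vS] := hits S SF; have /negP := hY v vp; apply.
  by apply: (subsetP (beta_sub SF dS)).
have [l [lp gl gl']] : exists l, [/\ l < size p, good l & ~ good l.+1].
  apply: contrapT => none; apply: gp; elim: {-2}(size p) (leqnn (size p)) => // l IH lp.
  by apply: contrapT => gl; apply: none; exists l; split=> //; apply: IH; apply: ltnW.
have [S Sh hS] := gl; have [x0 _] : exists x0, x0 \in p by case: (p) lp => // x0 q; exists x0; apply: mem_head.
have min Y : #|Y| < h -> exists2 v, v \in take l p & v \in beta Y.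
  move=> Yh; apply: contrapT => none; apply: gl'; exists (nth x0 p l |: Y).
    by rewrite cardsU1; case: (_ \notin _) => /=; lia.
  move=> v; rewrite (take_nth x0 lp) mem_rcons inE => /predU1P[->|vl].
    by apply: contraL (setU11 (nth x0 p l) Y) => /beta_out.
  apply/negP=> /(subsetP (beta_anti (subsetUr _ _))) vY.
  by apply: none; exists v.
exists (take l p), S; split=> //; first exact: take_sorted.
- exact: take_uniq.
- apply/eqP; rewrite eqn_leq Sh leqNgt; apply/negP=> /min[v vl vS].
  by have := hS v vl; rewrite vS.
Qed.

(** If Y with fewer than h vertices separated S from p, the haven of Y would still reach p. As it
    shares a bramble set with the haven of S, it would have to pass through S - Y and so enter the
    side of S, from which it cannot get to p. *)
Lemma separator_legs p S h : h + h < N -> #|S| = h ->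
  (forall v, v \in p -> v \notin beta S) ->
  (forall Y, #|Y| < h -> exists2 v, v \in p & v \in beta Y) ->
  linked (restr e (~: beta S)) S [set v in p] h.
Proof.
move=> hN Sh pS min; apply/linkedP=> Y /sepP[R [SR RY Rp clR]].
rewrite leqNgt; apply/negP=> Yh; have [v vp vY] := min Y Yh.
have [|S0 SF0 dS0] := @bramble_avoid (S :|: Y).
  by have := (leq_card_setU S Y).1; lia.
have [s0 s00] := conn_neq0 (cF SF0).
have s0S : s0 \in beta S by apply: (subsetP (beta_sub SF0 (disjointWr (subsetUl _ _) dS0))).
have s0Y : s0 \in beta Y by apply: (subsetP (beta_sub SF0 (disjointWr (subsetUr _ _) dS0))).
have [|||||a [b [aY aSR bY]]] := @conn_boundary _ e (beta Y) (beta S :|: R) s0 v.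
- by apply: beta_conn; lia.
- by [].
- by rewrite inE s0S.
- by [].
- rewrite inE negb_or pS //=; apply/negP=> vR.
  by move/setP/(_ v): Rp; rewrite !inE vR vp.
rewrite inE negb_or => /andP[bS bR] eab; case/negP: bR.
case aS: (a \in beta S).
  apply: (subsetP SR); rewrite inE (beta_out bY) /=.
  by apply: contraT => nbS; case/negP: bS; apply: beta_closed nbS eab.
apply: (clR a) => //; [by move: aSR; rewrite inE aS | exact: beta_out |].
by rewrite /restr /= ![_ \in ~: _]in_setC aS bS.
Qed.

(** For |Y| < f the set (S - X) + Y has fewer than h vertices, so its haven reaches p and must leave
    the haven of S through X. Thus no such Y cuts the centre of the haven of S off from [X1] or from
    [X2]. *)
Lemma attach_linked p S h X1 X2 f : h + h < N -> #|S| = h ->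
  (forall v, v \in p -> v \notin beta S) ->
  (forall Y, #|Y| < h -> exists2 v, v \in p & v \in beta Y) ->
  X1 \subset S -> X2 \subset S -> #|X1| = f -> #|X2| = f ->
  linked (restr e (beta S)) (attach S X1) (attach S X2) f.
Proof.
move=> hN Sh pS min XS1 XS2 X1f X2f; apply/linkedP=> Y sY.
rewrite leqNgt; apply/negP=> Yf; have fh : f <= h by rewrite -X1f -Sh subset_leq_card.
have [|S0 SF0 dS0] := @bramble_avoid (S :|: Y).
  by have := (leq_card_setU S Y).1; lia.
have [s0 s00] := conn_neq0 (cF SF0).
have s0S : s0 \in beta S by apply: (subsetP (beta_sub SF0 (disjointWr (subsetUl _ _) dS0))).
have s0Y : s0 \notin Y.
  by have := subsetP (sub_setC_disjoint (disjointWr (subsetUr _ _) dS0)) s0 s00; rewrite inE.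
have reach X : X \subset S -> #|X| = f -> exists u, [/\ u \in attach S X, u \notin Y &
    connect (restr (restr e (beta S)) (~: Y)) s0 u].
  move=> XS Xf; pose Y' := (S :\: X) :|: Y.
  have Y'h : #|Y'| < h.
    have := (leq_card_setU (S :\: X) Y).1; rewrite cardsD (setIidPr XS) Xf Sh /Y'; lia.
  have [v vp vY] := min Y' Y'h.
  have [|||||a [b [aY aC bY bC eab]]] := @conn_boundary _ e (beta Y') (component e (beta S :\: Y) s0) s0 v.
  - by apply: beta_conn; lia.
  - apply: (subsetP (beta_sub SF0 (disjointWr _ dS0)) _ s00).
    by rewrite /Y' setSU ?subsetDl.
  - exact: mem_component.
  - by [].
  - apply/negP=> vC; have := subsetP (component_sub e (_ : s0 \in beta S :\: Y)) v vC.
    by rewrite inE s0Y s0S => /(_ isT)/setDP[vS _]; have := pS v vp; rewrite vS.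
  have aS : a \in beta S :\: Y.
    by apply: (subsetP (component_sub e _) a aC); rewrite inE s0Y s0S.
  have := beta_out bY; rewrite inE negb_or inE negb_and negbK => /andP[bX bnY].
  have bS : b \in S.
    apply: contraT => nbS; case/negP: bC; apply: (component_edge aC aS _ eab).
    by rewrite inE bnY; apply: beta_closed nbS eab; case/setDP: aS.
  exists a; split; last 2 first.
  - by case/setDP: aS.
  - move: aC; rewrite inE; apply: connect_mono => x y; rewrite /restr /= !inE.
    by case/and3P=> /andP[-> ->] /andP[-> ->] ->.
  rewrite inE; case/setDP: aS => -> _ /=; apply/exists_inP; exists b => //.
  by case/orP: bX => //; rewrite bS.
have [u1 [h1 n1 c1]] := reach X1 XS1 X1f; have [u2 [h2 n2 c2]] := reach X2 XS2 X2f.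
move/forall_inP/(_ u1): sY; rewrite inE h1 n1 => /(_ isT)/forall_inP/(_ u2).
rewrite inE h2 n2 => /(_ isT)/negP; apply; apply: connect_trans c2.
by rewrite connect_restr_sym //; apply: restr_sym.
Qed.

End PathAndLegs.

Lemma sorted_conn (T : finType) (e : rel T) p :
  symmetric e -> sorted e p -> p != [::] -> conn e [set z in p].
Proof. by case: p => // x p es sp _; apply: path_conn. Qed.

Lemma block_unique q i j t : i * q < t <= i * q + q.-1 -> j * q < t <= j * q + q.-1 -> i = j.
Proof.
have [-> |q0] := posnP q; first by rewrite !muln0; lia.
by have [ij|ij|//] := ltngtP i j; have := leq_mul ij (leqnn q); rewrite mulSn; lia.
Qed.

Lemma block_bound i l r L f m : i < m -> l < L -> r < f ->
  i * (L * f).+2 < i * (L * f).+2 + (l * f + r).+1 <= i * (L * f).+2 + (L * f).+1 /\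
  i * (L * f).+2 + (l * f + r).+1 < m * (L * f).+2.
Proof.
move=> im lL rf; have h1 : l * f + f <= L * f by rewrite -mulSnr leq_mul.
have h2 : i * (L * f).+2 + (L * f).+2 <= m * (L * f).+2 by rewrite -mulSnr leq_mul.
by split; [apply/andP; split|]; lia.
Qed.

(** The path p is cut into m intervals, each carrying its own bundle of legs to S. For each ordered
    pair of intervals, f legs of either one are reserved and linked through the haven of S. If
    disjoint connections for all pairs exist, the intervals with their legs and connections are the
    branch sets of a clique. *)
Lemma clique_or_pseudogrid n d m : 0 < n -> exists N, forall (T : finType) (e : rel T),
  symmetric e -> big e N -> pseudogrid e n d \/ minor (fun i j : 'I_m => i != j) e.
Proof.
move=> n0; case: m => [|m'].
  by exists 0 => T e _ _; right; exists (fun=> set0); split=> -[].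
set m := m'.+1; pose L := m * m; have [f hf] := linkage_choice d L n0.
(* Each interval has f legs for each of the L pairs. The two further legs leave room for its
   bounding positions. *)
pose q := (L * f).+2; pose h := m * q; exists (h + h).+1 => T e es [F [cF iF oF]].
have hN : h + h < (h + h).+1 by [].
have [|p [S [sp up Sh pS min]]] := tight_separator cF iF oF (h := h); first by lia.
have [leg0 lk0] := menger (restr_sym _ es) (separator_legs es cF iF oF hN Sh pS min).
have [leg [ab un dj] trim] := linkage_trim lk0; clear leg0 lk0.
have q0 : 1 < q by [].
have h0 : 0 < h by rewrite /h /m mulSn; lia.
have [x0 _] : exists x, x \in leg 0.
  by have := ab 0 h0; case: (leg 0) => // x l _; exists x; apply: mem_head.
pose g k := index (last x0 (leg k)) p.
have legn k : k < h -> leg k != [::] by move=> /ab; case: (leg k).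
have lastl k : k < h -> last x0 (leg k) \in leg k.
  by move=> /legn; case: (leg k) => //= x l _; apply: mem_last.
have lastp k : k < h -> last x0 (leg k) \in p.
  by move=> /ab; rewrite (abpathE x0) => /and4P[_ _ _]; rewrite inE.
have gI k k' : k < h -> k' < h -> g k = g k' -> k = k'.
  move=> kh kh' /(congr1 (nth x0 p)); rewrite !nth_index ?lastp // => eq.
  by apply: (dj _ _ (last x0 (leg k))) => //; rewrite ?lastl // eq lastl.
pose s := sort (relpre g leq) (iota 0 h).
have sh : size s = h by rewrite size_sort size_iota.
have us : uniq s by rewrite sort_uniq iota_uniq.
have lth t : t < h -> nth 0 s t < h.
  by move=> th; have := mem_nth 0 (_ : t < size s); rewrite mem_sort mem_iota sh => /(_ th).
have ss : sorted (relpre g leq) s by apply: sort_sorted => x y; apply: leq_total.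
pose lg t := leg (nth 0 s t); pose pos t := g (nth 0 s t).
have posL t t' : t' < h -> t < t' -> pos t < pos t'.
  move=> th' tt; have th : t < h by lia.
  have := @sorted_leq_nth _ (relpre g leq) (fun y x z => @leq_trans (g y) (g x) (g z))
    (fun x => leqnn (g x)) 0 s ss t t'.
  rewrite !inE sh => /(_ th th' (ltnW tt)) /=; rewrite leq_eqVlt => /predU1P[eq|//].
  have /eqP := gI _ _ (lth t th) (lth t' th') eq.
  by rewrite nth_uniq ?sh //; lia.
have posI t t' : t < h -> t' < h -> (pos t < pos t') = (t < t').
  move=> th th'; have [tt|tt|->] := ltngtP t t'; rewrite ?ltnn //; first exact: posL.
  by apply/negbTE; rewrite -leqNgt; apply/ltnW/posL.
have posp t : t < h -> pos t < size p by move=> th; rewrite index_mem lastp // lth.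
have djl t t' x : t < h -> t' < h -> x \in lg t -> x \in lg t' -> t = t'.
  move=> th th' x1 x2; have /eqP := dj _ _ _ (lth t th) (lth t' th') x1 x2.
  by rewrite nth_uniq ?sh // => /eqP.
have lgp t x : t < h -> x \in lg t -> x \in p -> index x p = pos t.
  by move=> th xl xp; rewrite /pos /g (trim _ x) ?lth // inE.
have lgb t x : t < h -> x \in lg t -> x \notin beta e F S.
  move=> th; have := ab _ (lth t th); rewrite -/(lg t); case: (lg t) => // y l /and3P[yS pl _].
  have yb : y \in ~: beta e F S by rewrite inE; apply: contraL yS => /beta_out.
  move: pl; rewrite path_restr // => /andP[_ /allP al]; rewrite inE => /predU1P[->|/al].
    by rewrite inE in yb.
  by rewrite !inE.
have lgc t : t < h -> conn e [set z in lg t].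
  move=> th; apply: sorted_conn; rewrite ?legn ?lth //.
  have := ab _ (lth t th); rewrite (abpathE x0) => /and4P[_ _ sl _].
  by apply: sub_sorted sl => u v /and3P[].
pose sg t := head x0 (lg t).
have sgl t : t < h -> sg t \in lg t.
  by move=> /lth/legn; rewrite /sg /lg; case: (leg _) => //= x l _; apply: mem_head.
have sgS t : t < h -> sg t \in S.
  by move=> /lth/ab; rewrite (abpathE x0) => /and4P[].
have sgI t t' : t < h -> t' < h -> sg t = sg t' -> t = t'.
  by move=> th th' eq; apply: (djl _ _ (sg t)) => //; rewrite ?sgl // eq sgl.
have blkh i l r : i < m -> l < L -> r < f ->
    i * q < i * q + (l * f + r).+1 <= i * q + q.-1 /\ i * q + (l * f + r).+1 < h.
  exact: block_bound.
pose blk i l : {set T} := [set sg (i * q + (l * f + r).+1) | r : 'I_f].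
have blkS i l : i < m -> l < L -> blk i l \subset S.
  move=> im lL; apply/subsetP=> _ /imsetP[r _ ->].
  by apply: sgS; have [] := blkh i l r im lL (ltn_ord r).
have blkc i l : i < m -> l < L -> #|blk i l| = f.
  move=> im lL; rewrite card_imset ?card_ord // => r r' /sgI eq; apply: val_inj.
  have [_ r1] := blkh i l r im lL (ltn_ord r); have [_ r2] := blkh i l r' im lL (ltn_ord r').
  by have := eq r1 r2; rewrite /=; lia.
have am l : l < L -> l %/ m < m by move=> lL; rewrite ltn_divLR.
have bm l : l %% m < m by rewrite ltn_mod.
have [||pg|[ps [abs djs]]] := hf T (restr e (beta e F S)) _
    (fun l => attach e F S (blk (l %/ m) l)) (fun l => attach e F S (blk (l %% m) l)).
- exact: restr_sym.
- move=> l lL; apply: (attach_linked es cF iF oF hN Sh pS min); rewrite ?blkS ?blkc ?am ?bm //.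
- by left; apply: pseudogrid_mono pg => u v /and3P[].
right; have attP i l u : i < m -> l < L -> u \in attach e F S (blk i l) ->
    exists t, [/\ i * q < t <= i * q + q.-1, t < h & e u (sg t)].
  move=> im lL; rewrite inE => /andP[_ /exists_inP[_ /imsetP[r _ ->] eu]].
  by have [r1 r2] := blkh i l r im lL (ltn_ord r); exists (i * q + (l * f + r).+1).
have /choice[t1 t1P] : forall l, exists t, l < L ->
    [/\ l %/ m * q < t <= l %/ m * q + q.-1, t < h & e (head x0 (ps l)) (sg t)].
  move=> l; have [lL|] := ltnP l L; last by exists 0.
  have [abl _] := abs l lL; rewrite (abpathE x0) in abl; case/and4P: abl => _ hA _ _.
  by have [t tP] := attP _ _ _ (am l lL) lL hA; exists t.
have /choice[t2 t2P] : forall l, exists t, l < L ->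
    [/\ l %% m * q < t <= l %% m * q + q.-1, t < h & e (last x0 (ps l)) (sg t)].
  move=> l; have [lL|] := ltnP l L; last by exists 0.
  have [abl _] := abs l lL; rewrite (abpathE x0) in abl; case/and4P: abl => _ _ _ hA.
  by have [t tP] := attP _ _ _ (bm l) lL hA; exists t.
have psb l x : l < L -> x \in ps l -> x \in beta e F S.
  move=> lL; have [+ _] := abs l lL; case: (ps l) => // y c /and3P[yA pc _].
  have yb : y \in beta e F S by move: yA; rewrite inE => /andP[].
  by move: pc; rewrite path_restr // => /andP[_ /allP al]; rewrite inE => /predU1P[->|/al].
have psn l : l < L -> ps l != [::] by move=> lL; have [+ _] := abs l lL; case: (ps l).
have psc l : l < L -> conn e [set z in ps l].
  move=> lL; apply: sorted_conn; rewrite ?psn //.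
  have [+ _] := abs l lL; rewrite (abpathE x0) => /and4P[_ _ sl _].
  by apply: sub_sorted sl => u v /and3P[].
pose I i := interval p (pos (i * q)) (pos (i * q + q.-1)).
have qh i : i < m -> i * q + q.-1 < h.
  by move=> im; have := leq_mul im (leqnn q); rewrite mulSn -/h; lia.
have Ip i x : x \in I i -> x \in p by rewrite inE => /andP[].
have Ic i : i < m -> conn e (I i).
  by move=> im; apply: conn_interval; rewrite ?posp ?posL ?qh //; lia.
have It i t x : i < m -> t < h -> x \in lg t -> x \in I i -> i * q < t <= i * q + q.-1.
  move=> im th xl; rewrite inE => /and3P[xp]; rewrite (lgp t) // posI //; last by have := qh i im; lia.
  by rewrite [pos t <= _]leqNgt posI ?qh // -leqNgt => -> ->.
have It' i t : i < m -> i * q < t <= i * q + q.-1 -> last x0 (lg t) \in I i.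
  move=> im /andP[r1 r2]; have ih := qh i im; have th : t < h by lia.
  rewrite inE lastp ?lth //= -[index _ _]/(pos t) posI //; last by lia.
  by rewrite r1 [pos t <= _]leqNgt posI ?qh // -leqNgt.
(* The pair l has first entry [l %/ m] and second entry [l %% m]. The whole connection goes to the
   branch set of the first entry; the second keeps only its leg. *)
pose Z i := [set x | (x \in I i) || [exists l : 'I_L, (l %/ m != l %% m) &&
  (((l %/ m == i) && ((x \in lg (t1 l)) || (x \in ps l))) || ((l %% m == i) && (x \in lg (t2 l))))]].
have ZI i : I i \subset Z i by apply/subsetP=> x xI; rewrite inE xI.
have Z1 i l : l < L -> l %/ m != l %% m -> l %/ m = i -> [set z in lg (t1 l)] \subset Z i.
  move=> lL n1 e1; apply/subsetP=> x; rewrite !inE => xl; apply/orP; right.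
  by apply/existsP; exists (Ordinal lL); rewrite /= n1 e1 eqxx xl.
have Zp i l : l < L -> l %/ m != l %% m -> l %/ m = i -> [set z in ps l] \subset Z i.
  move=> lL n1 e1; apply/subsetP=> x; rewrite !inE => xl; apply/orP; right.
  by apply/existsP; exists (Ordinal lL); rewrite /= n1 e1 eqxx xl orbT.
have Z2 i l : l < L -> l %/ m != l %% m -> l %% m = i -> [set z in lg (t2 l)] \subset Z i.
  move=> lL n1 e1; apply/subsetP=> x; rewrite !inE => xl; apply/orP; right.
  by apply/existsP; exists (Ordinal lL); rewrite /= n1 e1 eqxx xl orbT.
have headp l : l < L -> head x0 (ps l) \in ps l.
  by move=> /psn; case: (ps l) => //= x c _; apply: mem_head.
have lastps l : l < L -> last x0 (ps l) \in ps l.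
  by move=> /psn; case: (ps l) => //= x c _; apply: mem_last.
exists (fun i : 'I_m => Z i); split.
- move=> i; have im := ltn_ord i; have [y yI] := conn_neq0 (Ic i im).
  have cI x : x \in I i -> connect (restr e (Z i)) y x.
    by move=> xI; apply: conn_connect_sub (Ic i im) (ZI i) yI xI.
  have cl t x : i * q < t <= i * q + q.-1 -> t < h -> [set z in lg t] \subset Z i -> x \in lg t ->
      connect (restr e (Z i)) y x.
    move=> ti th sub xl; apply: connect_trans (cI _ (It' i t im ti)) _.
    by apply: (conn_connect_sub (lgc t th) sub); rewrite inE // lastl // lth.
  apply: (conn_from (x := y) es); first exact: (subsetP (ZI i)).
  move=> x; rewrite inE => /orP[|/existsP[l /andP[n1]]]; first exact: cI.
  have lL := ltn_ord l; case/orP=> /andP[/eqP e1]; last first.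
    move=> xl; have [r1 r2 _] := t2P l lL; rewrite e1 in r1.
    by apply: (cl (t2 l)) => //; apply: Z2.
  have [r1 r2 r3] := t1P l lL; rewrite e1 in r1; have sub1 := Z1 i l lL n1 e1.
  case/orP=> [xl|xl]; first by apply: (cl (t1 l)).
  apply: connect_trans (cl _ _ r1 r2 sub1 (sgl _ r2)) _.
  have subp := Zp i l lL n1 e1.
  apply: connect_trans (connect1 _) (conn_connect_sub (psc l lL) subp (x := head x0 (ps l)) _ _).
  + apply/and3P; split; last by rewrite es.
      by apply: (subsetP sub1); rewrite inE sgl.
    by apply: (subsetP subp); rewrite inE headp.
  + by rewrite inE headp.
  by rewrite inE.
- move=> i j ij; have im := ltn_ord i; have jm := ltn_ord j.
  have {}ij : (i : nat) <> j by move=> eq; case/eqP: ij; apply: val_inj.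
  have ZP i' x : x \in Z i' -> [\/ x \in I i',
      exists t, [/\ i' * q < t <= i' * q + q.-1, t < h & x \in lg t] |
      exists l, [/\ l < L, l %/ m = i' & x \in ps l]].
    rewrite inE => /orP[->|/existsP[l /andP[n1]]]; first by constructor 1.
    have lL := ltn_ord l; case/orP=> /andP[/eqP e1]; last first.
      by move=> xl; constructor 2; exists (t2 l); rewrite -e1; have [] := t2P l lL.
    case/orP=> xl; last by constructor 3; exists l.
    by constructor 2; exists (t1 l); rewrite -e1; have [] := t1P l lL.
  rewrite -setI_eq0; apply/eqP/setP=> x; rewrite in_setI in_set0; apply/negP=> /andP[/ZP xi /ZP xj].
  case: xi => [xi|[t [ti th xt]]|[l [lL li xl]]]; case: xj => [xj|[t' [ti' th' xt']]|[l' [lL' li' xl']]].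
  + have hI a b : a < b -> b < m -> x \in I a -> x \in I b -> False.
      move=> lab bm'; rewrite !inE => /and3P[_ _ h1] /and3P[_ h2 _].
      have h3 := leq_mul lab (leqnn q); rewrite mulSn in h3.
      have : pos (a * q + q.-1) < pos (b * q) by apply: posL; have := qh b bm'; lia.
      by lia.
    by have [l1|l1|//] := ltngtP (i : nat) j; [apply: (hI i j) | apply: (hI j i)].
  + by apply: ij; apply: block_unique ti'; apply: It xi.
  + by have := pS x (Ip _ _ xi); rewrite (psb l').
  + by apply: ij; apply: block_unique ti _; apply: It xj.
  + by apply: ij; have ett := djl t t' x th th' xt xt'; subst t'; apply: block_unique ti ti'.
  + by have := lgb t x th xt; rewrite (psb l').
  + by have := pS x (Ip _ _ xj); rewrite (psb l).
  + by have := lgb t' x th' xt'; rewrite (psb l).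
  by apply: ij; rewrite -li -li' (djs l l' x).
move=> i j ij; have im := ltn_ord i; have jm := ltn_ord j; pose l := i * m + j.
have lL : l < L by rewrite /l /L; have := leq_mul im (leqnn m); rewrite mulSn; lia.
have e1 : l %/ m = i by rewrite /l divnMDl // divn_small // addn0.
have e2 : l %% m = j by rewrite /l modnMDl modn_small.
have n1 : l %/ m != l %% m by rewrite e1 e2.
have [r1 r2 r3] := t2P l lL.
exists (last x0 (ps l)), (sg (t2 l)); split=> //.
  by apply: (subsetP (Zp i l lL n1 e1)); rewrite inE lastps.
by apply: (subsetP (Z2 j l lL n1 e2)); rewrite inE sgl.
Qed.

(** * Hexagonal grids *)

(* The hexagonal grid: a crossing (i, j) of row i and column j is the edge joining
   (i, j, false), which is entered from the left and from above, to (i, j, true),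
   which is left to the right and downwards. *)
Definition hex_arc (u v : nat * nat * bool) : bool :=
  if u.2 then ~~ v.2 && ((v.1 == (u.1.1, u.1.2.+1)) || (v.1 == (u.1.1.+1, u.1.2)))
  else v.2 && (v.1 == u.1).

Definition hex_vertex n : finType := ('I_n * 'I_n * bool)%type.

Definition hex_nat n (u : hex_vertex n) : nat * nat * bool := (nat_of_ord u.1.1, nat_of_ord u.1.2, u.2).

Definition hex n : rel (hex_vertex n) :=
  [rel u v | hex_arc (hex_nat u) (hex_nat v) || hex_arc (hex_nat v) (hex_nat u)].

Lemma hex_nat_inj n : injective (@hex_nat n).
Proof. by move=> [[i j] b] [[i' j'] b'] [/val_inj-> /val_inj-> ->]. Qed.

Lemma hex_sym n : symmetric (@hex n).
Proof. by move=> u v; rewrite /hex /= orbC. Qed.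

Section Ladder.
Variables (T : finType) (e : rel T).
Hypothesis es : symmetric e.

Lemma conn_cross (A B : {set T}) : conn e (A :|: B) -> [disjoint A & B] -> A != set0 -> B != set0 ->
  exists x y, [/\ x \in A, y \in B & e x y].
Proof.
move=> cAB dAB /set0Pn[a aA] /set0Pn[b bB].
have [|||| x [y [xAB xA yAB yA exy]]] := @conn_boundary _ e _ A a b cAB; rewrite ?inE ?aA ?bB ?orbT //.
  by apply/negP=> bA; have := disjoint_setI0 dAB; move/setP/(_ b); rewrite !inE bA bB.
by exists x, y; split=> //; move: yAB; rewrite inE (negbTE yA).
Qed.

Lemma conn_by_cuts (V : finType) (H : rel V) : symmetric H -> (exists x : V, true) ->
  (forall I : {set V}, I != set0 -> I != setT -> exists i j, [/\ i \in I, j \notin I & H i j]) ->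
  conn H setT.
Proof.
move=> Hs [x _] cut; pose C := component H setT x.
have [CT|nCT] := eqVneq C setT; first by rewrite -CT; apply: conn_component.
have [|i [j [iC jC Hij]]] := cut C _ nCT.
  by apply/set0Pn; exists x; apply: mem_component.
by rewrite (component_edge iC _ _ Hij) ?inE in jC.
Qed.

(** The rungs at one position [tau k], between different pairs of consecutive rows, may overlap. So
    a grid can use only one of them at each position. *)
Definition ladder r K : Prop := exists (d : nat) (seg : nat -> nat -> {set T})
    (tau : nat -> nat) (Z : nat -> nat -> {set T}),
  [/\ forall i t, i < r -> t < d -> conn e (seg i t),
      forall i t, i < r -> t.+1 < d -> conn e (seg i t :|: seg i t.+1),
      forall i t j s x, i < r -> t < d -> j < r -> s < d -> x \in seg i t -> x \in seg j s ->
        i = j /\ t = s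
    & [/\ (forall k, k < K -> tau k < d) /\ (forall k k', k < k' -> k' < K -> tau k < tau k'),
          forall i k, i.+1 < r -> k < K -> conn e (seg i (tau k) :|: Z i k) /\
            conn e (seg i (tau k) :|: Z i k :|: seg i.+1 (tau k)),
          forall i k j t x, i.+1 < r -> k < K -> j < r -> t < d -> x \in Z i k -> x \notin seg j t
        & forall i k i' k' x, i.+1 < r -> i'.+1 < r -> k < K -> k' < K -> x \in Z i k ->
            x \in Z i' k' -> k = k']].

(** The rung below the crossing (i, j) is taken at position [kk i j], so all rungs are at different
    positions. The entering vertex is the stretch of row i strictly between [pp i j], the previous
    rung position of that row, and [kk i j]. The period r + 1 is at least 2, which makes this
    stretch non-empty. *)
Lemma ladder_hex r : 0 < r -> ladder r (r.+1 * r.+1) -> minor (@hex r) e.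
Proof.
move=> r0 [d [seg [tau [Z [cS cS2 dS [[tauD tauM] cZ dZ dZ2]]]]]].
pose kk i j := j.+1 * r.+1 + i; pose pp i j := j * r.+1 + i.
have kK i j : i < r -> j < r -> kk i j < r.+1 * r.+1.
  by move=> ir jr; rewrite /kk; have := leq_mul jr (leqnn r.+1); rewrite !mulSn; lia.
have pk i j : pp i j + r.+1 = kk i j by rewrite /kk /pp mulSn; lia.
have kI i j i' j' : i < r -> i' < r -> kk i j = kk i' j' -> i = i' /\ j = j'.
  move=> ir ir' eq; have ei : i = i'.
    have := congr1 (modn^~ r.+1) eq; rewrite /kk !modnMDl !modn_small //; lia.
  by split=> //; move: eq; rewrite /kk ei => /addIn/eqP; rewrite eqn_mul2r /= => /eqP[].
pose U i a b : {set T} := [set x | [exists t : 'I_d, (a < t < b) && (x \in seg i t)]].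
have UP i a b x : reflect (exists t, [/\ t < d, a < t < b & x \in seg i t]) (x \in U i a b).
  rewrite inE; apply: (iffP existsP) => [[t /andP[h1 h2]]|[t [td h1 h2]]]; first by exists t.
  by exists (Ordinal td); rewrite /= h1 h2.
have cU i a b : i < r -> a.+1 < b -> b <= d -> conn e (U i a b).
  move=> ir; elim: b => // b IH ab bd; have [eb|ab'] := eqVneq b a.+1.
    have -> : U i a b.+1 = seg i b; last exact: cS.
    apply/setP=> x; apply/UP/idP => [[t [td h1 h2]]|xs]; last by exists b; split=> //; lia.
    by have -> : b = t by lia.
  have -> : U i a b.+1 = U i a b :|: (seg i b.-1 :|: seg i b).
    apply/setP=> x; rewrite in_setU; apply/UP/orP => [[t [td h1 h2]]|[/UP[t [td h1 h2]]|]].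
    - have [tb|tb] := eqVneq t b; first by right; rewrite -tb inE h2 orbT.
      by left; apply/UP; exists t; split=> //; lia.
    - by exists t; split=> //; lia.
    case/setUP=> h; first by exists b.-1; split=> //; lia.
    by exists b; split=> //; lia.
  have bd' : b.-1 < d by lia.
  have [x xs] := conn_neq0 (cS i b.-1 ir bd').
  apply: (conn_unionI es (IH _ _) _ (x := x)); try lia.
  - by have := cS2 i b.-1 ir; rewrite prednK //; [apply; lia | lia].
  - by apply/UP; exists b.-1; split=> //; lia.
  by rewrite inE xs.
have gap i j : i < r -> j < r -> (tau (pp i j)).+1 < tau (kk i j).
  move=> ir jr; have h1 := kK i j ir jr; have h2 := pk i j.
  have : tau (pp i j) < tau (kk i j).-1 by apply: tauM; lia.
  have : tau (kk i j).-1 < tau (kk i j) by apply: tauM; lia.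
  lia.
pose Phi (u : hex_vertex r) : {set T} := let: (i, j, b) := u in
  if b then seg i (tau (kk i j)) :|: (if i.+1 < r then Z i (kk i j) else set0)
  else U i (tau (pp i j)) (tau (kk i j)).
have tk i j : i < r -> j < r -> tau (kk i j) < d by move=> ir jr; apply/tauD/kK.
have cross i t : i < r -> t.+1 < d -> exists x y, [/\ x \in seg i t, y \in seg i t.+1 & e x y].
  move=> ir td; apply: conn_cross; first exact: cS2.
  - rewrite -setI_eq0; apply/eqP/setP=> x; rewrite !inE; apply/negP=> /andP[h1 h2].
    by have [] := dS i t i t.+1 x ir (ltnW td) ir td h1 h2; lia.
  - by case/connP: (cS i t ir (ltnW td)).
  by case/connP: (cS i t.+1 ir td).
have arc u v : hex_arc (hex_nat u) (hex_nat v) -> exists x y, [/\ x \in Phi u, y \in Phi v & e x y].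
  case: u v => [[i j] b] [[i' j'] b'] /=; have ir := ltn_ord i; have jr := ltn_ord j.
  have ir' := ltn_ord i'; have jr' := ltn_ord j'; have g1 := gap i j ir jr; have t1 := tk i j ir jr.
  rewrite /hex_arc /=; case: b; last first.
    case: b' => //= /eqP[-> ->]; have [|x [y [xs ys exy]]] := cross i (tau (kk i j)).-1 ir.
      by rewrite prednK //; lia.
    exists x, y; split=> //; first by apply/UP; exists (tau (kk i j)).-1; split=> //; lia.
    by rewrite prednK in ys; [rewrite inE ys | lia].
  case: b' => //= /orP[] /eqP[ei ej].
    have g2 := gap i' j' ir' jr'; have t2 := tk i' j' ir' jr'.
    have epk : pp i' j' = kk i j by rewrite /pp ei ej.
    rewrite epk in g2 *; have [|x [y [xs ys exy]]] := cross i (tau (kk i j)) ir; first by lia.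
    exists x, y; split=> //; first by rewrite inE xs.
    by rewrite ei in g2 t2; apply/UP; exists (tau (kk i j)).+1; rewrite ei; split=> //; lia.
  have ir2 : i.+1 < r by rewrite -ei.
  have [c1 c2] := cZ i (kk i j) ir2 (kK i j ir jr).
  have [|||x [y [xs ys exy]]] := conn_cross c2.
  - rewrite -setI_eq0; apply/eqP/setP=> x; rewrite !inE; apply/negP=> /andP[/orP[h1|h1] h2].
      by have [] := dS _ _ _ _ x ir t1 ir2 t1 h1 h2; lia.
    by have := dZ i (kk i j) i.+1 (tau (kk i j)) x ir2 (kK i j ir jr) ir2 t1 h1; rewrite h2.
  - by case/connP: c1.
  - by case/connP: (cS i.+1 _ ir2 t1).
  exists x, y; rewrite ir2; split=> //; apply/UP; exists (tau (kk i j)); rewrite ei ej; split=> //.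
  have h1 : pp i.+1 j < kk i j by have := pk i j; rewrite /pp; lia.
  have h2 : kk i j < kk i.+1 j by rewrite /kk; lia.
  by apply/andP; split; apply: tauM; rewrite ?kK.
exists Phi; split.
- case=> [[i j] b]; have ir := ltn_ord i; have jr := ltn_ord j; rewrite /Phi; case: b.
    have c1 := cS i _ ir (tk i j ir jr); case: ifP => ir2; last by rewrite setU0.
    by have [] := cZ i (kk i j) ir2 (kK i j ir jr).
  by apply: cU => //; [apply: gap | apply/ltnW/tk].
- move=> [[i j] b] [[i' j'] b'] ne; have ir := ltn_ord i; have jr := ltn_ord j.
  have ir' := ltn_ord i'; have jr' := ltn_ord j'.
  have {}ne : (nat_of_ord i, nat_of_ord j, b) <> (nat_of_ord i', nat_of_ord j', b').
    by move=> eq; case/eqP: ne; apply: hex_nat_inj.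
  have tlt a b1 a' b1' : a < r -> b1 < r -> a' < r -> b1' < r -> kk a b1 < kk a' b1' -> tau (kk a b1) < tau (kk a' b1').
    by move=> *; apply: tauM => //; apply: kK.
  have mono a c c' : a < r -> c < c' -> c' < r -> tau (kk a c) <= tau (pp a c').
    move=> ar cc cr; have h1 := leq_mul cc (leqnn r.+1).
    have : kk a c <= pp a c' by rewrite /kk /pp; lia.
    rewrite leq_eqVlt => /predU1P[->//|h2]; apply/ltnW/tauM => //.
    by have := kK a c' ar cr; have := pk a c'; lia.
  have xx x : x \in U i (tau (pp i j)) (tau (kk i j)) -> x \in U i' (tau (pp i' j')) (tau (kk i' j')) ->
      (nat_of_ord i, nat_of_ord j) = (nat_of_ord i', nat_of_ord j').
    move=> /UP[t [td h1 h2]] /UP[t' [td' h1' h2']].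
    have [ei et] := dS _ _ _ _ _ ir td ir' td' h2 h2'; rewrite -ei in h1' *; subst t'.
    have [l1|l1|->//] := ltngtP j j'.
      by have := mono i _ _ ir l1 jr'; lia.
    by have := mono i _ _ ir l1 jr; lia.
  have xy a c a' c' x : a < r -> c < r -> a' < r -> c' < r -> x \in U a (tau (pp a c)) (tau (kk a c)) ->
      x \in seg a' (tau (kk a' c')) :|: (if a'.+1 < r then Z a' (kk a' c') else set0) -> False.
    move=> ar cr ar' cr' /UP[t [td h1 h2]] /setUP[h3|].
      have [ei et] := dS _ _ _ _ _ ar td ar' (tk _ _ ar' cr') h2 h3; subst a' t.
      have [l1|l1|cc] := ltngtP c c'.
      - by have := mono a _ _ ar l1 cr'; have := gap a c' ar cr'; lia.
      - by have := mono a _ _ ar l1 cr; lia.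
      by subst c'; lia.
    case: ifP => [ar2 xZ|_]; last by rewrite inE.
    by have := dZ _ _ _ _ x ar2 (kK _ _ ar' cr') ar td xZ; rewrite h2.
  rewrite -setI_eq0; apply/eqP/setP=> x; rewrite in_setI in_set0; apply/negP=> /andP[].
  rewrite /Phi; case: b b' ne => [] [] ne h1 h2.
  + apply: ne; suff : kk i j = kk i' j' by case/kI => // -> ->.
    have kr := kK i j ir jr; have kr' := kK i' j' ir' jr'.
    case/setUP: h1 => h1; case/setUP: h2 => h2.
    - have [_ et] := dS _ _ _ _ _ ir (tk _ _ ir jr) ir' (tk _ _ ir' jr') h1 h2.
      have [l1|l1|//] := ltngtP (kk i j) (kk i' j').
        by have := tlt _ _ _ _ ir jr ir' jr' l1; lia.
      by have := tlt _ _ _ _ ir' jr' ir jr l1; lia.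
    - move: h2; case: ifP => [ir2 h2|_]; last by rewrite inE.
      by have := dZ _ _ _ _ x ir2 kr' ir (tk _ _ ir jr) h2; rewrite h1.
    - move: h1; case: ifP => [ir2 h1|_]; last by rewrite inE.
      by have := dZ _ _ _ _ x ir2 kr ir' (tk _ _ ir' jr') h1; rewrite h2.
    move: h1 h2; case: ifP => [ir2 h1|_]; last by rewrite inE.
    case: ifP => [ir2' h2|_]; last by rewrite inE.
    exact: dZ2 ir2 ir2' kr kr' h1 h2.
  + exact: xy h2 h1.
  + exact: xy h1 h2.
  by apply: ne; case: (xx x h1 h2) => -> ->.
move=> u v /orP[|/arc[x [y [xu yv exy]]]]; first exact: arc.
by exists y, x; rewrite es.
Qed.

End Ladder.

(** If all degrees are at most r, at most (r + 1)^r vertices are within distance r of a given one,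
    so a path to another vertex has more than r edges. *)
Lemma star_or_path (V : finType) (H : rel V) r : conn H setT -> r.+1 ^ r < #|V| ->
  (exists c, r < #|[set y | H c y]|) \/
  exists x p, [/\ path H x p, uniq (x :: p) & size p = r].
Proof.
move=> cH Vr; have [[c cr]|star] := pselect (exists c, r < #|[set y | H c y]|).
  by left; exists c.
right; have deg u : #|[set y | H u y]| <= r by rewrite leqNgt; apply/negP=> ur; apply: star; exists u.
have [x _] := conn_neq0 cH.
pose ball := fix ball k : {set V} :=
  if k is k'.+1 then ball k' :|: \bigcup_(u in ball k') [set y | H u y] else [set x].
have ballr k : #|ball k| <= r.+1 ^ k.
  elim: k => [|k IH] /=; first by rewrite cards1.
  apply: leq_trans (leq_card_setU _ _).1 _; rewrite expnS mulSn leq_add //.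
  rewrite -[r * _]mulnC; apply: leq_trans (_ : #|ball k| * r <= _); last by rewrite leq_mul2r IH orbT.
  rewrite -sum_nat_const; apply: leq_trans (_ : _ <= \sum_(u in ball k) #|[set y | H u y]|) _.
    elim/big_rec2: _ => [|u a X _ IHX]; first by rewrite cards0.
    by apply: leq_trans (leq_card_setU _ _).1 _; rewrite leq_add2l.
  by apply: leq_sum => u _; apply: deg.
have ballp p : path H x p -> last x p \in ball (size p).
  elim/last_ind: p => [|p y IH] /=; first by rewrite set11.
  rewrite rcons_path last_rcons size_rcons => /andP[/IH lb Hy] /=.
  by rewrite inE; apply/orP; right; apply/bigcupP; exists (last x p); rewrite ?inE.
have balls k k' : k <= k' -> ball k \subset ball k'.
  elim: k' => [|k' IH]; first by rewrite leqn0 => /eqP->.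
  by rewrite leq_eqVlt => /predU1P[->//|/IH h]; apply: subset_trans h (subsetUl _ _).
have /existsP[y yb] : [exists y, y \notin ball r].
  rewrite -negb_forall; apply/negP=> /forallP all; have := ballr r.
  have -> : ball r = setT by apply/setP=> y; rewrite inE all.
  by rewrite cardsT; lia.
have [p [pp lp up _]] := conn_path cH (in_setT x) (in_setT y).
have rp : r < size p.
  rewrite ltnNge; apply/negP=> pr; case/negP: yb; rewrite -lp.
  by apply: (subsetP (balls _ _ pr)); apply: ballp.
exists x, (take r p); split; last by rewrite size_takel // ltnW.
  exact: take_path.
by have := take_uniq r.+1 up.
Qed.

Section PseudogridLadder.
Variables (T : finType) (e : rel T) (n d : nat).
Variables (seg : nat -> nat -> {set T}) (lay : nat -> {set T}).
Hypotheses (es : symmetric e)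
  (cS : forall i t, i < n -> t < d -> conn e (seg i t))
  (cS2 : forall i t, i < n -> t.+1 < d -> conn e (seg i t :|: seg i t.+1))
  (cL : forall t, t < d -> conn e (lay t))
  (hitL : forall i t, i < n -> t < d -> exists2 x, x \in lay t & x \in seg i t)
  (dS : forall i t j s x, i < n -> t < d -> j < n -> s < d ->
     x \in seg i t -> x \in seg j s -> i = j /\ t = s)
  (dL : forall t s x, t < d -> s < d -> x \in lay t -> x \in lay s -> t = s)
  (dLS : forall i t s x, i < n -> t < d -> s < d -> x \in lay s -> x \in seg i t -> t = s).

Definition contact (i j : 'I_n) t : bool := [exists R : {set T},
  [&& R \subset lay t, [forall l : 'I_n, [disjoint R & seg l t]], conn e (seg i t :|: R),
      conn e (seg j t :|: R) & conn e (seg i t :|: R :|: seg j t)]].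

Lemma contact_sym t : symmetric (fun i j => contact i j t).
Proof.
move=> i j; rewrite /contact; apply: eq_existsb => R; rewrite setUAC [seg i t :|: seg j t]setUC -setUAC.
by case: (R \subset _) => //=; case: [forall _, _] => //=; rewrite andbCA.
Qed.

(** Let B be formed by the segments of I and by the vertices off all rows whose component in the
    layer is adjacent to such a segment. The connected layer has an edge leaving B, which must end
    on a row outside I; the component at its other end, or the edge alone, is the contact. *)
Lemma contact_cut t (I : {set 'I_n}) : t < d -> I != set0 -> I != setT ->
  exists i j, [/\ i \in I, j \notin I & contact i j t].
Proof.
move=> td /set0Pn[i0 i0I]; rewrite -subTset => /subsetPn[j0 _ j0I].
have [x xL xi] := hitL (ltn_ord i0) td; have [y yL yj] := hitL (ltn_ord j0) td.
pose Free := lay t :\: \bigcup_(l : 'I_n) seg l t.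
have FreeP z : z \in Free -> forall l : 'I_n, z \notin seg l t.
  by case/setDP=> _ nz l; apply: contra nz => zl; apply/bigcupP; exists l.
pose B := [set z | [exists i in I, z \in seg i t] || ((z \in Free) && [exists i in I,
  [exists u in component e Free z, [exists w in seg (nat_of_ord i) t, e u w]]])].
have xB : x \in B by rewrite inE; apply/orP; left; apply/exists_inP; exists i0.
have yB : y \notin B.
  rewrite inE negb_or; apply/andP; split.
    apply/exists_inP=> -[i iI yi]; have [/val_inj eq _] := dS (ltn_ord _) td (ltn_ord _) td yi yj.
    by rewrite -eq iI in j0I.
  by apply/negP=> /andP[/FreeP/(_ j0)]; rewrite yj.
have [u [w [uL uB wL wB euw]]] := conn_boundary (cL td) xL xB yL yB.
have [wF|wF] := boolP (w \in Free).
  case/negP: wB; rewrite inE wF /=; apply/orP; right.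
  move: uB; rewrite inE => /orP[/exists_inP[i iI ui]|/andP[uF /exists_inP[i iI /exists_inP[u' u'C hw]]]].
    apply/exists_inP; exists i => //; apply/exists_inP; exists w; first exact: mem_component.
    by apply/exists_inP; exists u; rewrite // es.
  apply/exists_inP; exists i => //; apply/exists_inP; exists u' => //.
  rewrite !inE in u'C *; apply: connect_trans (connect1 _) u'C.
  by rewrite /restr /= wF uF es.
have /bigcupP[j _ wj] : w \in \bigcup_(l : 'I_n) seg l t.
  by move: wF; rewrite inE wL andbT negbK.
have jI : j \notin I.
  by apply: contra wB => jI; rewrite inE; apply/orP; left; apply/exists_inP; exists j.
have cSt (l : 'I_n) : conn e (seg l t) by apply: cS.
move: uB; rewrite inE => /orP[/exists_inP[i iI ui]|/andP[uF /exists_inP[i iI]]].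
  exists i, j; split=> //; apply/existsP; exists set0; rewrite !setU0 sub0set !cSt /=.
  rewrite (conn_unionE es (cSt i) (cSt j) ui wj euw) andbT.
  by apply/forallP=> l; rewrite -setI_eq0 set0I.
case/exists_inP=> u' u'C /exists_inP[w' w'i euw'].
have cR := conn_component Free u es; have sR := component_sub e uF.
exists i, j; split=> //; apply/existsP; exists (component e Free u).
have c1 : conn e (seg i t :|: component e Free u).
  by rewrite setUC; apply: (conn_unionE es cR (cSt i) u'C w'i euw').
have c2 : conn e (seg j t :|: component e Free u).
  by rewrite setUC; apply: (conn_unionE es cR (cSt j) (mem_component e Free u) wj euw).
have uC : u \in seg i t :|: component e Free u by rewrite inE mem_component orbT.
rewrite c1 c2 (conn_unionE es c1 (cSt j) uC wj euw) !andbT.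
rewrite (subset_trans sR) ?subsetDl //=; apply/forallP=> l; rewrite disjoint_subset.
by apply/subsetP=> z /(subsetP sR)/FreeP/(_ l).
Qed.

Definition zone t : {set T} := lay t :|: \bigcup_(l : 'I_n) seg l t.

Lemma zone_disjoint t s x : t < d -> s < d -> x \in zone t -> x \in zone s -> t = s.
Proof.
move=> td sd; rewrite !inE => /orP[xt|/bigcupP[l _ xl]] /orP[xs|/bigcupP[l' _ xl']].
- exact: dL xt xs.
- by symmetry; apply: dLS (ltn_ord l') sd td xt xl'.
- exact: dLS (ltn_ord l) td sd xs xl.
by have [] := dS (ltn_ord l) td (ltn_ord l') sd xl xl'.
Qed.

Lemma ladder_of_rows r K (v : nat -> 'I_n) (tau : nat -> nat) :
  (forall i j, i < r -> j < r -> v i = v j -> i = j) ->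
  (forall k, k < K -> tau k < d) -> (forall k k', k < k' -> k' < K -> tau k < tau k') ->
  (forall i k, i.+1 < r -> k < K -> exists Z : {set T}, [/\ Z \subset zone (tau k),
     conn e (seg (v i) (tau k) :|: Z), conn e (seg (v i) (tau k) :|: Z :|: seg (v i.+1) (tau k))
     & forall j t x, j < r -> t < d -> x \in Z -> x \notin seg (v j) t]) ->
  ladder e r K.
Proof.
move=> vI tauD tauM hZ.
have /choice[Z ZP] : forall ik : nat * nat, exists Z : {set T}, ik.1.+1 < r -> ik.2 < K ->
    [/\ Z \subset zone (tau ik.2), conn e (seg (v ik.1) (tau ik.2) :|: Z),
     conn e (seg (v ik.1) (tau ik.2) :|: Z :|: seg (v ik.1.+1) (tau ik.2))
     & forall j t x, j < r -> t < d -> x \in Z -> x \notin seg (v j) t].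
  move=> [i k] /=; have [ir|] := ltnP i.+1 r; last by exists set0.
  have [kK|] := ltnP k K; last by exists set0.
  by have [Z hZ'] := hZ i k ir kK; exists Z.
exists d, (fun i => seg (v i)), tau, (fun i k => Z (i, k)); split.
- by move=> i t _ td; apply: cS.
- by move=> i t _ td; apply: cS2.
- move=> i t j s x ir td jr sd xi xj; have [/val_inj eq ->] := dS (ltn_ord _) td (ltn_ord _) sd xi xj.
  by split=> //; apply: vI.
split=> //.
- by move=> i k ir kK; have [] := ZP (i, k) ir kK.
- by move=> i k j t x ir kK jr td; have [_ _ _ h] := ZP (i, k) ir kK; apply: h.
move=> i k i' k' x ir ir' kK kK' xZ xZ'.
have [s1 _ _ _] := ZP (i, k) ir kK; have [s2 _ _ _] := ZP (i', k') ir' kK'.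
have := zone_disjoint (tauD k kK) (tauD k' kK') (subsetP s1 x xZ) (subsetP s2 x xZ').
have [l1|l1|//] := ltngtP k k'.
  by have := tauM _ _ l1 kK'; lia.
by have := tauM _ _ l1 kK; lia.
Qed.

Lemma contact_zone (i j : 'I_n) t : t < d -> contact i j t -> exists Z : {set T},
  [/\ Z \subset zone t, conn e (seg i t :|: Z), conn e (seg j t :|: Z),
      conn e (seg i t :|: Z :|: seg j t)
    & forall (l : 'I_n) s x, s < d -> x \in Z -> x \notin seg l s].
Proof.
move=> td /existsP[R /and5P[RL /forallP dR c1 c2 c3]]; exists R; split=> //.
  exact: subset_trans RL (subsetUl _ _).
move=> l s x sd xR; apply/negP=> xl; have est := dLS (ltn_ord l) sd td (subsetP RL x xR) xl.
by subst s; have := disjoint_setI0 (dR l); move/setP/(_ x); rewrite !inE xR xl.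
Qed.

(** By pigeonhole many layers have the same contact graph, and it is connected. Along a path in it
    consecutive rows are in contact. In a star the leaves become the rows of the ladder, and the
    segments of the centre serve in the rungs between them. *)
Lemma pseudogrid_rows r K : r.+1 ^ r < n -> #|{set 'I_n * 'I_n}| * K < d -> ladder e r K.
Proof.
move=> nr dK; pose code t : {set 'I_n * 'I_n} := [set ij | contact ij.1 ij.2 t].
have [H0] := @pigeonhole _ code d K dK.
set ks := [seq k <- _ | _] => szk; pose tau k := nth 0 ks k.
have ksP k : k \in ks -> k < d /\ code k = H0.
  by rewrite mem_filter mem_iota /= => /andP[/eqP-> ->].
have tauP k : k < K -> tau k < d /\ code (tau k) = H0.
  by move=> kK; apply: ksP; rewrite mem_nth // (ltn_trans kK).
have tauM k k' : k < k' -> k' < K -> tau k < tau k'.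
  move=> kk kK; have ss : sorted ltn ks by apply: sorted_filter; [exact: ltn_trans | exact: iota_ltn_sorted].
  by rewrite (sorted_ltn_nth ltn_trans 0 ss) // inE; lia.
have t0P : tau 0 < d /\ code (tau 0) = H0 by apply: ksP; apply: mem_nth; apply: leq_ltn_trans szk.
have n0 : 0 < n by lia.
pose H i j := contact i j (tau 0).
have cH : conn H setT.
  apply: conn_by_cuts; [exact: contact_sym | by exists (Ordinal n0) |].
  by move=> I; apply: contact_cut; case: t0P.
have HE i j k : k < K -> H i j -> contact i j (tau k).
  move=> kK hij; have [_ c1] := tauP k kK; have [_ c0] := t0P.
  have : (i, j) \in code (tau k) by rewrite c1 -c0 inE.
  by rewrite inE.
have tauD k : k < K -> tau k < d by case/tauP.
have [|[c cr]|[x [p [pp up sp]]]] := star_or_path cH (r := r); first by rewrite card_ord.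
  pose N := [set y | H c y] :\ c; have Nr : r <= size (enum N).
    rewrite -cardE -ltnS; apply: leq_trans cr _; rewrite (cardsD1 c) -/N.
    by case: (c \in _); rewrite ?add1n // add0n ltnW.
  have NP i : i < r -> nth c (enum N) i \in N.
    by move=> ir; rewrite -mem_enum mem_nth // (leq_trans ir).
  apply: (ladder_of_rows (v := nth c (enum N)) (tau := tau)) => //.
    move=> i j ir jr /eqP; rewrite nth_uniq ?enum_uniq ?(leq_trans _ Nr) //.
    by move/eqP.
  move=> i k ir kK; have td := tauD k kK.
  have aN := NP i (ltnW ir); have bN := NP _ ir; set a := nth c _ i in aN *; set b := nth c _ _ in bN *.
  move: aN bN; rewrite !inE => /andP[ac Ha] /andP[bc Hb].
  have [R1 [s1 a1 c1 f1 g1]] : exists Z : {set T}, [/\ Z \subset zone (tau k), conn e (seg a (tau k) :|: Z),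
      conn e (seg c (tau k) :|: Z), conn e (seg a (tau k) :|: Z :|: seg c (tau k))
    & forall (l : 'I_n) s x, s < d -> x \in Z -> x \notin seg l s].
    by apply: contact_zone => //; apply: HE; rewrite // /H contact_sym.
  have [R2 [s2 c2 b2 f2 g2]] := contact_zone td (HE c b k kK Hb).
  have cc := cS (ltn_ord c) td; have [z zc] := conn_neq0 cc.
  have E1 : conn e (seg a (tau k) :|: (R1 :|: seg c (tau k) :|: R2)).
    have -> : seg a (tau k) :|: (R1 :|: seg c (tau k) :|: R2) =
        (seg a (tau k) :|: R1 :|: seg c (tau k)) :|: (seg c (tau k) :|: R2).
      by rewrite !setUA -(setUA _ (seg c _) (seg c _)) setUid.
    by apply: (conn_unionI es f1 c2 (x := z)); rewrite !inE zc ?orbT.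
  exists (R1 :|: seg c (tau k) :|: R2); split=> //.
  - rewrite !subUset s1 s2 andbT /=; apply: subset_trans (subsetUr _ _).
    exact: bigcup_sup.
  - have -> : seg a (tau k) :|: (R1 :|: seg c (tau k) :|: R2) :|: seg b (tau k) =
        (seg a (tau k) :|: (R1 :|: seg c (tau k) :|: R2)) :|: (seg c (tau k) :|: R2 :|: seg b (tau k)).
      apply/setP=> y; rewrite !inE.
      by case: (y \in seg a _); case: (y \in R1); case: (y \in R2); case: (y \in seg b _);
        case: (y \in seg c _).
    by apply: (conn_unionI es E1 f2 (x := z)); rewrite !inE zc ?orbT.
  move=> j t y jr td'; rewrite !inE => /orP[/orP[yR|yc]|yR].
  - exact: g1.
  - apply/negP=> yj; have [/val_inj eq _] := dS (ltn_ord _) td (ltn_ord _) td' yc yj.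
    by have := NP j jr; rewrite -eq !inE eqxx.
  exact: g2.
apply: (ladder_of_rows (v := nth x (x :: p)) (tau := tau)) => //.
  move=> i j ir jr /eqP; rewrite nth_uniq //=; first by move/eqP.
    by rewrite sp; lia.
  by rewrite sp; lia.
move=> i k ir kK; have td := tauD k kK.
have hc : H (nth x (x :: p) i) (nth x (x :: p) i.+1) by move/(pathP x): pp; apply; lia.
have [Z [s1 a1 _ f1 g1]] := contact_zone td (HE _ _ k kK hc).
by exists Z; split=> // j t y _; apply: g1.
Qed.

End PseudogridLadder.

Theorem hex_minor r : exists N, forall (T : finType) (e : rel T),
  symmetric e -> big e N -> minor (@hex r) e.
Proof.
case: r => [|r'].
  by exists 0 => T e _ _; exists (fun=> set0); split=> -[[[]]].
set r := r'.+1; pose n := (r.+1 ^ r).+1; pose d := (#|{set 'I_n * 'I_n}| * (r.+1 * r.+1)).+1.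
(* A clique minor with one branch set for each vertex of the grid contains the grid. *)
have [N hN] := @clique_or_pseudogrid n d #|hex_vertex r| (ltn0Sn _).
exists N => T e es /(hN T e es)[[seg [lay [cS cS2 cL hL [dS dL dLS]]]]|[Phi [c dj a]]].
  apply: ladder_hex => //.
  by apply: (pseudogrid_rows es cS cS2 cL hL dS dL dLS); apply: ltnSn.
exists (fun u => Phi (enum_rank u)); split=> [u|u v uv|u v huv].
- exact: c.
- by apply: dj; rewrite (inj_eq enum_rank_inj).
apply: a; rewrite (inj_eq enum_rank_inj); apply: contraTneq huv => ->.
case: v => [[i j] b]; rewrite /hex /= /hex_arc /=.
by case: b => //=; rewrite orbb.
Qed.

(** * Topological models *)

Definition deg (T : finType) (e : rel T) x := #|[set y | e x y]|.

Lemma infix2P (T : eqType) (x0 u v : T) s :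
  reflect (exists i, [/\ i.+1 < size s, nth x0 s i = u & nth x0 s i.+1 = v]) (infix [:: u; v] s).
Proof.
apply: (iffP (@infixP T [:: u; v] s)) => [[s1 [s2 ->]]|[i [si <- <-]]].
  exists (size s1); split; first by rewrite size_cat /=; lia.
    by rewrite nth_cat ltnn subnn.
  by rewrite nth_cat ltnNge leqnSn subSnn.
exists (take i s), (drop i.+2 s); rewrite -[LHS](cat_take_drop i); congr (_ ++ _).
by rewrite (drop_nth x0) 1?ltnW // (drop_nth x0).
Qed.

Lemma infix2_rev (T : eqType) (u v : T) s : infix [:: u; v] (rev s) = infix [:: v; u] s.
Proof. by rewrite -(infix_rev [:: v; u]). Qed.

Section Tripod.
Variables (T : finType) (e : rel T).
Hypothesis es : symmetric e.

Lemma sorted_rev_path s c : sorted e (rcons s c) -> path e c (rev s).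
Proof.
move=> ss; have : sorted e (rev (rcons s c)); last by rewrite rev_rcons.
by rewrite rev_sorted (eq_sorted (e' := e)) // => x y; rewrite es.
Qed.

Lemma last_rev (c : T) s : last c (rev s) = head c s.
Proof. by case: s => //= x s; rewrite rev_cons last_rcons. Qed.

(** A path between two of the vertices is met by a path from the third one; c is the first meeting
    point. Legs may be empty. *)
Lemma tripod (B : {set T}) (a : 'I_3 -> T) : conn e B -> (forall i, a i \in B) ->
  exists c (q : 'I_3 -> seq T), [/\ c \in B,
    forall i, [/\ path e c (q i), last c (q i) = a i, uniq (c :: q i) & {subset q i <= B}]
    & forall i j v, i != j -> v \in q i -> v \notin q j].
Proof.
move=> cB aB; pose i0 : 'I_3 := inord 0; pose i1 : 'I_3 := inord 1; pose i2 : 'I_3 := inord 2.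
have [p [pp lp up sp]] := conn_path cB (aB i0) (aB i1).
have [r [pr lr ur sr]] := conn_path cB (aB i2) (aB i0).
have hr : has (mem (a i0 :: p)) (a i2 :: r).
  by apply/hasP; exists (a i0); [have := mem_last (a i2) r; rewrite lr | exact: mem_head].
have [c [s3 [s4 [cp n3 E]]]] : exists c s3 s4, [/\ c \in a i0 :: p,
    ~~ has (mem (a i0 :: p)) s3 & a i2 :: r = rcons s3 c ++ s4].
  by case: (split_find hr) => c s3 s4 cp n3; exists c, s3, s4.
have [s1 [s2 E2]] : exists s1 s2, a i0 :: p = s1 ++ c :: s2.
  by case: (splitPr cp) => s1 s2; exists s1, s2.
have ss1 : sorted e (a i0 :: p) by [].
have ss3 : sorted e (a i2 :: r) by [].
rewrite E in ss3 ur sr; rewrite E2 in ss1 up sp n3.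
have sa1 : sorted e (rcons s1 c) /\ path e c s2.
  move: ss1; rewrite -cat_rcons; case: s1 {E2 up sp n3} => //= y s1.
  by rewrite cat_path last_rcons => /andP[].
have sa3 : sorted e (rcons s3 c).
  by move: ss3; case: (s3) => //= y s5; rewrite cat_path => /andP[].
have h1 : head c s1 = a i0 by case: (s1) E2 => [|y s5] [] //.
have h2 : last c s2 = a i1 by rewrite -lp -[last _ p]/(last c (a i0 :: p)) E2 last_cat.
have h3 : head c s3 = a i2 by case: (s3) E => [|y s5] [] //.
have [n1 u1 [c1 c2 u2]] : [/\ {in s1, forall v, v \notin c :: s2}, uniq s1 &
    [/\ c \notin s1, c \notin s2 & uniq s2]].
  move: up; rewrite cat_uniq => /and3P[u1 /hasPn n1 /andP[c2 u2]]; split=> //.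
    by move=> v v1; apply/negP=> /n1; rewrite /= v1.
  by split=> //; apply: n1; rewrite mem_head.
have [u3 c3] : uniq s3 /\ c \notin s3.
  by move: ur; rewrite cat_uniq rcons_uniq => /and3P[/andP[-> ->]].
pose q (i : 'I_3) := if i == i0 then rev s1 else if i == i1 then s2 else rev s3.
have e01 : (i1 == i0) = false by rewrite -val_eqE /= !inordK.
have e02 : (i2 == i0) = false by rewrite -val_eqE /= !inordK.
have e12 : (i2 == i1) = false by rewrite -val_eqE /= !inordK.
have i3 (i : 'I_3) : [\/ i = i0, i = i1 | i = i2].
  case: i => [[|[|[|//]]] hi]; [constructor 1 | constructor 2 | constructor 3];
    by apply: val_inj; rewrite /= inordK.
have d12 v : v \in s1 -> v \notin s2.
  by move=> /n1; rewrite inE negb_or => /andP[].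
have d13 v : v \in s1 -> v \notin s3.
  by move=> v1; apply: contra n3 => v3; apply/hasP; exists v; rewrite // inE mem_cat v1.
have d23 v : v \in s2 -> v \notin s3.
  move=> v1; apply: contra n3 => v3; apply/hasP; exists v; first by [].
  by rewrite inE mem_cat inE v1 !orbT.
exists c, q; split; first by apply: sp; rewrite mem_cat mem_head orbT.
  move=> i; case: (i3 i) => ->; rewrite /q ?eqxx ?e01 ?e02 ?e12.
  - split; [by apply: sorted_rev_path; case: sa1 | by rewrite last_rev | |].
      by rewrite /= mem_rev c1 rev_uniq.
    by move=> v; rewrite mem_rev => v1; apply: sp; rewrite mem_cat v1.
  - split=> //; [by case: sa1 | by rewrite /= c2 |].
    by move=> v v2; apply: sp; rewrite mem_cat inE v2 !orbT.
  split; [exact: sorted_rev_path | by rewrite last_rev | |].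
    by rewrite /= mem_rev c3 rev_uniq.
  by move=> v; rewrite mem_rev => v3; apply: sr; rewrite mem_cat mem_rcons inE v3 orbT.
move=> i j v; case: (i3 i) => ->; case: (i3 j) => ->; rewrite /q ?eqxx ?e01 ?e02 ?e12 ?mem_rev // => _.
- exact: d12.
- exact: d13.
- by apply: contraL => /d12.
- exact: d23.
- by apply: contraL => /d13.
by apply: contraL => /d23.
Qed.

End Tripod.

(** The conditions of [is_subdivision], except that e may have further vertices and edges. *)
Definition tmodel (T' T : finType) (e' : rel T') (e : rel T) (f : T' -> T)
    (p : T' -> T' -> seq T) : Prop :=
  [/\ injective f,
      forall x y, e' x y -> p y x = rev (p x y),
      forall x y, e' x y -> uniq (p x y),
      forall x y z, e' x y -> f z \notin p x y
    & (forall x y x' y' v, e' x y -> e' x' y' -> v \in p x y -> v \in p x' y' ->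
         [set x; y] = [set x'; y']) /\
      (forall x y, e' x y -> path e (f x) (rcons (p x y) (f y)))].

(** Maximum degree 3, given by a numbering of the neighbours of each vertex because the legs of a
    tripod are indexed by ['I_3]. *)
Definition subcubic (T : finType) (e : rel T) : Prop :=
  exists slot : T -> T -> 'I_3, forall x y z, e x y -> e x z -> slot x y = slot x z -> y = z.

(* In each branch set a tripod joins the at most three vertices where the model leaves it. *)
Lemma topological_of_minor (T' T : finType) (e' : rel T') (e : rel T) :
  symmetric e -> symmetric e' -> irreflexive e' -> subcubic e' -> minor e' e ->
  exists f p, tmodel e' e f p.
Proof.
move=> es es' ei' [slot slotI] [Phi [cP dP aP]].
have /choice[w wP] : forall xy : T' * T', exists ab : T * T, [/\ ab.1 \in Phi xy.1,
    ab.2 \in Phi xy.2 & e' xy.1 xy.2 -> e ab.1 ab.2].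
  move=> [x y] /=; have [exy|nexy] := boolP (e' x y).
    by have [a [b [xa yb eab]]] := aP x y exy; exists (a, b).
  have [a xa] := conn_neq0 (cP x); have [b yb] := conn_neq0 (cP y).
  by exists (a, b).
(* Comparing ranks makes both orientations of xy use the same edge of e. *)
pose att x y := if enum_rank x < enum_rank y then (w (x, y)).1 else (w (y, x)).2.
have attP x y : att x y \in Phi x.
  by rewrite /att; case: ifP => _; [case: (wP (x, y)) | case: (wP (y, x))].
have attE x y : e' x y -> e (att x y) (att y x).
  move=> exy; rewrite /att; have [_ _ h1] := wP (x, y); have [_ _ h2] := wP (y, x).
  case: (ltngtP (enum_rank x) (enum_rank y)) => [_|_|eq].
  - exact: h1.
  - by rewrite es; apply: h2; rewrite /= es'.
  by move: exy; rewrite (enum_rank_inj (val_inj eq)) ei'.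
have /choice[A AP] : forall xi : T' * 'I_3, exists a, a \in Phi xi.1 /\
    forall y, e' xi.1 y -> slot xi.1 y = xi.2 -> a = att xi.1 y.
  move=> [x i] /=; have [[y [exy yi]]|none] := pselect (exists y, e' x y /\ slot x y = i).
    exists (att x y); split=> // z exz zi; congr (att x _).
    by apply: slotI exy exz _; rewrite yi zi.
  have [a xa] := conn_neq0 (cP x); exists a; split=> // y exy yi.
  by case: none; exists y.
have /choice[f /choice[q fq]] := fun x => tripod es (cP x) (fun i => (AP (x, i)).1).
have fP x : f x \in Phi x by have [] := fq x.
pose l x y := q x (slot x y).
have lP x y : e' x y -> [/\ path e (f x) (l x y), last (f x) (l x y) = att x y,
    f x \notin l x y /\ uniq (l x y) & {subset l x y <= Phi x}].
  move=> exy; have [_ /(_ (slot x y)) [h1 h2 /andP h3 h4] _] := fq x; split=> //.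
  by rewrite h2; apply: (AP (x, slot x y)).2.
have lD x y z v : e' x y -> e' x z -> v \in l x y -> v \in l x z -> y = z.
  move=> exy exz vy vz; apply: slotI exy exz _; apply/eqP; apply: contraT => ne.
  by have [_ _ h] := fq x; have := h _ _ v ne vy; rewrite -/(l x z) vz.
have PD x y v : v \in Phi x -> v \in Phi y -> x = y.
  move=> vx vy; apply/eqP; apply: contraT => /dP /disjoint_setI0 /setP/(_ v).
  by rewrite !inE vx vy.
exists f, (fun x y => l x y ++ rev (l y x)); split.
- by move=> x y eq; apply: (PD _ _ (f x)) => //; rewrite eq.
- by move=> x y exy; rewrite rev_cat revK.
- move=> x y exy; have eyx : e' y x by rewrite es'.
  have [_ _ [_ u1] s1] := lP x y exy; have [_ _ [_ u2] s2] := lP y x eyx.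
  rewrite cat_uniq u1 rev_uniq u2 andbT /=; apply/hasPn=> v; rewrite mem_rev => /s2 vy.
  by apply/negP=> /s1 vx; have := PD _ _ _ vx vy => eq; rewrite eq ei' in exy.
- move=> x y z exy; have eyx : e' y x by rewrite es'.
  have [_ _ [n1 _] s1] := lP x y exy; have [_ _ [n2 _] s2] := lP y x eyx.
  rewrite mem_cat mem_rev negb_or; apply/andP; split.
    by apply/negP=> h; have := PD _ _ _ (s1 _ h) (fP z) => eq; subst z; rewrite h in n1.
  by apply/negP=> h; have := PD _ _ _ (s2 _ h) (fP z) => eq; subst z; rewrite h in n2.
split.
  move=> x y x' y' v exy exy'; have eyx : e' y x by rewrite es'.
  have eyx' : e' y' x' by rewrite es'.
  have [_ _ _ s1] := lP x y exy; have [_ _ _ s2] := lP y x eyx.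
  have [_ _ _ s3] := lP x' y' exy'; have [_ _ _ s4] := lP y' x' eyx'.
  rewrite !mem_cat !mem_rev => /orP[] h1 /orP[] h2.
  - have eq := PD _ _ _ (s1 _ h1) (s3 _ h2); subst x'.
    by rewrite (lD _ _ _ _ exy exy' h1 h2).
  - have eq := PD _ _ _ (s1 _ h1) (s4 _ h2); subst y'.
    by rewrite (lD _ _ _ _ exy eyx' h1 h2) setUC.
  - have eq := PD _ _ _ (s2 _ h1) (s3 _ h2); subst x'.
    by rewrite (lD _ _ _ _ eyx exy' h1 h2) setUC.
  have eq := PD _ _ _ (s2 _ h1) (s4 _ h2); subst y'.
  by rewrite (lD _ _ _ _ eyx eyx' h1 h2).
move=> x y exy; have eyx : e' y x by rewrite es'.
have [p1 l1 _ _] := lP x y exy; have [p2 l2 _ _] := lP y x eyx.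
rewrite rcons_cat cat_path p1 l1 /= -rev_cons lastI rev_rcons /= l2 attE //=.
by rewrite -l2 rev_path (eq_path (e' := e)) // => u v; rewrite es.
Qed.

Section Model.
Variables (T' T : finType) (e' : rel T') (e : rel T) (f : T' -> T) (p : T' -> T' -> seq T).

Definition thread x y : seq T := f x :: rcons (p x y) (f y).

Definition tmrel : rel T :=
  [rel u v | [exists x, exists y, e' x y && infix [:: u; v] (thread x y)]].

Lemma tmrelP u v : reflect (exists x y, e' x y /\ infix [:: u; v] (thread x y)) (tmrel u v).
Proof.
apply: (iffP existsP) => [[x /existsP[y /andP[h1 h2]]]|[x [y [h1 h2]]]]; first by exists x, y.
by exists x; apply/existsP; exists y; rewrite h1.
Qed.

Hypotheses (es' : symmetric e') (ei' : irreflexive e') (tm : tmodel e' e f p).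

Lemma thread_rev x y : e' x y -> thread y x = rev (thread x y).
Proof.
by case: tm => _ h _ _ _ exy; rewrite /thread h // rev_cons rev_rcons.
Qed.

Lemma tmrel_sym : symmetric tmrel.
Proof.
move=> u v; apply/tmrelP/tmrelP => -[x [y [exy h]]]; exists y, x; rewrite es' exy; split=> //;
  by rewrite thread_rev // infix2_rev.
Qed.

Lemma tmrel_sub : subrel tmrel e.
Proof.
case: tm => _ _ _ _ [_ hp] u v /tmrelP[x [y [exy /(infix2P (f x))[i [si <- <-]]]]].
by have h := elimT (pathP (f x)) (hp x y exy) i; apply: h.
Qed.

Lemma thread_uniq x y : e' x y -> uniq (thread x y).
Proof.
case: tm => fI _ hu hf _ exy; rewrite /thread /= rcons_uniq hu // mem_rcons inE negb_or !hf //.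
by rewrite !andbT (inj_eq fI); apply: contraTneq exy => ->; rewrite ei'.
Qed.

Lemma tmrel_thread x y : e' x y -> path tmrel (f x) (rcons (p x y) (f y)).
Proof.
move=> exy; apply/(pathP (f x)) => i si; apply/tmrelP; exists x, y; split=> //.
by apply/(infix2P (f x)); exists i; split; rewrite // /thread /= ltnS.
Qed.

Lemma branch_neighbours x u : tmrel (f x) u -> exists y, e' x y /\ u = head (f y) (p x y).
Proof.
case: tm => fI _ _ hf _ /tmrelP[a [b [eab]]] h; have ut := thread_uniq eab.
case/(infix2P u): h => i [si h1 h2].
have a0 : nth u (thread a b) 0 = f a by [].
have [i0|i0] := posnP i.
  subst i; rewrite a0 in h1; have := fI _ _ h1 => eax; subst a; exists b; split=> //.
  by rewrite -h2 /thread /=; case: (p x b).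
case/negP: (hf a b x eab); rewrite -h1 /thread.
move: si; rewrite /thread /= size_rcons !ltnS => si.
by case: i i0 si {h1 h2} => // i _ si /=; rewrite nth_rcons si mem_nth.
Qed.

Lemma deg_branch x : deg tmrel (f x) <= deg e' x.
Proof.
rewrite /deg; apply: leq_trans (leq_imset_card (fun y => head (f y) (p x y)) [set y | e' x y]).
apply: subset_leq_card; apply/subsetP=> u; rewrite inE => /branch_neighbours[y [exy ->]].
by apply: imset_f; rewrite inE.
Qed.

Lemma deg_thread x y v : e' x y -> v \in p x y -> deg tmrel v <= 2.
Proof.
case: tm => fI _ _ hf [hd _] exy vp; set s := thread x y; set i := index v s.
have us : uniq s by apply: thread_uniq.
suff sub : [set u | tmrel v u] \subset [set nth v s i.+1; nth v s i.-1].
  apply: leq_trans (subset_leq_card sub) _; by rewrite cards2; case: (_ != _).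
apply/subsetP=> u; rewrite inE => /tmrelP[a [b [eab h]]].
have vab : v \in p a b.
  have := h => /mem_infix/(_ v); rewrite mem_head /thread inE mem_rcons inE => /(_ isT).
  case/or3P=> [/eqP ev|/eqP ev|//]; first by have := hf x y a exy; rewrite -ev vp.
  by have := hf x y b exy; rewrite -ev vp.
have eqs := hd _ _ _ _ v exy eab vp vab.
have : thread a b = s \/ thread a b = rev s.
  have := set21 a b; rewrite -eqs => /set2P[] ea; have := set22 a b; rewrite -eqs => /set2P[] eb;
    subst a b; rewrite ?ei' // in eab *; first by left.
  by right; apply: thread_rev.
case=> eq; rewrite eq in h.
  case/(infix2P v): h => j [sj h1 h2]; rewrite !inE; apply/orP; left.
  by rewrite -h2 /i -[v in index v]h1 index_uniq // ltnW.
rewrite infix2_rev in h; case/(infix2P v): h => j [sj h1 h2]; rewrite !inE; apply/orP; right.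
by rewrite -h1 /i -[v in index v]h2 index_uniq.
Qed.

Lemma tmrel_support u v : tmrel u v -> (exists x, u = f x) \/ exists x y, e' x y /\ u \in p x y.
Proof.
case/tmrelP=> x [y [exy h]]; have := mem_infix h; move=> /(_ u); rewrite mem_head => /(_ isT).
rewrite /thread inE mem_rcons inE => /or3P[/eqP->|/eqP->|up]; [left | left | right].
- by exists x.
- by exists y.
by exists x, y.
Qed.

Definition spread x : {set T} := [set v | (v == f x) || [exists y, e' x y && (v \in p x y)]].

(** A branch vertex is in one spread only, an inner vertex of a thread in the spreads of its two
    ends: hence the factor 2. *)
Lemma big_tmrel n : symmetric e -> big e' (2 * n) -> big tmrel n.
Proof.
move=> _; have ts := tmrel_sym; case: tm => fI hr _ hf [hd _].
have cL x y : e' x y -> conn tmrel [set z in thread x y].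
  by move=> exy; apply: path_conn => //; apply: tmrel_thread.
have cB x y : e' x y -> conn tmrel [set z in f x :: p x y].
  by move=> exy; apply: path_conn => //; have := tmrel_thread exy; rewrite rcons_path => /andP[].
have fS x : f x \in spread x by rewrite inE eqxx.
have cS x : conn tmrel (spread x).
  apply: (conn_from (x := f x) ts) => // v; rewrite inE => /predU1P[->//|/existsP[y /andP[exy vp]]].
  apply: (conn_connect_sub (cB x y exy)); rewrite ?inE ?eqxx ?vp ?orbT //.
  apply/subsetP=> z; rewrite !inE => /predU1P[->|zp]; first by rewrite eqxx.
  by apply/orP; right; apply/existsP; exists y; rewrite exy.
apply: (big_transfer (Phi := spread)) => //.
  move=> x y exy; have -> : spread x :|: spread y = spread x :|: [set z in thread x y] :|: spread y.
    apply/setP=> z; rewrite !in_setU; case zx: (z \in spread x) => //=.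
    case zy: (z \in spread y); rewrite ?orbT ?orbF //; symmetry; apply/negbTE; rewrite inE /thread.
    rewrite inE mem_rcons inE !negb_or; apply/and3P; split.
    - by apply: contraFneq zx => ->.
    - by apply: contraFneq zy => ->.
    apply: contraFN zx => zp; rewrite inE; apply/orP; right.
    by apply/existsP; exists y; rewrite exy.
  apply: (conn_unionI ts _ (cS y) (x := f y)) => //; last first.
    by rewrite !inE mem_rcons mem_head !orbT.
  by apply: (conn_unionI ts (cS x) (cL x y exy) (x := f x)); rewrite // inE mem_head.
move=> v; have [[x ev]|nf] := pselect (exists x, v = f x).
  apply: leq_trans (_ : #|[set x]| <= _); last by rewrite cards1.
  apply: subset_leq_card; apply/subsetP=> z; rewrite !inE ev.
  case/orP=> [/eqP/fI->//|/existsP[y /andP[ezy]]]; by rewrite (negbTE (hf _ _ _ ezy)).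
have [[x [y [exy vp]]]|np] := pselect (exists x y, e' x y /\ v \in p x y).
  apply: leq_trans (_ : #|[set x; y]| <= _); last by rewrite cards2; case: (_ != _).
  apply: subset_leq_card; apply/subsetP=> z; rewrite inE inE.
  case/orP=> [/eqP ev|/existsP[y' /andP[ezy vp']]]; first by case: nf; exists z.
  by rewrite (hd _ _ _ _ v exy ezy vp vp') set21.
suff -> : [set a | v \in spread a] = set0 by rewrite cards0.
apply/setP=> z; rewrite !inE; apply/negP=> /orP[/eqP ev|/existsP[y /andP[ezy vp]]].
  by case: nf; exists z.
by case: np; exists z, y.
Qed.

End Model.

Lemma tmodel_sub (T' T : finType) (e'' e' : rel T') (e : rel T) f p :
  subrel e'' e' -> tmodel e' e f p -> tmodel e'' e f p.
Proof.
move=> se [h1 h2 h3 h4 [h5 h6]]; split=> // [x y /se|x y /se|x y z /se|]; auto.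
by split=> [x y x' y' v /se exy /se exy'|x y /se]; auto; apply: h5.
Qed.

(** * Branching in one colour *)

(** Among 2K + 1 rows, more than K columns show the same colour pattern by pigeonhole, and one
    colour of this pattern is taken by more than K rows. *)
Lemma ramsey_grid K : exists n, forall chi : nat -> nat -> bool, exists c I J,
  [/\ forall i, i < K -> I i < n /\ J i < n,
      forall i j, i < j -> j < K -> I i < I j /\ J i < J j
    & forall i j, i < K -> j < K -> chi (I i) (J j) = c].
Proof.
pose R := (2 * K).+1; exists (#|{set 'I_R}| * K + R).+1 => chi; set n := (_ + R).+1.
have [X] := @pigeonhole _ (fun j => [set i : 'I_R | chi i j]) n K (leq_addr _ _).
set cols := [seq k <- _ | _] => colsK; pose J := nth 0 cols.
have [|c] := @pigeonhole _ (fun i => chi i (J 0)) R K; first by rewrite card_bool.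
set rows := [seq k <- _ | _] => rowsK; pose I := nth 0 rows.
have rowP i : i < K -> I i < R /\ chi (I i) (J 0) = c.
  move=> iK; have := mem_nth 0 (ltn_trans iK rowsK); rewrite -/(I i).
  by rewrite mem_filter mem_iota /= => /andP[/eqP-> ->].
have colP j : j < size cols -> J j < n /\ [set i : 'I_R | chi i (J j)] = X.
  move=> jK; have := mem_nth 0 jK; rewrite -/(J j).
  by rewrite mem_filter mem_iota /= => /andP[/eqP-> ->].
have srt a m i j : i < j -> j < size [seq k <- iota 0 m | a k] ->
    nth 0 [seq k <- iota 0 m | a k] i < nth 0 [seq k <- iota 0 m | a k] j.
  move=> ij js; have ss : sorted ltn [seq k <- iota 0 m | a k].
    by apply: sorted_filter; [exact: ltn_trans | exact: iota_ltn_sorted].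
  by rewrite (sorted_ltn_nth ltn_trans 0 ss) // inE (ltn_trans ij).
exists c, I, J; split.
- move=> i iK; have [h1 _] := rowP i iK; have [h2 _] := colP i (ltn_trans iK colsK).
  by split=> //; apply: leq_trans h1 _; rewrite /n leqW // leq_addl.
- by move=> i j ij jK; split; apply: srt => //; apply: ltn_trans jK _.
move=> i j iK jK; have [iR <-] := rowP i iK.
have [_ e1] := colP j (ltn_trans jK colsK).
have [_ e2] := colP 0 (leq_ltn_trans (leq0n _) colsK).
have : (Ordinal iR \in [set i : 'I_R | chi i (J j)]) = (Ordinal iR \in [set i : 'I_R | chi i (J 0)]).
  by rewrite e1 e2.
by rewrite !inE.
Qed.

Definition grid_arc (u v : nat * nat) : bool := (v == (u.1, u.2.+1)) || (v == (u.1.+1, u.2)).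

Definition grid m : rel ('I_m * 'I_m) := [rel u v |
  grid_arc (nat_of_ord u.1, nat_of_ord u.2) (nat_of_ord v.1, nat_of_ord v.2) ||
  grid_arc (nat_of_ord v.1, nat_of_ord v.2) (nat_of_ord u.1, nat_of_ord u.2)].

(** The bramble consists of the crosses of a row and a column. Fewer than m vertices miss some row
    and some column, hence a cross. *)
Lemma big_grid m : big (@grid m) m.
Proof.
case: m => [|m]; first by exists set0; split=> // [S|S1 S2]; rewrite inE.
have gs : symmetric (@grid m.+1) by move=> u v; rewrite /grid /= orbC.
pose row i : {set 'I_m.+1 * 'I_m.+1} := [set u | u.1 == i].
pose col j : {set 'I_m.+1 * 'I_m.+1} := [set u | u.2 == j].
have conn_line (A : {set 'I_m.+1 * 'I_m.+1}) (f : 'I_m.+1 -> 'I_m.+1 * 'I_m.+1) :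
    (forall k, f k \in A) -> (forall u, u \in A -> exists k, u = f k) ->
    (forall k : nat, k < m -> grid (f (inord k)) (f (inord k.+1))) -> conn (@grid m.+1) A.
  move=> fA Af ef; apply: (conn_from (x := f ord0) gs) => // u /Af[k ->].
  have -> : k = inord k by apply: val_inj; rewrite /= inordK.
  have -> : ord0 = inord 0 :> 'I_m.+1 by apply: val_inj; rewrite /= inordK.
  have : (k : nat) <= m by rewrite -ltnS.
  elim: (k : nat) => [|l IH] lm; first exact: connect0.
  apply: connect_trans (IH (ltnW lm)) (connect1 _).
  by apply/and3P; split; [exact: fA | exact: fA | exact: ef].
have crow i : conn (@grid m.+1) (row i).
  apply: (conn_line _ (fun k => (i, k))) => [k|[a k]|k km]; rewrite ?inE //=.
    by move=> /eqP->; exists k.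
  by rewrite /grid /= /grid_arc /= !inordK ?eqxx // ltnS ltnW.
have ccol i : conn (@grid m.+1) (col i).
  apply: (conn_line _ (fun k => (k, i))) => [k|[k a]|k km]; rewrite ?inE //=.
    by move=> /eqP->; exists k.
  by rewrite /grid /= /grid_arc /= !inordK ?eqxx ?orbT // ltnS ltnW.
exists [set row ij.1 :|: col ij.2 | ij : 'I_m.+1 * 'I_m.+1]; split.
- move=> _ /imsetP[[i j] _ ->] /=.
  by apply: (conn_unionI gs (crow i) (ccol j) (x := (i, j))); rewrite inE /=.
- move=> _ _ /imsetP[[i j] _ ->] /imsetP[[i' j'] _ ->] /=.
  by apply/set0Pn; exists (i, j'); rewrite !inE /= !eqxx orbT.
move=> Y hY; rewrite leqNgt; apply/negP=> Ym.
have miss (g : 'I_m.+1 * 'I_m.+1 -> 'I_m.+1) : exists i, i \notin g @: Y.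
  apply/existsP; rewrite -negb_forall; apply/negP=> /forallP all.
  have : #|g @: Y| <= #|Y| by apply: leq_imset_card.
  have -> : g @: Y = setT by apply/setP=> i; rewrite inE all.
  by rewrite cardsT card_ord leqNgt Ym.
have [i iY] := miss fst; have [j jY] := miss snd.
have /set0Pn[u /setIP[+ uY]] : (row i :|: col j) :&: Y != set0.
  by apply: hY; apply/imsetP; exists (i, j).
rewrite !inE /= => /orP[/eqP eu|/eqP eu].
  by case/negP: iY; rewrite -eu; apply: imset_f.
by case/negP: jY; rewrite -eu; apply: imset_f.
Qed.

Lemma hex_irr n : irreflexive (@hex n).
Proof. by case=> [[i j] []]. Qed.

(** The slots are the partner in the same crossing, the neighbour in the same row and the neighbour
    in another row. *)
Lemma hex_subcubic n : subcubic (@hex n).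
Proof.
pose slot (u v : nat * nat) := if (u.1 == v.1) && (u.2 == v.2) then 0 else if u.1 == v.1 then 1 else 2.
exists (fun u v => inord (slot (hex_nat u).1 (hex_nat v).1)) => u v w uv uw sl.
apply: hex_nat_inj; move: uv uw; have {sl} : slot (hex_nat u).1 (hex_nat v).1 = slot (hex_nat u).1 (hex_nat w).1.
  have slot3 a b : slot a b < 3 by rewrite /slot; do 2 case: ifP => //.
  by have := congr1 val sl; rewrite /= !inordK.
have hexE a b : hex a b = hex_arc (hex_nat a) (hex_nat b) || hex_arc (hex_nat b) (hex_nat a) by [].
rewrite !hexE; move: (hex_nat u) (hex_nat v) (hex_nat w) => [[i j] b] [[i1 j1] b1] [[i2 j2] b2].
rewrite /slot /hex_arc /= !xpair_eqE.
case: b b1 b2 => [] [] [] //=; case: (i =P i1) => h1; case: (i =P i2) => h2;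
  case: (j =P j1) => h3; case: (j =P j2) => h4 //= sl a1 a2;
  by have [-> ->] : i1 = i2 /\ j1 = j2 by lia.
Qed.

Section Hooks.
Variables (n m : nat) (r c : nat -> nat -> nat).
(** The chosen rows come in groups indexed by a, in descending order of b inside a group, and
    symmetrically for the columns. Hence the row of hook (a, b) reaches the column of hook (a, b +
    1) strictly below its corner, and the column of hook (a, b) reaches the row of hook (a + 1, b)
    strictly to the right of its corner. *)
Hypotheses
  (rn : forall a b, a <= m -> b <= m -> r a b <= n)
  (cn : forall a b, a <= m -> b <= m -> c a b <= n)
  (r1 : forall a b a' b', a < a' -> a' <= m -> b <= m -> b' <= m -> r a b < r a' b')
  (r2 : forall a b b', b < b' -> a <= m -> b' <= m -> r a b' < r a b)
  (c1 : forall a b a' b', b < b' -> b' <= m -> a <= m -> a' <= m -> c a b < c a' b')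
  (c2 : forall a a' b, a < a' -> a' <= m -> b <= m -> c a' b < c a b).

(* Hook (a, b) turns from its corner (r a b, c a b) to the right, until hook (a, b + 1),
   and down, until hook (a + 1, b). It branches only where it is entered. *)
Definition hor i j := [exists ab : 'I_m * 'I_m,
  (i == r ab.1 ab.2) && (c ab.1 ab.2 <= j < c ab.1 ab.2.+1)].
Definition ver i j := [exists ab : 'I_m * 'I_m,
  (j == c ab.1 ab.2) && (r ab.1 ab.2 <= i < r ab.1.+1 ab.2)].
Definition corner i j := [exists ab : 'I_m * 'I_m, (i == r ab.1 ab.2) && (j == c ab.1 ab.2)].

Lemma horP i j : reflect (exists a b, [/\ a < m, b < m, i = r a b & c a b <= j < c a b.+1]) (hor i j).
Proof.
apply: (iffP existsP) => [[[a b] /andP[/eqP-> h]]|[a [b [am bm -> h]]]].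
  by exists a, b; rewrite !ltn_ord.
by exists (Ordinal am, Ordinal bm); rewrite /= eqxx.
Qed.

Lemma verP i j : reflect (exists a b, [/\ a < m, b < m, j = c a b & r a b <= i < r a.+1 b]) (ver i j).
Proof.
apply: (iffP existsP) => [[[a b] /andP[/eqP-> h]]|[a [b [am bm -> h]]]].
  by exists a, b; rewrite !ltn_ord.
by exists (Ordinal am, Ordinal bm); rewrite /= eqxx.
Qed.

Lemma cornerP i j : reflect (exists a b, [/\ a < m, b < m, i = r a b & j = c a b]) (corner i j).
Proof.
apply: (iffP existsP) => [[[a b] /andP[/eqP-> /eqP->]]|[a [b [am bm -> ->]]]].
  by exists a, b; rewrite !ltn_ord.
by exists (Ordinal am, Ordinal bm); rewrite /= !eqxx.
Qed.

Lemma r_inj a b a' b' : a <= m -> b <= m -> a' <= m -> b' <= m -> r a b = r a' b' -> a = a' /\ b = b'.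
Proof.
move=> am bm am' bm' eq; have [l1|l1|ea] := ltngtP a a'.
- by have := r1 l1 am' bm bm'; lia.
- by have := r1 l1 am bm' bm; lia.
subst a'; have [l2|l2|//] := ltngtP b b'.
  by have := r2 l2 am bm'; lia.
by have := r2 l2 am bm; lia.
Qed.

Lemma c_inj a b a' b' : a <= m -> b <= m -> a' <= m -> b' <= m -> c a b = c a' b' -> a = a' /\ b = b'.
Proof.
move=> am bm am' bm' eq; have [l1|l1|ea] := ltngtP b b'.
- by have := c1 l1 bm' am am'; lia.
- by have := c1 l1 bm am' am; lia.
subst b'; have [l2|l2|//] := ltngtP a a'.
  by have := c2 l2 am' bm; lia.
by have := c2 l2 am bm; lia.
Qed.

(** A crossing is left both to the right and downwards only at a corner, where the edge inside the
    crossing is removed. So no leaving vertex has degree 3 in [hooks]. *)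
Lemma hor_ver_corner i j : hor i j -> ver i j -> corner i j.
Proof.
case/horP=> a [b [am bm ei h12]] /verP[a' [b' [am' bm' ej h34]]].
have [l1|l1|eb] := ltngtP b' b.
- by have := c1 (a := a') (a' := a) l1 (ltnW bm) (ltnW am') (ltnW am); lia.
- have [l2|l2|eb] := ltngtP b.+1 b'.
  + by have := c1 (a := a) (a' := a') l2 (ltnW bm') (ltnW am) (ltnW am'); lia.
  + by lia.
  subst b'; have [l3|l3|ea] := ltngtP a a'.
  + by have := r1 (b := b) (b' := b.+1) l3 (ltnW am') (ltnW bm) bm; lia.
  + by have := c2 (b := b.+1) l3 (ltnW am) bm; lia.
  by rewrite ea in h12; lia.
subst b'; have [l3|l3|ea] := ltngtP a a'.
- by have := c2 (b := b) l3 (ltnW am') (ltnW bm); lia.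
- have [l4|l4|ea] := ltngtP a'.+1 a.
  + by have := r1 (b := b) (b' := b) l4 (ltnW am) (ltnW bm) (ltnW bm); lia.
  + by lia.
  by rewrite ea in h34; lia.
by subst a'; apply/cornerP; exists a, b.
Qed.

Definition hook_arc (u v : nat * nat * bool) : bool := hex_arc u v &&
  (if u.2 then (if u.1.1 == v.1.1 then hor u.1.1 u.1.2 else ver u.1.1 u.1.2)
   else ~~ corner u.1.1 u.1.2).

Definition hooks : rel (hex_vertex n.+1) :=
  [rel u v | hook_arc (hex_nat u) (hex_nat v) || hook_arc (hex_nat v) (hex_nat u)].

Lemma hooks_sym : symmetric hooks.
Proof. by move=> u v; rewrite /hooks /= orbC. Qed.

Lemma hooks_sub : subrel hooks (@hex n.+1).
Proof. by move=> u v /orP[] /andP[h _]; rewrite /hex /= h ?orbT. Qed.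

Lemma deg_list u (s : seq (nat * nat * bool)) : (forall v, hooks u v -> hex_nat v \in s) ->
  deg hooks u <= size s.
Proof.
move=> hs; rewrite /deg cardE -(size_map (@hex_nat n.+1)); apply: uniq_leq_size.
  by rewrite map_inj_uniq ?enum_uniq //; apply: hex_nat_inj.
by move=> _ /mapP[v + ->]; rewrite mem_enum inE => /hs.
Qed.

Lemma deg_hooks u : deg hooks u <= 2 + (~~ u.2 &&
  [exists ab : 'I_m.+1 * 'I_m.+1, nat_of_ord u.1.1 == r ab.1 ab.2] &&
  [exists ab : 'I_m.+1 * 'I_m.+1, nat_of_ord u.1.2 == c ab.1 ab.2]).
Proof.
have hooksE v w : hooks v w = hook_arc (hex_nat v) (hex_nat w) || hook_arc (hex_nat w) (hex_nat v) by [].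
case uE: (hex_nat u) => [[i0 j0] b].
have [-> -> ->] : [/\ nat_of_ord u.1.1 = i0, nat_of_ord u.1.2 = j0 & u.2 = b] by case: uE.
case: b uE => uE.
  apply: leq_trans (_ : size ((if corner i0 j0 then [::] else [:: (i0, j0, false)]) ++
    (if hor i0 j0 then [:: (i0, j0.+1, false)] else [::]) ++
    (if ver i0 j0 then [:: (i0.+1, j0, false)] else [::])) <= _).
    apply: deg_list => v; rewrite hooksE uE; case: (hex_nat v) => [[i1 j1] b1].
    rewrite /hook_arc /hex_arc /=; case: b1 => //=; rewrite ?orbF ?andbT.
    case/orP=> [/andP[/orP[] /eqP[-> ->]]|/andP[/eqP[-> ->]]].
    - by rewrite eqxx => ->; rewrite !(inE, mem_cat) eqxx ?orbT.
    - by rewrite ltn_eqF // => ->; rewrite !(inE, mem_cat) eqxx ?orbT.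
    by move/negbTE->; rewrite !mem_cat inE eqxx.
  rewrite !size_cat; have := @hor_ver_corner i0 j0.
  by case: (hor i0 j0); case: (ver i0 j0); case: (corner i0 j0) => //= /(_ isT isT).
apply: leq_trans (_ : size ([:: (i0, j0, true)] ++
    (if (0 < j0) && hor i0 j0.-1 then [:: (i0, j0.-1, true)] else [::]) ++
    (if (0 < i0) && ver i0.-1 j0 then [:: (i0.-1, j0, true)] else [::])) <= _).
  apply: deg_list => v; rewrite hooksE uE; case: (hex_nat v) => [[i1 j1] b1].
  rewrite /hook_arc /hex_arc /=; case: b1 => //=; rewrite ?orbF ?andbT.
    case/orP=> [/andP[/eqP[-> ->] _]|/andP[/orP[] /eqP[-> ->]]].
    - by rewrite inE eqxx.
    - by rewrite eqxx /= => ->; rewrite !(inE, mem_cat) eqxx ?orbT.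
    by rewrite ltn_eqF // => /= ->; rewrite !(inE, mem_cat) eqxx ?orbT.
case hh : ((0 < j0) && hor i0 j0.-1); last by rewrite /= ; case: ifP.
case vv : ((0 < i0) && ver i0.-1 j0); last by [].
case/andP: hh => _ /horP[a [b [am bm er _]]]; case/andP: vv => _ /verP[a' [b' [am' bm' ec _]]].
have -> : [exists ab : 'I_m.+1 * 'I_m.+1, i0 == r ab.1 ab.2].
  by apply/existsP; exists (inord a, inord b); rewrite /= !inordK ?er // ltnW.
have -> // : [exists ab : 'I_m.+1 * 'I_m.+1, j0 == c ab.1 ab.2].
by apply/existsP; exists (inord a', inord b'); rewrite /= !inordK ?ec // ltnW.
Qed.

Definition hook_h a b i j := (i == r a b) && (c a b <= j < c a b.+1).
Definition hook_v a b i j := (j == c a b) && (r a b <= i < r a.+1 b).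

(** The entering vertex of the corner crossing is left out, since [hooks] lacks the edge inside that
    crossing. *)
Definition hook (ab : 'I_m * 'I_m) : {set hex_vertex n.+1} :=
  [set u : hex_vertex n.+1 | let: (i, j, b) := hex_nat u in
   (hook_h ab.1 ab.2 i j && (b || (c ab.1 ab.2 < j))) ||
   (hook_v ab.1 ab.2 i j && (b || (r ab.1 ab.2 < i)))].

Definition mkv i j b : hex_vertex n.+1 := (inord i, inord j, b).

Lemma mkvE i j b : i <= n -> j <= n -> hex_nat (mkv i j b) = (i, j, b).
Proof. by move=> im jm; rewrite /hex_nat /= !inordK. Qed.

Lemma hooksW i j b i' j' b' : i <= n -> j <= n -> i' <= n -> j' <= n ->
  hook_arc (i, j, b) (i', j', b') -> hooks (mkv i j b) (mkv i' j' b').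
Proof. by move=> h1 h2 h3 h4 arc; rewrite /hooks /= !mkvE // arc. Qed.

Lemma mid_edge a b i j : a < m -> b < m ->
  (hook_h a b i j && (c a b < j)) || (hook_v a b i j && (r a b < i)) -> ~~ corner i j.
Proof.
move=> am bm h; apply/negP=> /cornerP[a' [b' [am' bm' ei ej]]]; case/orP: h.
  case/andP=> /andP[/eqP ei' _] cj; have eqr : r a b = r a' b' by rewrite -ei -ei'.
  have [ea eb] := r_inj (ltnW am) (ltnW bm) (ltnW am') (ltnW bm') eqr.
  by move: cj; rewrite ej ea eb ltnn.
case/andP=> /andP[/eqP ej' _] cj; have eqc : c a b = c a' b' by rewrite -ej -ej'.
have [ea eb] := c_inj (ltnW am) (ltnW bm) (ltnW am') (ltnW bm') eqc.
by move: cj; rewrite ei ea eb ltnn.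
Qed.

Lemma hook_conn ab : conn hooks (hook ab).
Proof.
case: ab => a b; have am := ltn_ord a; have bm := ltn_ord b.
set A := hook _; have AE i j d : i <= n -> j <= n -> (mkv i j d \in A) =
    (hook_h a b i j && (d || (c a b < j))) || (hook_v a b i j && (d || (r a b < i))).
  by move=> im jm; rewrite inE mkvE.
have ra := rn (ltnW am) (ltnW bm); have ca := cn (ltnW am) (ltnW bm).
have rb := rn am (ltnW bm); have cb := cn (ltnW am) bm.
have cc : c a b < c a b.+1 by apply: c1 => //; exact: ltnW.
have rr : r a b < r a.+1 b by apply: r1 => //; exact: ltnW.
pose x0 := mkv (r a b) (c a b) true.
have x0A : x0 \in A by rewrite AE // /hook_h eqxx leqnn cc.
have edge i j d i' j' d' : i <= n -> j <= n -> i' <= n -> j' <= n -> mkv i j d \in A ->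
    mkv i' j' d' \in A -> hook_arc (i, j, d) (i', j', d') ->
    connect (restr hooks A) (mkv i j d) (mkv i' j' d').
  by move=> *; apply: connect1; apply/and3P; split=> //; apply: hooksW.
have armh j : c a b <= j -> j < c a b.+1 -> connect (restr hooks A) x0 (mkv (r a b) j true) /\
    (c a b < j -> connect (restr hooks A) x0 (mkv (r a b) j false)).
  elim: j => [|j IH] h1 h2.
    by have -> : 0 = c a b by [lia]; rewrite ltnn; split.
  move: h1; rewrite leq_eqVlt => /predU1P[<-|h1]; first by rewrite ltnn; split.
  have h0 : c a b <= j by [].
  have [IH1 _] := IH h0 (ltnW h2); have jn : j.+1 <= n by lia.
  have m1 : mkv (r a b) j true \in A by rewrite AE ?(ltnW jn) // /hook_h eqxx h0 (ltnW h2).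
  have m2 : mkv (r a b) j.+1 false \in A by rewrite AE // /hook_h eqxx (leqW h0) h2 /= h1.
  have m3 : mkv (r a b) j.+1 true \in A by rewrite AE // /hook_h eqxx (leqW h0) h2.
  have s1 : connect (restr hooks A) x0 (mkv (r a b) j.+1 false).
    apply: connect_trans IH1 (edge _ _ _ _ _ _ _ _ _ _ m1 m2 _); rewrite ?(ltnW jn) //.
    rewrite /hook_arc /hex_arc /= !eqxx /=; apply/horP; exists a, b.
    by split=> //; rewrite h0 ltnW.
  split=> //; apply: connect_trans s1 (edge _ _ _ _ _ _ _ _ _ _ m2 m3 _) => //.
  rewrite /hook_arc /hex_arc /= eqxx /=; apply: (mid_edge am bm).
  by rewrite /hook_h eqxx (leqW h0) h2 h1.
have armv i : r a b <= i -> i < r a.+1 b -> connect (restr hooks A) x0 (mkv i (c a b) true) /\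
    (r a b < i -> connect (restr hooks A) x0 (mkv i (c a b) false)).
  elim: i => [|i IH] h1 h2.
    by have -> : 0 = r a b by [lia]; rewrite ltnn; split.
  move: h1; rewrite leq_eqVlt => /predU1P[<-|h1]; first by rewrite ltnn; split.
  have h0 : r a b <= i by [].
  have [IH1 _] := IH h0 (ltnW h2); have jn : i.+1 <= n by lia.
  have m1 : mkv i (c a b) true \in A by rewrite AE ?(ltnW jn) // /hook_v eqxx h0 (ltnW h2) orbT.
  have m2 : mkv i.+1 (c a b) false \in A by rewrite AE // /hook_v eqxx (leqW h0) h2 /= h1 orbT.
  have m3 : mkv i.+1 (c a b) true \in A by rewrite AE // /hook_v eqxx (leqW h0) h2 orbT.
  have s1 : connect (restr hooks A) x0 (mkv i.+1 (c a b) false).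
    apply: connect_trans IH1 (edge _ _ _ _ _ _ _ _ _ _ m1 m2 _); rewrite ?(ltnW jn) //.
    rewrite /hook_arc /hex_arc /= !eqxx orbT ltn_eqF //=; apply/verP; exists a, b.
    by split=> //; rewrite h0 ltnW.
  split=> //; apply: connect_trans s1 (edge _ _ _ _ _ _ _ _ _ _ m2 m3 _) => //.
  rewrite /hook_arc /hex_arc /= eqxx /=; apply: (mid_edge am bm).
  by rewrite /hook_v eqxx (leqW h0) h2 h1 orbT.
apply: (conn_from (x := x0)) => //; first exact: hooks_sym.
move=> [[i j] d] uA; have -> : (i, j, d) = mkv i j d by rewrite /mkv !inord_val.
move: uA; rewrite inE /=; case/orP=> /andP[/andP[/eqP-> /andP[h1 h2]]] => [dj|di].
  by have [H1 H2] := armh j h1 h2; case: d dj => //=; apply: H2.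
by have [H1 H2] := armv i h1 h2; case: d di => //=; apply: H2.
Qed.

Lemma hook_grid ab ab' : grid ab ab' -> conn hooks (hook ab :|: hook ab').
Proof.
wlog arc : ab ab' / grid_arc (nat_of_ord ab.1, nat_of_ord ab.2) (nat_of_ord ab'.1, nat_of_ord ab'.2).
  by move=> W /orP[arc|arc]; [|rewrite setUC]; apply: W => //; rewrite /grid /= arc.
move=> _; have [x [y [xA yA exy]]] : exists x y, [/\ x \in hook ab, y \in hook ab' & hooks x y]; last first.
  exact: conn_unionE hooks_sym (hook_conn ab) (hook_conn ab') xA yA exy.
case: ab ab' arc => [a b] [a' b'] /=; have am := ltn_ord a; have bm := ltn_ord b.
have am' := ltn_ord a'; have bm' := ltn_ord b'.
have ra := rn (ltnW am) (ltnW bm); have ca := cn (ltnW am) (ltnW bm).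
have rb := rn am (ltnW bm); have cb := cn (ltnW am) bm.
have cc : c a b < c a b.+1 by apply: c1 => //; exact: ltnW.
have rr : r a b < r a.+1 b by apply: r1 => //; exact: ltnW.
rewrite /grid_arc => /orP[] /eqP[ea eb].
  exists (mkv (r a b) (c a b.+1).-1 true), (mkv (r a b) (c a b.+1) false); split.
  - by rewrite inE mkvE /hook_h ?eqxx //=; lia.
  - rewrite inE mkvE //= /hook_v ea eb eqxx /=; apply/orP; right.
    have h1 : r a b.+1 < r a b by apply: r2 => //; lia.
    have h2 : r a b < r a.+1 b.+1 by apply: r1 => //; lia.
    by rewrite h1 h2 (ltnW h1).
  apply: hooksW; try lia; rewrite /hook_arc /hex_arc /= prednK; last by lia.
  rewrite !eqxx /=; apply/horP; exists a, b; split=> //; lia.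
exists (mkv (r a.+1 b).-1 (c a b) true), (mkv (r a.+1 b) (c a b) false); split.
- by rewrite inE mkvE /hook_v ?eqxx //=; lia.
- rewrite inE mkvE //= /hook_h ea eb eqxx /=; apply/orP; left.
  have h1 : c a.+1 b < c a b by apply: c2 => //; lia.
  have h2 : c a b < c a.+1 b.+1 by apply: c1 => //; lia.
  by rewrite h1 h2 (ltnW h1).
apply: hooksW; try lia; rewrite /hook_arc /hex_arc /= prednK; last by lia.
rewrite !eqxx orbT /= ltn_eqF; last by lia.
apply/verP; exists a, b; split=> //; lia.
Qed.

(** As r and c are injective, a vertex lies on at most one hook through its row and one through its
    column. The bramble of the grid of hooks is transferred with overlap 2. *)
Lemma big_hooks N : 2 * N <= m -> big hooks N.
Proof.
move=> Nm; apply: (big_transfer (e' := @grid m) (Phi := hook) (c := 2)) => //.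
- exact: hooks_sym.
- exact: hook_conn.
- exact: hook_grid.
- move=> u; case E: (hex_nat u) => [[i j] d].
  pose H := [set ab : 'I_m * 'I_m | i == r ab.1 ab.2]; pose V := [set ab : 'I_m * 'I_m | j == c ab.1 ab.2].
  have one (A : {set 'I_m * 'I_m}) : {in A &, forall x y, x = y} -> #|A| <= 1.
    by move=> h; apply/card_le1_eqP=> x y xA yA; apply: h.
  apply: leq_trans (_ : #|H :|: V| <= _).
    apply: subset_leq_card; apply/subsetP=> ab; rewrite !inE E.
    by case/orP=> /andP[/andP[-> _] _]; rewrite ?orbT.
  apply: leq_trans (leq_card_setU _ _).1 _; rewrite -[2]/(1 + 1) leq_add //; apply: one.
    move=> [a b] [a' b']; rewrite !inE /= => /eqP-> /eqP eq.
    have [/val_inj-> /val_inj->//] := r_inj (ltnW (ltn_ord a)) (ltnW (ltn_ord b)) (ltnW (ltn_ord a')) (ltnW (ltn_ord b')) eq.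
  move=> [a b] [a' b']; rewrite !inE /= => /eqP-> /eqP eq.
  have [/val_inj-> /val_inj->//] := c_inj (ltnW (ltn_ord a)) (ltnW (ltn_ord b)) (ltnW (ltn_ord a')) (ltnW (ltn_ord b')) eq.
exact: big_le Nm (big_grid m).
Qed.

End Hooks.

Theorem monochromatic n : exists N, forall (T : finType) (e : rel T) (col : T -> bool),
  symmetric e -> big e N -> exists c (h : rel T),
  [/\ symmetric h, subrel h e, big h n & forall x, deg h x <= 2 + (col x == c)].
Proof.
(* One factor 2 pays for the overlap of hooks, the other for the overlap of spreads in
   [big_tmrel]. *)
pose m := 2 * (2 * n); have [n' hn'] := ramsey_grid (m.+1 * m.+1).
have [N hN] := hex_minor n'.+1; exists N => T e col es /(hN T e es) mh.
have [f [p tm]] := topological_of_minor es (@hex_sym _) (@hex_irr _) (@hex_subcubic _) mh.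
(* Hooks branch only at entering vertices on chosen rows and columns, so only the colours of these
   have to agree. *)
pose chi i j := col (f (inord i, inord j, false)).
have [c [I [J [IJn IJm IJc]]]] := hn' chi; exists c.
(* Lexicographic numbering with the second index reversed, as the hooks require. *)
pose R a b := I (a * m.+1 + (m - b)); pose C a b := J (b * m.+1 + (m - a)).
have K a b : a <= m -> a * m.+1 + (m - b) < m.+1 * m.+1.
  by move=> am; have := leq_mul am (leqnn m.+1); rewrite [m.+1 * _]mulSn; lia.
have lt1 a b a' b' : a < a' -> a * m.+1 + (m - b) < a' * m.+1 + (m - b').
  by move=> aa; have := leq_mul aa (leqnn m.+1); rewrite mulSn; lia.
have rn a b : a <= m -> b <= m -> R a b <= n'.
  by move=> am bm; have [h _] := IJn _ (K a b am); apply: ltnW.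
have cn a b : a <= m -> b <= m -> C a b <= n'.
  by move=> am bm; have [_ h] := IJn _ (K b a bm); apply: ltnW.
have r1 a b a' b' : a < a' -> a' <= m -> b <= m -> b' <= m -> R a b < R a' b'.
  by move=> aa am _ _; have [|//] := IJm _ _ (lt1 a b a' b' aa); apply: K.
have r2 a b b' : b < b' -> a <= m -> b' <= m -> R a b' < R a b.
  move=> bb am bm; have h : a * m.+1 + (m - b') < a * m.+1 + (m - b) by lia.
  by have [|//] := IJm _ _ h; apply: K.
have c1 a b a' b' : b < b' -> b' <= m -> a <= m -> a' <= m -> C a b < C a' b'.
  by move=> aa am _ _; have [|//] := IJm _ _ (lt1 b a b' a' aa); apply: K.
have c2 a a' b : a < a' -> a' <= m -> b <= m -> C a' b < C a b.
  move=> bb am bm; have h : b * m.+1 + (m - a') < b * m.+1 + (m - a) by lia.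
  by have [|//] := IJm _ _ h; apply: K.
have hs := @hooks_sym n' m R C; have hb := @hooks_sub n' m R C.
have tm' := tmodel_sub hb tm.
have hi : irreflexive (@hooks n' m R C).
  by move=> u; apply/negP=> /hb; rewrite hex_irr.
exists (tmrel (@hooks n' m R C) f p); split.
- exact: tmrel_sym hs tm'.
- exact: tmrel_sub tm'.
- apply: (big_tmrel hs tm' es); apply: (big_hooks rn cn r1 r2 c1 c2); exact: leqnn.
move=> x; have [[u ->]|nf] := pselect (exists u, x = f u).
  apply: leq_trans (deg_branch hi tm' u) _.
  apply: leq_trans (deg_hooks r1 c1 c2 u) _; rewrite leq_add2l.
  case: (boolP (_ && _)) => // /andP[/andP[u2 /existsP[[a b] /eqP ei]] /existsP[[a' b'] /eqP ej]].
  suff -> : col (f u) = c by rewrite eqxx.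
  have -> : u = (inord (R a b), inord (C a' b'), false).
    by rewrite -ei -ej !inord_val; case: u u2 {ei ej} => [[i j] []].
  apply: IJc; apply: K; rewrite -ltnS; exact: ltn_ord.
have [[u [v [huv xp]]]|np] := pselect (exists u v, hooks m R C u v /\ x \in p u v).
  by apply: leq_trans (deg_thread hi tm' huv xp) _; rewrite leq_addr.
suff -> : deg (tmrel (@hooks n' m R C) f p) x = 0 by [].
rewrite /deg; apply: eq_card0 => y; rewrite in_set.
case h: (tmrel _ _ _ x y) => //; by case: (tmrel_support h) => [[u eu]|[u [v huv]]]; [case: nf; exists u | case: np; exists u, v].
Qed.

(** * Claws and triangles *)

Section Good.
Variable T : finType.
Implicit Types (e : rel T) (v : T).

Definition claw_vertex e v : Prop := deg e v = 3 /\ forall a, e v a -> deg e a <= 2.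

Definition triangle_vertex e v : Prop := exists a b c,
  [/\ [set y | e v y] = [set a; b; c], e b c, ~~ e a b, ~~ e a c & deg e a <= 2].

Definition good e v : Prop := [\/ deg e v <= 2, claw_vertex e v | triangle_vertex e v].

Lemma deg_mono e e' v : subrel e e' -> deg e v <= deg e' v.
Proof.
by move=> s; apply: subset_leq_card; apply/subsetP=> y; rewrite !inE; apply: s.
Qed.

Lemma restr_restr e (X X' : {set T}) : X' \subset X -> restr (restr e X) X' = restr e X'.
Proof.
move=> /subsetP sX; apply/funext=> x; apply/funext=> y; rewrite /restr /=.
by case xX: (x \in X') => //; case yX: (y \in X') => //; rewrite !sX.
Qed.

Lemma restr_sub e (X : {set T}) : subrel (restr e X) e.
Proof. by move=> x y /and3P[]. Qed.

Lemma claw_restr e (X : {set T}) v : claw_vertex e v ->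
  deg (restr e X) v <= 2 \/ claw_vertex (restr e X) v.
Proof.
case=> d3 cl; have [d2|d2] := leqP (deg (restr e X) v) 2; [by left | right; split].
  by have := deg_mono v (@restr_sub e X); lia.
by move=> u /restr_sub/cl; apply: leq_trans; apply/deg_mono/restr_sub.
Qed.

Lemma triangle_restr e (X : {set T}) v : triangle_vertex e v ->
  deg (restr e X) v <= 2 \/ triangle_vertex (restr e X) v.
Proof.
case=> [a [b [c [N bc ab ac da]]]].
have [d2|d2] := leqP (deg (restr e X) v) 2; [by left | right].
have N' : [set y | restr e X v y] = [set a; b; c].
  apply/eqP; rewrite eqEcard -N; apply/andP; split.
    by apply/subsetP=> y; rewrite !in_set; apply: restr_sub.
  apply: leq_trans d2; rewrite N; apply: leq_trans (leq_card_setU _ _).1 _.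
  by rewrite cards2 cards1; case: (_ != _).
have mem y : y \in [set a; b; c] -> y \in X by rewrite -N' inE => /and3P[].
exists a, b, c; split=> //.
- by rewrite /restr /= !mem ?inE ?eqxx ?orbT.
- by apply: contra ab => /restr_sub.
- by apply: contra ac => /restr_sub.
by apply: leq_trans da; apply/deg_mono/restr_sub.
Qed.

(** This allows the classes to be treated one after another: later deletions do not spoil vertices
    made good earlier. *)
Lemma good_restr e (X : {set T}) v : good e v -> good (restr e X) v.
Proof.
case=> [d2|/(claw_restr X)[g|g]|/(triangle_restr X)[g|g]].
- by constructor 1; apply: leq_trans d2; apply/deg_mono/restr_sub.
- by constructor 1.
- by constructor 2.
- by constructor 1.
by constructor 3.
Qed.

End Good.

(** A largest connected proper subset of K through x can be enlarged by a single vertex, so it lacks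
    only that one. *)
Lemma conn_noncut (T : finType) (e : rel T) (K : {set T}) x : symmetric e -> conn e K ->
  x \in K -> 1 < #|K| -> exists w, [/\ w \in K, w != x & conn e (K :\ w)].
Proof.
move=> es cK xK K1.
pose P (A : {set T}) := [&& x \in A, A \proper K & conn e A].
have P1 : P [set x].
  rewrite /P set11 conn1 andbT /=; apply/properP; split; first by rewrite sub1set.
  by move: K1; rewrite (cardsD1 x) xK ltnS card_gt0 => /set0Pn[y /setD1P[yx yK]];
    exists y; rewrite // inE.
case: (arg_maxnP (fun A : {set T} => #|A|) P1) => A /and3P[xA AK cA] Amax.
have /properP[sAK [y yK yA]] := AK.
have [u [w [uK uA wK wA euw]]] := conn_boundary cK xK xA yK yA.
have cAw := conn_unionE es cA (conn1 e w) uA (set11 w) euw.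
have KE : A :|: [set w] = K.
  apply/eqP; apply: contraT => ne; have : P (A :|: [set w]).
    by rewrite /P cAw inE xA andbT properEneq ne subUset sAK sub1set.
  by move/Amax; rewrite setUC cardsU1 wA add1n /= ltnn.
exists w; split=> //; first by apply: contraNneq wA => ->.
suff -> : K :\ w = A by [].
by apply/setP=> z; rewrite -KE !inE; have [->|] := eqVneq z w; rewrite ?(negbTE wA) // orbF.
Qed.

(* By minimality of C every component of C - v owns a private vertex of Y, all of whose
   neighbours in C lie in that component. As Y has at most three vertices, either v has
   one neighbour in each component, or two adjacent neighbours in a single one. *)
Section Local.
Variables (T : finType) (e : rel T) (X C Y : {set T}) (v : T).
Hypotheses (es : symmetric e) (ei : irreflexive e)
  (cC : conn e C) (vC : v \in C) (CX : C \subset X) (YX : Y \subset X)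
  (Y3 : #|Y| <= 3)
  (hitC : forall y, y \in Y -> exists2 x, x \in C & e x y)
  (minC : forall C', conn e C' -> C' \subset C ->
     (forall y, y \in Y -> exists2 x, x \in C' & e x y) -> C' = C)
  (nbrC : forall x u, x \in C -> (x == v) || e v x -> u \in X -> e x u -> (u \in C) || (u \in Y))
  (leaf : forall x y, x \in C -> (x == v) || e v x -> y \in Y -> e x y ->
     (forall x', x' \in C -> e x' y -> x' = x) /\ deg (restr e X) y <= 2).

Let part x := component e (C :\ v) x.

Lemma part_sub x : x \in C :\ v -> part x \subset C :\ v.
Proof. exact: component_sub. Qed.

Lemma part_eq x y : y \in part x -> part y = part x.
Proof.
rewrite inE => cxy; apply/setP=> w; rewrite !inE.
by rewrite (same_connect (connect_restr_sym (C :\ v) es) cxy).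
Qed.

Lemma part_nbr x : x \in C :\ v -> exists2 a, a \in part x & e v a.
Proof.
move=> xC; have vp : v \notin part x by apply/negP=> /(subsetP (part_sub xC)); rewrite !inE eqxx.
have [u [w [uC up wC wp euw]]] :=
  conn_boundary cC (subsetP (subsetDl _ _) x xC) (mem_component _ _ _) vC vp.
have [ew|nw] := eqVneq w v; first by exists u; rewrite // es -ew.
case/negP: wp; apply: (component_edge up _ _ euw); last by rewrite !inE nw.
exact: (subsetP (part_sub xC)).
Qed.

Lemma rest_conn x : x \in C :\ v -> conn e (C :\: part x).
Proof.
move=> xC; have vR : v \in C :\: part x.
  by rewrite inE vC andbT; apply/negP=> /(subsetP (part_sub xC)); rewrite !inE eqxx.
apply: (conn_from (x := v)) => // w /setDP[wC wp].
have [->|nw] := eqVneq w v; first exact: connect0.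
have wCv : w \in C :\ v by rewrite !inE nw.
have [a aw eva] := part_nbr wCv.
have dj : part w \subset C :\: part x.
  apply/subsetP=> z zw; rewrite inE; have := subsetP (part_sub wCv) z zw; rewrite inE => /andP[_ ->].
  rewrite andbT; apply: contra wp => zx; rewrite -(part_eq zx) (part_eq zw).
  exact: mem_component.
apply: connect_trans (connect1 _) (conn_connect_sub (conn_component _ _ es) dj aw (mem_component _ _ _)).
by apply/and3P; split=> //; apply: (subsetP dj).
Qed.

(** Replacing the component by two connected pieces, each attached to v, keeps C connected. If all
    of Y is still hit, minimality of C forbids any loss. The pieces may coincide. *)
Lemma shrink x (K1 K2 : {set T}) : x \in C :\ v -> K1 \subset part x -> K2 \subset part x ->
  conn e K1 -> conn e K2 -> (exists2 b, b \in K1 & e v b) -> (exists2 b, b \in K2 & e v b) ->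
  (forall y, y \in Y -> exists2 z, z \in (C :\: part x) :|: K1 :|: K2 & e z y) ->
  K1 :|: K2 = part x.
Proof.
move=> xC s1 s2 c1 c2 [b1 b1K e1] [b2 b2K e2] hit.
have vR : v \in C :\: part x.
  by rewrite inE vC andbT; apply/negP=> /(subsetP (part_sub xC)); rewrite !inE eqxx.
have cR := conn_unionE es (rest_conn xC) c1 vR b1K e1.
have vR1 : v \in C :\: part x :|: K1 by rewrite inE vR.
have cR2 := conn_unionE es cR c2 vR1 b2K e2.
have sC : part x \subset C by apply: subset_trans (part_sub xC) (subsetDl _ _).
have := minC cR2; rewrite !subUset subsetDl (subset_trans s1 sC) (subset_trans s2 sC).
move=> /(_ isT hit) eC; apply/eqP; rewrite eqEsubset subUset s1 s2 /=.
apply/subsetP=> z zx; have zC := subsetP sC z zx.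
by rewrite -eC in_setU in_setU in_setD zx /= in zC; rewrite in_setU.
Qed.

Definition private (y : T) (K : {set T}) := (y \in Y) && [forall x in C, e x y ==> (x \in K)].

Lemma privateP y K x : private y K -> x \in C -> e x y -> x \in K.
Proof. by case/andP=> _ /forall_inP h xC; apply: implyP (h x xC). Qed.

Lemma private_disjoint y (K K' : {set T}) : private y K -> private y K' -> [disjoint K & K'] -> False.
Proof.
move=> p1 p2 /disjoint_setI0 d; have /andP[yY _] := p1; have [x xC exy] := hitC yY.
by move/setP/(_ x): d; rewrite !inE (privateP p1 xC exy) (privateP p2 xC exy).
Qed.

Lemma private_exists C' : conn e C' -> C' \subset C -> C' != C -> exists y, private y (C :\: C').
Proof.
move=> cC' sC' ne; apply: contrapT => none; case/eqP: ne; apply: minC => // y yY.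
apply: contrapT => nh; apply: none; exists y; rewrite /private yY /=.
apply/forall_inP=> x xC; apply/implyP=> exy; rewrite inE xC andbT.
by apply/negP=> xC'; apply: nh; exists x.
Qed.

Lemma part_private x : x \in C :\ v -> exists y, private y (part x).
Proof.
move=> xC; have sC : part x \subset C by apply: subset_trans (part_sub xC) (subsetDl _ _).
have [||y yp] := private_exists (rest_conn xC); first exact: subsetDl.
  by apply/eqP=> /setP/(_ x); rewrite in_setD mem_component; case/setD1P: xC => _ ->.
by exists y; rewrite setDDr setDv set0U (setIidPr sC) in yp.
Qed.

(** A vertex w whose removal leaves the component connected leaves it attached to v as well, because
    a or b remains. By minimality w is then the only neighbour in C of some vertex of Y, and there
    are two such w. *)
Lemma part_two_private x a b : x \in C :\ v -> a \in part x -> b \in part x -> a != b -> e v a -> e v b ->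
  exists w1 w2 y1 y2, [/\ w1 \in part x, w2 \in part x, w1 != w2, private y1 [set w1] & private y2 [set w2]].
Proof.
move=> xC ax bx ab eva evb; have sC : part x \subset C by apply: subset_trans (part_sub xC) (subsetDl _ _).
have cP : conn e (part x) by apply: conn_component.
have p2 : 1 < #|part x|.
  by rewrite (cardsD1 a) ax ltnS card_gt0; apply/set0Pn; exists b; rewrite in_setD1 eq_sym ab.
have priv w : w \in part x -> conn e (part x :\ w) -> exists y, private y [set w].
  move=> wx cw; have [d dx evd] : exists2 d, d \in part x :\ w & e v d.
    have [aw|aw] := eqVneq a w; first by exists b; rewrite // in_setD1 bx -aw eq_sym ab.
    by exists a; rewrite // in_setD1 aw.
  apply: contrapT => none; have := shrink xC (subsetDl _ [set w]) (subsetDl _ [set w]) cw cw.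
  have ed : exists2 b0, b0 \in part x :\ w & e v b0 by exists d.
  move/(_ ed ed); rewrite setUid => sh; have : w \in part x :\ w.
    rewrite sh // => y yY; apply: contrapT => nh; apply: none; exists y; rewrite /private yY /=.
    apply/forall_inP=> z zC; apply/implyP=> ezy; rewrite inE; apply: contraT => zw; case: nh.
    by exists z; rewrite // in_setU in_setU in_setD in_setD1 zC zw; case: (z \in part x).
  by rewrite !inE eqxx.
have [w1 [w1x _ c1]] := conn_noncut es cP ax p2.
have [w2 [w2x n2 c2]] := conn_noncut es cP w1x p2.
have [y1 h1] := priv w1 w1x c1; have [y2 h2] := priv w2 w2x c2.
by exists w1, w2, y1, y2; rewrite eq_sym n2.
Qed.

Let e' := restr e X.

Lemma nbr_cases x u : x \in C -> (x == v) || e v x -> e' x u -> e x u /\ ((u \in C) || (u \in Y)).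
Proof. by move=> xC xv /and3P[_ uX exu]; split=> //; apply: (nbrC xC). Qed.

(** The component only has to connect v with [y0]. So by minimality it is an induced path from a to
    the neighbour of [y0], and the neighbours of a are v and the next vertex, possibly [y0]
    itself. *)
Lemma pendant_deg a y0 : a \in C :\ v -> e v a -> private y0 (part a) ->
  (forall b, b \in part a -> e v b -> b = a) ->
  (forall y x, y \in Y -> y != y0 -> x \in part a -> ~~ e x y) -> deg e' a <= 2.
Proof.
move=> aC eva py0 onlya other; have sC : part a \subset C by apply: subset_trans (part_sub aC) (subsetDl _ _).
have aC' := subsetP (subsetDl _ _) a aC.
have y0Y : y0 \in Y by case/andP: py0.
have [x xC exy0] := hitC y0Y; have xa := privateP py0 xC exy0.
have [p [pp lp up sp]] := conn_path (conn_component _ _ es) (mem_component e (C :\ v) a) xa.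
(* Applied to the whole path, and again to any shortcut from a, which would omit the second vertex
   b. *)
have full q : path e a q -> {subset a :: q <= part a} -> last a q = x -> part a = [set z in a :: q].
  move=> pq sq lq; rewrite -[RHS]setUid; symmetry.
  have cq := path_conn es pq; have s : [set z in a :: q] \subset part a.
    by apply/subsetP=> z; rewrite inE => /sq.
  have nb : exists2 b, b \in [set z in a :: q] & e v b by exists a; rewrite // inE mem_head.
  apply: shrink => // y yY; have [->|ny] := eqVneq y y0.
    by exists x; rewrite // in_setU [_ \in [set z in _]]inE -lq mem_last orbT.
  have [z zC ezy] := hitC yY; exists z => //; rewrite in_setU in_setU in_setD zC andbT.
  by rewrite (contraL (other y z yY ny)) //; apply/negP; rewrite negbK.
have aE := full p pp sp lp.
have va : a \in C /\ ((a == v) || e v a) by rewrite aC' eva orbT.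
have sub : exists u, [set z | e' a z] \subset [set v; u].
  case: p pp lp up sp aE => [|b p] /= pp lp up sp aE.
    exists y0; apply/subsetP=> u; rewrite inE => /(nbr_cases va.1 va.2)[eau /orP[uC|uY]].
      rewrite !inE; apply/orP; left; apply: contraT => nuv.
      have : u \in part a by apply: (component_edge (mem_component _ _ _) aC _ eau); rewrite !inE nuv.
      by rewrite aE !inE => /eqP eua; rewrite eua ei in eau.
    rewrite !inE; apply/orP; right; apply: contraT => nuy.
    by have := other u a uY nuy (mem_component _ _ _); rewrite eau.
  exists b; apply/subsetP=> u; rewrite inE => /(nbr_cases va.1 va.2)[eau /orP[uC|uY]].
    rewrite !inE; have [//|nuv /=] := eqVneq u v.
    have : u \in part a by apply: (component_edge (mem_component _ _ _) aC _ eau); rewrite !inE nuv.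
    rewrite {1}aE inE inE => /predU1P[eua|]; first by rewrite eua ei in eau.
    rewrite inE => /predU1P[->//|ubp]; case/splitPr: ubp pp lp up sp aE => p1 p2 pp lp up sp aE.
    have := full (u :: p2); rewrite /= eau.
    have -> : path e u p2 by move: pp; rewrite cat_path /= => /and3P[_ _ /andP[]].
    have -> : last u p2 = x by rewrite -lp last_cat.
    have sq : {subset [:: a, u & p2] <= part a}.
      move=> z; rewrite inE => /predU1P[->|zp]; first exact: mem_component.
      by apply: sp; rewrite !inE mem_cat zp !orbT.
    move=> /(_ isT sq erefl)/setP/(_ b); rewrite aE !inE eqxx orbT -[_ || (b \in p2)]/(b \in u :: p2).
    have [ab bup] : a != b /\ b \notin u :: p2.
      move: up; rewrite -/(uniq [:: a, b & p1 ++ u :: p2]) => up; split.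
        by apply: contraTneq up => ->; rewrite cons_uniq mem_head.
      by move: up; rewrite !cons_uniq mem_cat negb_or => /and3P[_ /andP[_ ->]].
    by rewrite eq_sym (negbTE ab) (negbTE bup).
  have [un _] := leaf va.1 va.2 uY eau.
  have [euy0|nuy0] := eqVneq u y0; last by have := other u a uY nuy0 (mem_component _ _ _); rewrite eau.
  have exa : x = a by apply: un => //; rewrite euy0.
  by move: up; rewrite -{1}exa -lp mem_last.
case: sub => u sub; apply: leq_trans (subset_leq_card sub) _.
by rewrite cards2; case: (_ != _).
Qed.

Lemma part_disjoint x y : x \in C :\ v -> y \in C :\ v -> x \notin part y -> [disjoint part x & part y].
Proof.
move=> xC yC xy; rewrite -setI_eq0; apply/eqP/setP=> z; rewrite in_setI in_set0; apply/negP.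
move=> /andP[zx zy]; case/negP: xy; rewrite -(part_eq zy) (part_eq zx); exact: mem_component.
Qed.

Lemma part_subC x : x \in C :\ v -> part x \subset C.
Proof. by move=> xC; apply: subset_trans (part_sub xC) (subsetDl _ _). Qed.

Lemma v_notin_part x : x \in C :\ v -> v \notin part x.
Proof. by move=> xC; apply/negP=> /(subsetP (part_sub xC)); rewrite !inE eqxx. Qed.

Lemma path_to_nbr x w : x \in C :\ v -> w \in part x -> exists q b,
  [/\ path e w q, {subset w :: q <= part x}, uniq (w :: q), last w q = b /\ e v b &
      forall z, z \in w :: q -> e v z -> z = b].
Proof.
move=> xC wx; have [a ax eva] := part_nbr xC.
have [evw|evw] := boolP (e v w).
  exists [::], w; split=> // z; rewrite inE => /eqP-> //.
have [q [pq lq uq sq]] := conn_path (conn_component _ _ es) wx ax.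
have hq : has (e v) q.
  apply/hasP; exists a => //; have := mem_last w q; rewrite lq inE => /predU1P[ew|//].
  by rewrite -ew eva in evw.
case: (split_find hq) pq uq sq => b s1 s2 evb nB pq uq sq.
exists (rcons s1 b), b; split.
- by move: pq; rewrite cat_path => /andP[].
- by move=> z zs; apply: sq; rewrite -cat_cons mem_cat zs.
- by move: uq; rewrite -cat_cons cat_uniq => /andP[].
- by rewrite last_rcons.
move=> z; rewrite inE mem_rcons inE => /or3P[/eqP->|/eqP->//|zs] evz; first by rewrite evz in evw.
by case/hasP: nB; exists z.
Qed.

(** With such an edge uw, the vertex b could be dropped: the rest of both paths is connected, is
    attached to v through c, and still contains [w1] and [w2]. *)
Lemma no_shortcut x w1 q1 b w2 q2 c y1 y2 u w : x \in C :\ v ->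
  path e w1 q1 -> {subset w1 :: q1 <= part x} -> uniq (w1 :: q1) -> last w1 q1 = b ->
  path e w2 q2 -> {subset w2 :: q2 <= part x} -> last w2 q2 = c -> e v c -> b \notin w2 :: q2 ->
  private y1 [set w1] -> private y2 [set w2] ->
  (forall y, y \in Y -> [\/ y = y1, y = y2 | private y (C :\: part x)]) ->
  u \in w1 :: q1 -> u != b -> w \in w2 :: q2 -> e u w -> False.
Proof.
move=> xC; case/lastP: q1 => [|q1 b'].
  by move=> _ _ _ /= <- _ _ _ _ _ _ _ _; rewrite inE => ->.
rewrite last_rcons => pq1 s1 up1 eb; subst b'; move=> pq2 s2 lq2 evc bP2 h1 h2 hY uP ub wP euw.
have uq : u \in w1 :: q1 by move: uP; rewrite -rcons_cons mem_rcons inE (negbTE ub).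
have nb : b \notin w1 :: q1 by move: up1; rewrite -rcons_cons rcons_uniq => /andP[].
have c1 : conn e [set z in w1 :: q1] by apply: path_conn => //; move: pq1; rewrite rcons_path => /andP[].
have c2 := path_conn es pq2.
have cU : conn e ([set z in w1 :: q1] :|: [set z in w2 :: q2]).
  by apply: (conn_unionE es c1 c2 _ _ euw); rewrite inE.
have sU : [set z in w1 :: q1] :|: [set z in w2 :: q2] \subset part x.
  rewrite subUset; apply/andP; split; apply/subsetP=> z; rewrite inE => zq; last exact: s2.
  by apply: s1; rewrite -rcons_cons mem_rcons inE zq orbT.
have nU : exists2 b0, b0 \in [set z in w1 :: q1] :|: [set z in w2 :: q2] & e v b0.
  exists c => //; rewrite in_setU; apply/orP; right; rewrite inE -lq2; exact: mem_last.
have := shrink xC sU sU cU cU nU nU; rewrite setUid => sh.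
have : b \in [set z in w1 :: q1] :|: [set z in w2 :: q2].
  rewrite sh; first by apply: s1; rewrite -rcons_cons mem_rcons mem_head.
  have at1 w0 y (q : seq T) : private y [set w0] -> w0 \in q -> exists2 z, z \in q & e z y.
    move=> py wq; have /andP[yY _] := py; have [z zC ezy] := hitC yY; exists z => //.
    by have := privateP py zC ezy; rewrite inE => /eqP->.
  move=> y yY; case: (hY y yY) => [->|->|py].
  - have [z zq ezy] := at1 w1 y1 (w1 :: q1) h1 (mem_head _ _); exists z => //.
    by rewrite !in_setU [z \in [set z in w1 :: q1]]inE zq !orbT.
  - have [z zq ezy] := at1 w2 y2 (w2 :: q2) h2 (mem_head _ _); exists z => //.
    by rewrite !in_setU [z \in [set z in w2 :: q2]]inE zq !orbT.
  have [z zC ezy] := hitC yY; exists z => //.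
  by rewrite in_setU in_setU (privateP py zC ezy).
by rewrite in_setU !in_set (negbTE nb) (negbTE bP2).
Qed.

(** Two vertices of Y are tied to single vertices [w1], [w2] of the component, and the third one to
    C outside it. By minimality the component is the union of two paths from [w1], [w2] to
    neighbours b, c of v. It is connected, and by [no_shortcut] only the edge bc can join the two
    paths. *)
Lemma triangle_case x a0 b0 : x \in C :\ v -> a0 \in part x -> b0 \in part x -> a0 != b0 ->
  e v a0 -> e v b0 -> triangle_vertex e' v.
Proof.
move=> xC ax bx ab eva evb.
have [w1 [w2 [y1 [y2 [w1x w2x nw p1 p2]]]]] := part_two_private xC ax bx ab eva evb.
have sx := part_subC xC; have vx := v_notin_part xC.
have [|y3 p3] := private_exists (conn_component (C :\ v) x es) sx.
  by apply/eqP=> eq; case/negP: vx; rewrite /part eq.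
have dxy w : w \in part x -> [disjoint [set w] & C :\: part x].
  by move=> wx; rewrite disjoints1 inE wx.
have n12 : y1 != y2.
  apply/eqP=> eq; rewrite -eq in p2; apply: (private_disjoint p1 p2).
  by rewrite disjoints1 inE.
have n13 : y1 != y3 by apply/eqP=> eq; rewrite -eq in p3; apply: (private_disjoint p1 p3 (dxy _ w1x)).
have n23 : y2 != y3 by apply/eqP=> eq; rewrite -eq in p3; apply: (private_disjoint p2 p3 (dxy _ w2x)).
have y1Y : y1 \in Y by case/andP: p1.
have y2Y : y2 \in Y by case/andP: p2.
have y3Y : y3 \in Y by case/andP: p3.
have YE : Y = [set y1; y2; y3].
  apply/esym/eqP; rewrite eqEcard !subUset !sub1set y1Y y2Y y3Y /=; apply: leq_trans Y3 _.
  by rewrite setUC cardsU1 !inE cards2 n12 !(eq_sym y3) (negbTE n13) (negbTE n23).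
have Y_cases y : y \in Y -> [\/ y = y1, y = y2 | y = y3].
  by rewrite YE !inE => /orP[/orP[]|] /eqP->; [constructor 1 | constructor 2 | constructor 3].
have hY y : y \in Y -> [\/ y = y1, y = y2 | private y (C :\: part x)].
  by case/Y_cases=> ->; [constructor 1 | constructor 2 | constructor 3].
have hY' y : y \in Y -> [\/ y = y2, y = y1 | private y (C :\: part x)].
  by case/Y_cases=> ->; [constructor 2 | constructor 1 | constructor 3].
have at1 w0 y : private y [set w0] -> e w0 y.
  move=> py; have /andP[yY _] := py; have [z zC ezy] := hitC yY.
  by have := privateP py zC ezy; rewrite inE => /eqP <-.
have [q1 [b [pq1 s1 u1 [l1 evb'] o1]]] := path_to_nbr xC w1x.
have [q2 [c [pq2 s2 u2 [l2 evc] o2]]] := path_to_nbr xC w2x.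
have bP : b \in w1 :: q1 by rewrite -l1 mem_last.
have cP : c \in w2 :: q2 by rewrite -l2 mem_last.
have xE : [set z in w1 :: q1] :|: [set z in w2 :: q2] = part x.
  apply: (shrink xC); [ | | exact: path_conn | exact: path_conn | | | ].
  - by apply/subsetP=> z; rewrite inE; apply: s1.
  - by apply/subsetP=> z; rewrite inE; apply: s2.
  - by exists b; rewrite // inE.
  - by exists c; rewrite // inE.
  move=> y /hY[->|->|py].
  - by exists w1; rewrite ?at1 // !in_setU [w1 \in [set z in w1 :: q1]]inE mem_head !orbT.
  - by exists w2; rewrite ?at1 // !in_setU [w2 \in [set z in w2 :: q2]]inE mem_head !orbT.
  have /andP[yY _] := py; have [z zC ezy] := hitC yY; exists z => //.
  by rewrite in_setU in_setU (privateP py zC ezy).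
have nbx z : z \in part x -> e v z -> z = b \/ z = c.
  by rewrite -xE !in_setU !in_set => /orP[zq|zq] evz; [left; apply: o1 | right; apply: o2].
have bc : b != c.
  apply: contraNneq ab => ebc; apply/eqP.
  by case: (nbx a0 ax eva) => ->; case: (nbx b0 bx evb) => ->.
have bP2 : b \notin w2 :: q2 by apply: contra bc => /o2/(_ evb')->.
have cP1 : c \notin w1 :: q1 by apply: contra bc => /o1/(_ evc)->.
have bx' : b \in part x := s1 b bP; have cx' : c \in part x := s2 c cP.
have ebc : e b c.
  have bB : b \in [set z in w1 :: q1] by rewrite inE.
  have cB : c \notin [set z in w1 :: q1] by rewrite inE.
  have [u [w [ux uP wx wP euw]]] := conn_boundary (conn_component (C :\ v) x es) bx' bB cx' cB.
  have wP2 : w \in w2 :: q2.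
    by have := wx; rewrite -[component _ _ _]xE in_setU (negbTE wP) inE.
  rewrite inE in uP; have [eub|nub] := eqVneq u b; have [ewc|nwc] := eqVneq w c.
  - by rewrite -eub -ewc.
  - case: (no_shortcut xC pq2 s2 u2 l2 pq1 s1 l1 evb' cP1 p2 p1 hY' wP2 nwc uP); by rewrite es.
  - by case: (no_shortcut xC pq1 s1 u1 l1 pq2 s2 l2 evc bP2 p1 p2 hY uP nub wP2).
  by case: (no_shortcut xC pq1 s1 u1 l1 pq2 s2 l2 evc bP2 p1 p2 hY uP nub wP2).
have noty w y : w \in part x -> private y [set w] -> ~~ e v y.
  move=> wx py; apply/negP=> evy; have := privateP py vC evy; rewrite inE => /eqP evw.
  by rewrite evw wx in vx.
have inX z : z \in part x -> z \in X by move=> /(subsetP sx)/(subsetP CX).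
(* The third neighbour is [y3] if the component and v make up C. Otherwise it is the neighbour of v
   in the only other component, which owns [y3]. *)
suff [al [alX eva' nal dal onl]] : exists al, [/\ al \in X, e v al, forall z, z \in part x -> ~~ e al z,
    deg e' al <= 2 & forall u, e' v u -> u \notin part x -> u = al].
  exists al, b, c; split.
  - apply/setP=> u; rewrite !inE; apply/idP/idP => [evu|].
      have [ux|ux] := boolP (u \in part x); last by rewrite (onl u evu ux) eqxx.
      have /and3P[_ _ evu'] := evu.
      by case: (nbx u ux evu') => ->; rewrite eqxx ?orbT.
    have vX : v \in X by apply: (subsetP CX).
    by move=> /orP[/orP[]|] /eqP->; apply/and3P; split=> //; apply: inX.
  - by apply/and3P; split=> //; apply: inX.
  - by apply/negP=> /and3P[_ _]; apply/negP/nal.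
  - by apply/negP=> /and3P[_ _]; apply/negP/nal.
  exact: dal.
have [all|[x2 [x2C x2v x2x]]] : (forall z, z \in C -> z = v \/ z \in part x) \/
    exists x2, [/\ x2 \in C, x2 != v & x2 \notin part x].
  have [[x2 h]|none] := pselect (exists x2, [/\ x2 \in C, x2 != v & x2 \notin part x]); first by right; exists x2.
  left=> z zC; have [->|zv] := eqVneq z v; [by left | right].
  by apply: contraT => zx; case: none; exists z.
- have evy3 : e v y3.
    have [z zC ezy] := hitC y3Y; have := privateP p3 zC ezy.
    by rewrite inE => /andP[zx _]; case: (all z zC) => [<-//|zx']; rewrite zx' in zx.
  exists y3; split=> //.
  - exact: (subsetP YX).
  - move=> z zx; apply/negP; rewrite es => ezy; have := privateP p3 (subsetP sx z zx) ezy.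
    by rewrite inE zx.
  - by have [] := leaf vC (introT orP (or_introl (eqxx v))) y3Y evy3.
  move=> u evu ux; have [evu' /orP[uC|uY]] := nbr_cases vC (introT orP (or_introl (eqxx v))) evu.
    by case: (all u uC) => [euv|ux']; [rewrite euv ei in evu' | rewrite ux' in ux].
  case: (Y_cases u uY) => // eu; rewrite eu in evu'.
    by have := noty w1 y1 w1x p1; rewrite evu'.
  by have := noty w2 y2 w2x p2; rewrite evu'.
have x2Cv : x2 \in C :\ v by rewrite !inE x2v.
have [al alx2 eval] := part_nbr x2Cv.
have alCv := subsetP (part_sub x2Cv) al alx2; have alC : al \in C by case/setD1P: alCv.
have pal := part_eq alx2; have dj2 := part_disjoint x2Cv xC x2x.
have alx : al \notin part x.
  by apply/negP=> alx; move/disjoint_setI0/setP/(_ al): dj2; rewrite in_setI in_set0 alx2 alx.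
have only3 z y : z \in C :\ v -> z \notin part x -> private y (part z) -> y = y3.
  move=> zC zx py; have /andP[yY _] := py; have dz := part_disjoint zC xC zx.
  have dzw w : w \in part x -> [disjoint [set w] & part z].
    move=> wx; rewrite disjoints1; apply/negP=> wz.
    by move/disjoint_setI0/setP/(_ w): dz; rewrite in_setI in_set0 wz wx.
  case: (Y_cases y yY) => // ey; rewrite ey in py.
    by case: (private_disjoint p1 py (dzw _ w1x)).
  by case: (private_disjoint p2 py (dzw _ w2x)).
have [y0 py0] := part_private alCv; have ey0 := only3 al y0 alCv alx py0; subst y0.
have notin z y w : z \in C :\ v -> z \notin part x -> w \in part x -> private y [set w] ->
    forall t, t \in part z -> ~~ e t y.
  move=> zC zx wx py t tz; apply/negP=> ety; have := privateP py (subsetP (part_subC zC) t tz) ety.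
  rewrite inE => /eqP etw; have := part_disjoint zC xC zx => /disjoint_setI0/setP/(_ t).
  by rewrite in_setI in_set0 tz etw wx.
exists al; split=> //.
- exact: (subsetP CX).
- move=> z zx; apply/negP; rewrite es => ezal; case/negP: alx.
  by apply: (component_edge zx _ alCv ezal); apply: (subsetP (part_sub xC)).
- apply: (pendant_deg alCv eval py0).
    move=> b' b'a evb'2; apply/eqP; apply: contraT => nb'.
    have [v1 [v2 [z1 [z2 [v1a v2a nv q1' q2']]]]] :=
      part_two_private alCv b'a (mem_component _ _ _) nb' evb'2 eval.
    have up w y : w \in part al -> private y [set w] -> y = y3.
      move=> wa /andP[yY h]; apply: (only3 al) => //; rewrite /private yY /=.
      apply/forall_inP=> t tC; apply/implyP=> ety; have := forall_inP h t tC; rewrite ety inE.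
      by move=> /eqP->.
    have e1 := up _ _ v1a q1'; have e2 := up _ _ v2a q2'; subst z1 z2.
    by case: (private_disjoint q1' q2'); rewrite disjoints1 inE.
  move=> y t yY ny ta; case: (Y_cases y yY) => ey; rewrite ey in ny *; last by rewrite eqxx in ny.
    exact: (notin al y1 w1).
  exact: (notin al y2 w2).
move=> u evu ux; have [evu' /orP[uC|uY]] := nbr_cases vC (introT orP (or_introl (eqxx v))) evu.
  have uCv : u \in C :\ v by rewrite !inE uC andbT; apply: contraTneq evu' => ->; rewrite ei.
  have [y' py'] := part_private uCv; have ey' := only3 u y' uCv ux py'; subst y'.
  apply/eqP; apply: contraT => nua.
  have [ual|ual] := boolP (u \in part al).
    have [v1 [v2 [z1 [z2 [v1a v2a nv q1' q2']]]]] :=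
      part_two_private alCv ual (mem_component _ _ _) nua evu' eval.
    have up w y : w \in part al -> private y [set w] -> y = y3.
      move=> wa /andP[yY h]; apply: (only3 al) => //; rewrite /private yY /=.
      apply/forall_inP=> t tC; apply/implyP=> ety; have := forall_inP h t tC; rewrite ety inE.
      by move=> /eqP->.
    have e1 := up _ _ v1a q1'; have e2 := up _ _ v2a q2'; subst z1 z2.
    by case: (private_disjoint q1' q2'); rewrite disjoints1 inE.
  by case: (private_disjoint py' py0 (part_disjoint uCv alCv ual)).
case: (Y_cases u uY) => eu; rewrite eu in evu'.
- by have := noty w1 y1 w1x p1; rewrite evu'.
- by have := noty w2 y2 w2x p2; rewrite evu'.
by have := privateP py0 vC evu'; rewrite (negbTE (v_notin_part alCv)).
Qed.

Theorem local_good : good e' v.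
Proof.
have vv : (v == v) || e v v by rewrite eqxx.
have [[x [a [b [xC ax bx ab [eva evb]]]]]|simple] := pselect (exists x a b,
    [/\ x \in C :\ v, a \in part x, b \in part x, a != b & e v a /\ e v b]).
  by constructor 3; apply: (triangle_case xC ax bx ab).
have one a b : a \in C :\ v -> b \in part a -> e v a -> e v b -> b = a.
  move=> aC ba eva evb; apply/eqP; apply: contraT => nab; case: simple.
  by exists a, b, a; split=> //; exact: mem_component.
have inCv u : u \in C -> e v u -> u \in C :\ v.
  by move=> uC evu; rewrite !inE uC andbT; apply: contraTneq evu => ->; rewrite ei.
(* Each neighbour of v is charged to a vertex of Y: one in C to a private vertex of its component,
   one in Y to itself. *)
have /choice[g gP] : forall u, exists y, e' v u ->
    if u \in C then private y (part u) else (y == u) && (u \in Y).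
  move=> u; have [uC|uC] := boolP (u \in C); last first.
    by exists u => /(nbr_cases vC vv)[_]; rewrite (negbTE uC) eqxx.
  have [evu|evu] := boolP (e v u); last by exists u => /(nbr_cases vC vv)[evu']; rewrite evu' in evu.
  by have [y py] := part_private (inCv u uC evu); exists y.
pose N := [set u | e' v u].
have gY u : u \in N -> g u \in Y.
  rewrite inE => /gP; case: ifP => _; first by case/andP.
  by case/andP=> /eqP->.
have gI : {in N &, injective g}.
  move=> u u'; rewrite !inE => evu evu'; have := gP u evu; have := gP u' evu'.
  have [e1 c1] := nbr_cases vC vv evu; have [e2 c2] := nbr_cases vC vv evu'.
  have mixed t t' : t \in C -> e v t -> t' \in Y -> e v t' -> private t' (part t) -> False.
    move=> tC evt tY evt' pt; have := privateP pt vC evt'.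
    by rewrite (negbTE (v_notin_part (inCv t tC evt))).
  case: ifP => uC'; case: ifP => uC.
  - move=> pu' pu eq; rewrite eq in pu; apply/eqP; apply: contraT => nuu.
    apply: False_ind; apply: (private_disjoint pu pu'); apply: part_disjoint; rewrite ?inCv //.
    by apply: contra nuu => h; rewrite (one u' u) ?inCv.
  - move=> pu' /andP[/eqP gu uY] eq; rewrite -eq gu in pu'.
    by case: (mixed u' u).
  - move=> /andP[/eqP gu uY] pu eq; rewrite eq gu in pu.
    by case: (mixed u u').
  by move=> /andP[/eqP-> _] /andP[/eqP-> _].
have gN : g @: N \subset Y by apply/subsetP=> _ /imsetP[u uN ->]; apply: gY.
have dN : deg e' v = #|g @: N| by rewrite card_in_imset.
have [d2|d2] := leqP (deg e' v) 2; first by constructor 1.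
(* With three neighbours the charging is onto Y. A component is then adjacent to no vertex of Y but
   its own, as [pendant_deg] requires. *)
have gE : g @: N = Y by apply/eqP; rewrite eqEcard gN -dN; apply: leq_trans d2.
constructor 2; split.
  by apply/eqP; rewrite eqn_leq d2 andbT dN gE.
move=> u evu; have [evu' cu] := nbr_cases vC vv evu; have := gP u evu.
case: ifP => uC pu; last first.
  by case/andP: pu => _ uY; have [] := leaf vC vv uY evu'.
have uCv := inCv u uC evu'; apply: (pendant_deg uCv evu' pu).
  by move=> b bu evb; apply: one.
move=> y x yY nyu xu; apply/negP=> exy; have xC := subsetP (part_subC uCv) x xu.
move: yY; rewrite -gE => /imsetP[u']; rewrite inE => evu2 ey; have [evu2' cu2] := nbr_cases vC vv evu2.
have := gP u' evu2; case: ifP => uC'; last first.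
  case/andP=> /eqP gu' uY'; have [un _] := leaf vC vv uY' evu2'.
  have := un x xC; rewrite -gu' -ey => /(_ exy) exv.
  by have := v_notin_part uCv; rewrite -exv xu.
move=> pu'; have uCv' := inCv u' uC' evu2'; have := privateP pu' xC; rewrite -ey => /(_ exy) xu'.
have euu : u' = u by apply: one => //; rewrite -(part_eq xu) (part_eq xu'); exact: mem_component.
by rewrite ey euu eqxx in nyu.
Qed.

End Local.

(** * Making the vertices of one class good *)

Lemma greedy_colouring (T : finType) (r : rel T) k : symmetric r ->
  (forall x, #|[set y | r x y && (y != x)]| <= k) ->
  exists col : T -> nat, (forall x, col x <= k) /\
    forall x y, r x y -> col x = col y -> x = y.
Proof.
move=> rs rk; suff H (A : {set T}) : exists col : T -> nat, (forall x, col x <= k) /\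
    {in A &, forall x y, r x y -> col x = col y -> x = y}.
  by have [col [h1 h2]] := H setT; exists col; split=> // x y; apply: h2; rewrite inE.
have [m mA] := ubnP #|A|; elim: m A mA => // m IH A mA.
have [->|/set0Pn[x xA]] := eqVneq A set0.
  by exists (fun _ => 0); split=> // x y; rewrite inE.
have [|col [ck cA]] := IH (A :\ x); first by rewrite (cardsD1 x) xA in mA.
pose used := [set (inord (col y) : 'I_k.+1) | y in [set y | r x y && (y != x)]].
have /subsetPn[i _ iu] : ~~ ([set: 'I_k.+1] \subset used).
  apply/negP=> /subset_leq_card; rewrite cardsT card_ord => /leq_trans/(_ (leq_imset_card _ _)).
  by rewrite ltnNge rk.
exists (fun y => if y == x then i : nat else col y); split.
  by move=> y; case: ifP => // _; rewrite -ltnS.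
have iN y : r x y -> y != x -> (i : nat) <> col y.
  move=> rxy yx iy; case/negP: iu; apply/imsetP; exists y; rewrite ?inE ?rxy //.
  by apply: val_inj; rewrite /= inordK ?ltnS.
move=> y z yA zA ryz; have [ey|yx] := eqVneq y x; have [ez|zx] := eqVneq z x.
- by rewrite ey ez.
- by rewrite ey in ryz; move/(iN z ryz zx).
- by rewrite ez rs in ryz; move/esym/(iN y ryz yx).
by apply: cA => //; rewrite !inE ?yx ?zx.
Qed.

Section Ball.
Variables (T : finType).
Implicit Types (d : rel T) (x y z : T).

Fixpoint ball d n x : {set T} :=
  if n is m.+1 then \bigcup_(y in ball d m x) (y |: [set z | d y z]) else [set x].

Lemma ball_step d n x y z : y \in ball d n x -> (z == y) || d y z -> z \in ball d n.+1 x.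
Proof. by move=> yb h; apply/bigcupP; exists y; rewrite // !inE. Qed.

Lemma mem_ball d n x : x \in ball d n x.
Proof. by elim: n => [|n IH]; [rewrite inE | apply: ball_step IH _; rewrite eqxx]. Qed.

Lemma ball_trans d m n x y z : y \in ball d m x -> z \in ball d n y -> z \in ball d (m + n) x.
Proof.
move=> yx; elim: n z => [|n IH] z; first by rewrite inE addn0 => /eqP->.
case/bigcupP=> u /IH ux zu; rewrite addnS; apply: ball_step ux _.
by move: zu; rewrite !inE.
Qed.

Lemma ball_sym d n x y : symmetric d -> y \in ball d n x -> x \in ball d n y.
Proof.
move=> ds; elim: n y => [|n IH] y; first by rewrite !inE eq_sym.
case/bigcupP=> u /IH xu yu; rewrite -add1n; apply: ball_trans xu.
by apply: ball_step (mem_ball _ 0 _) _; rewrite eq_sym ds; move: yu; rewrite !inE.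
Qed.

Lemma ball_mono d d' n x : subrel d d' -> ball d n x \subset ball d' n x.
Proof.
move=> s; elim: n => [|n IH] //; apply/subsetP=> z /bigcupP[y /(subsetP IH) yb zy].
apply: ball_step yb _; move: zy; rewrite !inE => /orP[->//|/s->]; exact: orbT.
Qed.

Lemma ball_sub e (A : {set T}) n x : x \in A -> ball (restr e A) n x \subset A.
Proof.
move=> xA; elim: n => [|n IH]; first by rewrite sub1set.
apply/subsetP=> z /bigcupP[y /(subsetP IH) yA]; rewrite !inE => /predU1P[->//|].
by case/and3P.
Qed.

Lemma conn_ball d n x : symmetric d -> conn d (ball d n x).
Proof.
move=> ds; elim: n => [|n IH]; first exact: conn1.
have sub : ball d n x \subset ball d n.+1 x.
  by apply/subsetP=> y yb; apply: ball_step yb _; rewrite eqxx.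
apply: (conn_from ds (mem_ball d n.+1 x)) => z zb; have /bigcupP[y yb zy] := zb.
apply: connect_trans (conn_connect_sub IH sub (mem_ball _ _ _) yb) _.
move: zy; rewrite !inE => /predU1P[->|dyz]; first exact: connect0.
by apply: connect1; apply/and3P; split=> //; apply: (subsetP sub).
Qed.

Lemma card_ball d g n x : (forall y, deg d y <= g) -> #|ball d n x| <= g.+1 ^ n.
Proof.
move=> dg; elim: n => [|n IH]; first by rewrite cards1.
apply: leq_trans (_ : _ <= \sum_(y in ball d n x) g.+1) _; last first.
  by rewrite sum_nat_const expnSr leq_mul2r IH orbT.
apply: leq_trans (_ : _ <= \sum_(y in ball d n x) #|y |: [set z | d y z]|) _.
  rewrite /=; elim/big_rec2: _ => [|y a A _ h]; first by rewrite cards0.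
  by apply: leq_trans (leq_card_setU _ _).1 _; rewrite leq_add2l.
apply: leq_sum => y _; apply: leq_trans (leq_card_setU _ _).1 _; rewrite cards1 add1n ltnS.
exact: dg.
Qed.

End Ball.

(** No bramble set is {x} alone, since it would then hit all of them with one vertex. So each set
    through the leaf x contains its neighbour y, and x can be folded onto y. *)
Lemma big_delete_leaf (T : finType) (h : rel T) n x : symmetric h -> irreflexive h -> 1 < n ->
  deg h x = 1 -> big h n -> big (restr h (~: [set x])) n.
Proof.
move=> hs hi n1 /eqP/cards1P[y xy] [F [cF iF oF]].
have hx z : h x z = (z == y) by have := in_set (h x) z; rewrite xy inE.
have yx : y != x by apply/eqP=> e; have := hx y; rewrite e hi eqxx.
have noty S : S \in F -> x \in S -> y \in S.
  move=> SF xS; have [z zS zx] : exists2 z, z \in S & z != x.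
    apply: contrapT => none; suff : n <= #|[set x]| by rewrite cards1 leqNgt n1.
    apply: oF => S' S'F; have /set0Pn[z /setIP[zS zS']] := iF _ _ SF S'F.
    have ex : z = x by apply/eqP; apply: contraT => zx; case: none; exists z.
    by apply/set0Pn; exists x; rewrite !inE eqxx andbT -ex.
  have zx' : z \notin [set x] by rewrite inE.
  have [u [w [_ + wS _]]] := conn_boundary (cF _ SF) xS (set11 x) zS zx'.
  by rewrite inE => /eqP->; rewrite hx => /eqP <-.
pose Phi a := [set if a == x then y else a].
exists [set \bigcup_(a in S) Phi a | S : {set T} in F]; split.
- move=> _ /imsetP[S SF ->]; apply: (conn_bigcup (e' := h)); last exact: cF.
  + exact: restr_sym.
  + by move=> a; apply: conn1.
  move=> a b hab; rewrite /Phi; have [ea|ax] := eqVneq a x.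
    by move: hab; rewrite ea hx => /eqP->; rewrite (negbTE yx) setUid conn1.
  have [eb|bx] := eqVneq b x.
    by move: hab; rewrite eb hs hx => /eqP->; rewrite setUid conn1.
  apply: conn_edge; first exact: restr_sym.
  by rewrite /restr /= !inE ax bx.
- move=> _ _ /imsetP[S1 F1 ->] /imsetP[S2 F2 ->].
  have /set0Pn[a /setIP[a1 a2]] := iF _ _ F1 F2.
  apply/set0Pn; exists (if a == x then y else a).
  by apply/setIP; split; apply/bigcupP; exists a; rewrite // inE.
move=> Y hY; apply: oF => S SF.
have /set0Pn[z /setIP[/bigcupP[a aS]]] := hY _ (imset_f (fun S : {set T} => \bigcup_(a in S) Phi a) SF).
rewrite inE => /eqP-> zY; apply/set0Pn; move: zY; case: eqP => [ea|_] zY; last by exists a; apply/setIP.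
by exists y; rewrite inE zY andbT noty // -ea.
Qed.

Lemma big_minimal (T : finType) (h : rel T) n : symmetric h -> irreflexive h -> 1 < n -> big h n ->
  exists h' : rel T, [/\ symmetric h', subrel h' h, big h' n & forall x, deg h' x != 1].
Proof.
move=> hs hi n1; have [m] := ubnP #|[set p : T * T | h p.1 p.2]|.
elim: m h hs hi => // m IH h hs hi hm bh.
have [[x /eqP dx]|none] := pselect (exists x, deg h x == 1); last first.
  by exists h; split=> // x; apply/negP=> dx; apply: none; exists x.
have bh' := big_delete_leaf hs hi n1 dx bh.
have sub : subrel (restr h (~: [set x])) h by move=> a b /and3P[].
have ri : irreflexive (restr h (~: [set x])) by move=> a; apply/negP=> /sub; rewrite hi.
have rm : #|[set p : T * T | restr h (~: [set x]) p.1 p.2]| < m.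
  rewrite -ltnS; apply: leq_trans hm; rewrite ltnS; apply: proper_card; apply/properP; split.
    by apply/subsetP=> p; rewrite !in_set; apply: sub.
  move/eqP/cards1P: dx => [y /setP/(_ y)]; rewrite !inE eqxx => hxy.
  by exists (x, y); rewrite in_set //= /restr /= !inE eqxx.
have [h' [s1 s2 s3 s4]] := IH _ (restr_sym _ hs) ri rm bh'.
by exists h'; split=> // a b /s2/sub.
Qed.

Section Class.
Variables (T : finType) (e : rel T) (X D I : {set T}) (g : nat).
Hypotheses (es : symmetric e) (ei : irreflexive e)
  (small : forall x, x \notin D -> deg e x <= 2)
  (dg : forall x, deg (restr e D) x <= g)
  (far : forall v w, v \in I -> w \in I -> w \in ball (restr e D) 5 v -> w = v).

Let J := I :&: (D :&: X).
Let d := restr e (D :&: X).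
Let B v := ball d 2 v.
(** The contraction of all balls. The quotient keeps T as vertex type, a ball being represented by
    its centre. *)
Let rho x := odflt x [pick v in J | x \in B v].

Let ds : symmetric d. Proof. exact: restr_sym. Qed.

Let dD : subrel d (restr e D).
Proof. by apply: sub_restr => //; apply: subsetIl. Qed.

Let B_sub v : v \in J -> B v \subset D :&: X.
Proof. by case/setIP=> _ vDX; apply: ball_sub. Qed.

Let far_balls v w x y : v \in J -> w \in J -> x \in B v -> y \in B w -> (y == x) || e x y -> w = v.
Proof.
move=> vJ wJ xv yw xy; have [vI _] := setIP vJ; have [wI _] := setIP wJ; apply: far => //.
have xDX := subsetP (B_sub vJ) x xv; have yDX := subsetP (B_sub wJ) y yw.
(* Two steps from v to x, at most one from x to y, and two from y to w. *)
apply: (subsetP (ball_mono _ _ dD)); rewrite -[5]/(3 + 2).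
apply: ball_trans (ball_sym ds yw); apply: ball_step xv _.
by case/orP: xy => [->//|exy]; rewrite /d /restr /= xDX yDX exy orbT.
Qed.

Let rho_ball v x : v \in J -> x \in B v -> rho x = v.
Proof.
move=> vJ xv; rewrite /rho; case: pickP => [w /andP[wJ xw]|/(_ v)]; last by rewrite vJ xv.
by apply: (far_balls vJ wJ xv xw); rewrite eqxx.
Qed.

Let rho_cases x : (rho x = x /\ forall v, v \in J -> x \notin B v) \/ (rho x \in J /\ x \in B (rho x)).
Proof.
rewrite /rho; case: pickP => [v /andP[]|none]; [by right | left; split=> // v vJ].
by apply/negP=> xv; have := none v; rewrite vJ xv.
Qed.

Let rho_out x : rho x \notin J -> rho x = x.
Proof. by case: (rho_cases x) => [[]|[->]]. Qed.

Let q : rel T := [rel a b | (a != b) &&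
  [exists x, exists y, [&& x \in X, y \in X, rho x == a, rho y == b & e x y]]].

Let qP a b : q a b -> a != b /\ exists x y, [/\ x \in X, y \in X, rho x = a, rho y = b & e x y].
Proof.
case/andP=> ab /existsP[x /existsP[y /and5P[xX yX /eqP xa /eqP yb exy]]].
by split=> //; exists x, y.
Qed.

Let qI x y : x \in X -> y \in X -> e x y -> rho x != rho y -> q (rho x) (rho y).
Proof.
move=> xX yX exy ne; apply/andP; split=> //; apply/existsP; exists x; apply/existsP; exists y.
by rewrite xX yX exy !eqxx.
Qed.

Let qs : symmetric q.
Proof.
suff s a b : q a b -> q b a by move=> a b; apply/idP/idP; apply: s.
case/qP=> ne [x [y [xX yX xa yb exy]]]; rewrite -xa -yb in ne *.
by apply: qI => //; [rewrite es | rewrite eq_sym].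
Qed.

(** A fibre of [rho] lies in one ball of radius 2 in D, which has at most (g + 1)^2 vertices
    whatever the degrees in e are. *)
Lemma big_contract n : big (restr e X) (g.+1 ^ 2 * n) -> big q n.
Proof.
apply: (big_transfer (Phi := fun x => [set rho x])) => //.
- by move=> x; apply: conn1.
- move=> a b /and3P[aX bX eab]; have [->|ne] := eqVneq (rho a) (rho b).
    by rewrite setUid conn1.
  by apply: conn_edge => //; apply: qI.
move=> x; have [xJ|xJ] := boolP (x \in J).
  apply: leq_trans (card_ball 2 x (d := d) (g := g) _); last first.
    by move=> y; apply: leq_trans (dg y); apply: deg_mono.
  apply: subset_leq_card; apply/subsetP=> a; rewrite !inE => /eqP xa.
  case: (rho_cases a) => [[ea _]|[_]]; last by rewrite -xa.
  by rewrite xa ea; apply: mem_ball.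
apply: leq_trans (_ : #|[set x]| <= _); last by rewrite cards1 expn_gt0.
apply: subset_leq_card; apply/subsetP=> a; rewrite !inE => /eqP xa.
by rewrite xa in xJ *; rewrite -{1}(rho_out xJ).
Qed.

Section Subcubic.
Variables (h : rel T) (n : nat).
Hypotheses (hs : symmetric h) (hq : subrel h q) (h3 : forall x, deg h x <= 3)
  (h1 : forall x, deg h x != 1) (hn : big h (2 * n)).

Let Y v := [set y | h v y].

Let nbr_out v y : v \in J -> y \in Y v ->
  [/\ y \in X, forall w, w \in J -> y \notin B w, rho y = y & exists2 x, x \in B v & e x y].
Proof.
move=> vJ; rewrite inE => /hq/qP[ne [x [z [xX zX xv zy exz]]]].
have xB : x \in B v.
  case: (rho_cases x) => [[ex _]|[_]]; last by rewrite xv.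
  by rewrite -xv ex; apply: mem_ball.
case: (rho_cases z) => [[ez hz]|[zJ zB]].
  by rewrite ez in zy; subst z; split=> //; exists x.
case/eqP: ne; rewrite -zy; symmetry; apply: (far_balls vJ zJ xB zB).
by rewrite exz orbT.
Qed.

Let two_nbrs x : 0 < deg h x -> 2 <= deg h x.
Proof. by have := h1 x; case: (deg h x) => [|[]]. Qed.

(* Vertices of h have degree at least 2 in h, so that those outside D use all their edges. *)
Lemma rho_inj_nbrs u : u \notin D -> 0 < deg h u ->
  {in [set x | e u x] &, injective rho} /\ forall x, e u x -> h u (rho x).
Proof.
move=> uD /two_nbrs u2; have uJ : u \notin J by apply: contra uD => /setIP[_ /setIP[]].
have sub : [set y | h u y] \subset rho @: [set x | e u x].
  apply/subsetP=> y; rewrite inE => /hq/qP[_ [x [z [_ _ xu <- exz]]]].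
  have xJ : rho x \notin J by rewrite xu.
  by apply: imset_f; rewrite inE -xu (rho_out xJ).
have le := leq_imset_card rho [set x | e u x].
have dle : deg e u <= deg h u by apply: leq_trans u2; apply: small.
have eN : [set y | h u y] = rho @: [set x | e u x].
  by apply/eqP; rewrite eqEcard sub /=; apply: leq_trans le dle.
split.
  apply/imset_injP; rewrite eqn_leq le /= -eN; exact: dle.
move=> x eux; suff : rho x \in [set y | h u y] by rewrite inE.
by rewrite eN; apply: imset_f; rewrite inE.
Qed.

Let hits (C : {set T}) v := [forall y in Y v, exists x in C, e x y].

Let hitsP (C : {set T}) v : reflect (forall y, y \in Y v -> exists2 x, x \in C & e x y) (hits C v).
Proof.
apply: (iffP forall_inP) => H y yY; first by have /exists_inP := H y yY.
by apply/exists_inP; apply: H.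
Qed.

Let bag v : exists C : {set T}, v \in J ->
  [/\ C \subset B v, conn e C, hits C v &
      forall C', conn e C' -> C' \subset C -> hits C' v -> C' = C].
Proof.
have [vJ|vJ] := boolP (v \in J); last by exists set0.
have PB : [&& B v \subset B v, conn e (B v) & hits (B v) v].
  rewrite subxx /=; apply/andP; split.
    by apply: conn_mono (conn_ball 2 v ds) => a b /and3P[].
  by apply/hitsP=> y /(nbr_out vJ)[].
case: (arg_minnP (fun C : {set T} => #|C|) (i0 := B v)
  (P := fun C : {set T} => [&& C \subset B v, conn e C & hits C v]) PB) => C /and3P[CB cC hC] Cmin.
exists C => _; split=> // C' cC' sC' hC'; apply/eqP; rewrite eqEcard sC' /=.
by apply: Cmin; rewrite cC' hC' (subset_trans sC' CB).
Qed.

(** Of each ball only the minimal set [C v] is kept, and outside the balls only what h uses. The bag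
    of a is [C a] for a used centre and {a} otherwise, so a vertex x lies at most in the bags of x
    and [rho x]: hence the factor 2. *)
Lemma refine_class : exists X' : {set T}, [/\ X' \subset X, big (restr e X') n &
  forall v, v \in I -> v \in X' -> good (restr e X') v].
Proof.
have /choice[C CP] := bag.
pose X' := [set x in X | (0 < deg h (rho x)) && ((rho x \in J) ==> (x \in C (rho x)))].
have X'X : X' \subset X by apply/subsetP=> x; rewrite inE => /andP[].
have inX' v x : v \in J -> 0 < deg h v -> x \in B v -> (x \in X') = (x \in C v).
  move=> vJ v0 xv; rewrite inE (rho_ball vJ xv) v0 vJ /=.
  by have /setIP[_ ->] := subsetP (B_sub vJ) x xv.
have CX' v : v \in J -> 0 < deg h v -> C v \subset X'.
  move=> vJ v0; have [CB _ _ _] := CP v vJ; apply/subsetP=> x xC.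
  by rewrite (inX' v x vJ v0 (subsetP CB x xC)).
have outX' x : x \in X -> rho x = x -> x \notin J -> 0 < deg h x -> x \in X'.
  by move=> xX rx xJ x0; rewrite inE rx xX x0 (negbTE xJ).
have pos a b : h a b -> 0 < deg h a by move=> hab; apply/card_gt0P; exists b; rewrite inE.
have nbX' v y : v \in J -> y \in Y v -> [/\ y \in X', y \notin J & exists2 x, x \in C v & e x y].
  move=> vJ yY; have [yX out ry _] := nbr_out vJ yY; have [_ _ /hitsP hC _] := CP v vJ.
  have yJ : y \notin J by apply/negP=> yJ; have /negP := out y yJ; apply; apply: mem_ball.
  split=> //; last exact: hC.
  by apply: outX' => //; apply: (pos y v); rewrite hs; move: yY; rewrite inE.
have e's : symmetric (restr e X') by apply: restr_sym.
exists X'; split=> //.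
  pose Phi a := if (a \in J) && (0 < deg h a) then C a else [set a].
  apply: (big_transfer (Phi := Phi) e's) hn => //.
  - move=> a; rewrite /Phi; case: ifP => [/andP[aJ a0]|_]; last exact: conn1.
    by rewrite conn_restr ?CX' //; have [] := CP a aJ.
  - suff H a b : h a b -> a \in J -> conn (restr e X') (Phi a :|: Phi b).
      move=> a b hab; have [aJ|aJ] := boolP (a \in J); first exact: H.
      have [bJ|bJ] := boolP (b \in J); first by rewrite setUC; apply: H; rewrite // hs.
      rewrite /Phi (negbTE aJ) (negbTE bJ) /=; apply: conn_edge => //.
      have [_ [x [y [xX yX xa yb exy]]]] := qP (hq hab).
      have xJ : rho x \notin J by rewrite xa.
      have yJ : rho y \notin J by rewrite yb.
      have := rho_out xJ; have := rho_out yJ; rewrite xa yb => eb ea; subst x y.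
      apply/and3P; split=> //; apply: outX' => //; first exact: pos hab.
      by apply: (pos b a); rewrite hs.
    move=> hab aJ; have a0 := pos a b hab; have bY : b \in Y a by rewrite inE.
    have [bX' bJ [x xC exb]] := nbX' a b aJ bY.
    rewrite /Phi aJ a0 (negbTE bJ) /=.
    have cC : conn (restr e X') (C a) by rewrite conn_restr ?CX' //; have [] := CP a aJ.
    apply: (conn_unionE e's cC (conn1 _ b) xC (set11 b)).
    by apply/and3P; split=> //; apply: (subsetP (CX' a aJ a0)).
  move=> x; apply: leq_trans (_ : #|[set x; rho x]| <= _); last by rewrite cards2; case: (_ != _).
  apply: subset_leq_card; apply/subsetP=> a; rewrite !inE /Phi; case: ifP => [/andP[aJ _] xa|_].
    have [CB _ _ _] := CP a aJ.
    by rewrite (rho_ball aJ (subsetP CB x xa)) eqxx orbT.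
  by rewrite inE eq_sym => ->.
move=> v vI vX'; have [vD|vD] := boolP (v \in D); last first.
  by constructor 1; apply: leq_trans (small vD); apply: deg_mono => a b /and3P[].
have vJ : v \in J by rewrite !inE vI vD (subsetP X'X).
have vB : v \in B v := mem_ball _ _ _.
have v0 : 0 < deg h v by move: vX'; rewrite inE (rho_ball vJ vB) => /and3P[].
have vC : v \in C v by rewrite -(inX' v v vJ v0 vB).
have [CB cC /hitsP hC Cmin] := CP v vJ.
(* This is where radius 2 is needed: u is reached from v in two steps inside D. *)
have near x u : x \in C v -> (x == v) || e v x -> u \in X -> u \in D -> e x u -> u \in B v.
  move=> xC xv uX uD exu; have xDX := subsetP (B_sub vJ) x (subsetP CB x xC).
  have vDX := subsetP (B_sub vJ) v vB.
  apply: (ball_step (y := x)); last by rewrite /d /restr /= xDX inE uD uX exu orbT.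
  apply: (ball_step (y := v)); first exact: mem_ball.
  by rewrite /d /restr /= xDX vDX; case/orP: xv => ->; rewrite ?orbT.
have rC x : x \in C v -> rho x = v by move=> xC; apply: rho_ball => //; apply: (subsetP CB).
apply: (local_good (C := C v) (Y := Y v)) => //.
- exact: CX'.
- by apply/subsetP=> y /(nbX' v y vJ)[].
- exact: h3.
- by move=> C' cC' sC' hC'; apply: Cmin => //; apply/hitsP.
- move=> x u xC xv uX' exu; have [uB|uB] := boolP (u \in B v); first by rewrite -(inX' v u vJ v0 uB) uX'.
  have uX := subsetP X'X u uX'.
  have uD : u \notin D by apply: contra uB => uD; apply: (near x).
  have ru : rho u = u.
    case: (rho_cases u) => [[]//|[rJ rB]]; case/negP: uD.
    by have /setIP[] := subsetP (B_sub rJ) u rB.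
  have u0 : 0 < deg h u by move: uX'; rewrite inE ru => /and3P[].
  (* Since u lies outside D, h uses the edge from u to x, and it is an edge to v after contraction.
     So u belongs to Y. *)
  have [_ /(_ x)] := rho_inj_nbrs uD u0; rewrite es exu rC // => /(_ isT) huv.
  by apply/orP; right; rewrite inE hs.
move=> x y xC xv yY exy; have [yX out ry _] := nbr_out vJ yY.
have yD : y \notin D by apply: contra (out v vJ) => yD; apply: (near x).
have y0 : 0 < deg h y by apply: (pos y v); rewrite hs; move: yY; rewrite inE.
split; last by apply: leq_trans (small yD); apply: deg_mono => a b /and3P[].
(* A second neighbour of y in [C v] would be contracted to v too, against the injectivity of [rho]
   at y. *)
move=> x' x'C ex'y; have [inj _] := rho_inj_nbrs yD y0.
by apply: inj; rewrite ?inE 1?es // !rC.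
Qed.

End Subcubic.

Lemma refine_classes N n :
  (forall q', symmetric q' -> big q' N ->
     exists h : rel T, [/\ symmetric h, subrel h q', big h (2 * n.+1) & forall x, deg h x <= 3]) ->
  big (restr e X) (g.+1 ^ 2 * N) ->
  exists X' : {set T}, [/\ X' \subset X, big (restr e X') n &
    forall v, v \in I -> v \in X' -> good (restr e X') v].
Proof.
move=> mono /big_contract bq; have [h [hs hq hn h3]] := mono q qs bq.
have hi : irreflexive h by move=> a; apply/negP=> /hq; rewrite /q /= eqxx.
(* The successor in [2 * n.+1] keeps the order above 1, so that leaves can be removed. *)
have [|h' [h's h'h h'n h'1]] := big_minimal hs hi _ hn; first by lia.
have h'3 x : deg h' x <= 3 by apply: leq_trans (h3 x); apply: deg_mono.
have [|X' [X'X bX' gX']] := refine_class h's _ h'3 h'1 h'n; first by move=> a b /h'h/hq.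
by exists X'; split=> //; apply: big_le bX'.
Qed.

End Class.

Theorem good_induced g n : exists N, forall (T : finType) (e : rel T),
  symmetric e -> irreflexive e ->
  (forall x, deg (restr e [set y | 2 < deg e y]) x <= g) -> big e N ->
  exists X : {set T}, big (restr e X) n /\ forall v, good (restr e X) v.
Proof.
suff [N H] : exists N, forall (T : finType) (e : rel T) (col : T -> nat),
    symmetric e -> irreflexive e ->
    (forall x, deg (restr e [set y | 2 < deg e y]) x <= g) ->
    (forall v w, col v = col w -> w \in ball (restr e [set y | 2 < deg e y]) 5 v -> w = v) ->
    big e N -> exists X : {set T}, big (restr e X) n /\
      forall v, v \in X -> col v < (g.+1 ^ 5).+1 -> good (restr e X) v.
  exists N => T e es ei dg be; pose d := restr e [set y | 2 < deg e y].
  have ds : symmetric d by apply: restr_sym.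
  (* Vertices within distance 5 in D get different colours; a ball of radius 5 has at most (g + 1)^5
     vertices. *)
  have [||col [ck cP]] := @greedy_colouring T [rel x y | y \in ball d 5 x] (g.+1 ^ 5).
  - by move=> x y; apply/idP/idP; exact: (@ball_sym _ d 5).
  - move=> x; apply: leq_trans (card_ball 5 x dg); apply: subset_leq_card.
    by apply/subsetP=> y; rewrite inE => /andP[].
  have [v w cvw wv|X [bX gX]] := H T e col es ei dg _ be; first by symmetry; apply: cP.
  exists X; split=> // v; have [vX|vX] := boolP (v \in X); first by apply: gX; rewrite ?ltnS.
  constructor 1; rewrite /deg (_ : [set y | _] = set0) ?cards0 //.
  by apply/setP=> y; rewrite !inE /restr /= (negbTE vX).
(* Induction on the number of colours treated. The order n is generalized, because the colours below
   k must leave an order large enough for the contraction at colour k. *)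
move: ((g.+1 ^ 5).+1) => K; elim: K n => [|k IH] n.
  exists n => T e col es ei dg far be; exists setT; split=> //.
  by apply: big_mono be => x y exy; rewrite /restr /= !inE.
have [M mono] := monochromatic (2 * n.+1); have [N HN] := IH (g.+1 ^ 2 * M).
exists N => T e col es ei dg far be; have [X [bX gX]] := HN T e col es ei dg far be.
have small x : x \notin [set y | 2 < deg e y] -> deg e x <= 2 by rewrite inE -leqNgt.
have far' v w : v \in [set v | col v == k] -> w \in [set v | col v == k] ->
    w \in ball (restr e [set y | 2 < deg e y]) 5 v -> w = v.
  by rewrite !inE => /eqP <- /eqP cw; apply: far.
have [|X' [X'X bX' gX']] := refine_classes (n := n) (N := M) es ei small dg far' _ bX.
  move=> q qs bq; have [c [h [hs hq hn h3]]] := mono T q (fun=> true) qs bq; exists h; split=> // x.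
  by apply: leq_trans (h3 x) _; case: (_ == c).
exists X'; split=> // v vX' ck; have [ek|nk] := eqVneq (col v) k; first by apply: gX'; rewrite // inE ek.
by rewrite -(restr_restr _ X'X); apply: good_restr; apply: gX; [apply: (subsetP X'X) | move: ck nk; rewrite ltnS leq_eqVlt; case: eqP].
Qed.

(** * Chords *)

Lemma tmrel_degree (T' T : finType) (e' : rel T') (e : rel T) f p u :
  symmetric e' -> irreflexive e' -> tmodel e' e f p -> (forall x, 1 < deg e' x) ->
  (exists x, u = f x) \/ (exists x y, e' x y /\ u \in p x y) -> 1 < deg (tmrel e' f p) u.
Proof.
move=> es' ei' tm d2; have [fI _ _ hf [hd _]] := tm.
case=> [[x ->]|[x [y [exy uxy]]]].
  pose g y := head (f y) (p x y).
  have gI : {in [set y | e' x y] &, injective g}.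
    move=> y z; rewrite !inE /g => exy exz.
    case ey: (p x y) => [|a s]; case ez: (p x z) => [|b t] /= eq.
    - exact: fI.
    - by have := hf x z y exz; rewrite ez eq mem_head.
    - by have := hf x y z exy; rewrite ey -eq mem_head.
    have : [set x; y] = [set x; z] by apply: (hd _ _ _ _ a); rewrite ?ey ?ez ?eq ?mem_head.
    move/setP/(_ y); rewrite !inE eqxx orbT => /esym/orP[/eqP eyx|/eqP //].
    by rewrite eyx ei' in exy.
  apply: leq_trans (d2 x) _; rewrite /deg -(card_in_imset gI); apply: subset_leq_card.
  apply/subsetP=> w /imsetP[y]; rewrite inE => exy ->; rewrite inE; apply/tmrelP; exists x, y.
  split=> //; apply/(infix2P (f x)); exists 0; rewrite /g /thread /= size_rcons.
  by split=> //; case: (p x y).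
pose s := thread f p x y; pose i := index u s; have us : uniq s := thread_uniq ei' tm exy.
have i_s : i < size (f x :: p x y) .
  rewrite /i /s /thread -rcons_cons -cats1 index_cat inE uxy orbT index_mem inE uxy; exact: orbT.
have ss : size s = (size (f x :: p x y)).+1 by rewrite /s /thread /= size_rcons.
have ni : nth u s i = u by apply: nth_index; rewrite -index_mem ss ltnW // ltnS.
have i0 : 0 < i.
  rewrite lt0n; apply: contraTneq uxy => e0; rewrite e0 in ni.
  by rewrite -ni; apply: hf.
suff sub : [set nth u s i.-1; nth u s i.+1] \subset [set w | tmrel e' f p u w].
  apply: leq_trans (subset_leq_card sub); rewrite cards2 nth_uniq ?ss ?ltnS //; first by case: eqP => //; lia.
  by rewrite -ltnS prednK // ltnW // ltnS ltnW.
rewrite subUset !sub1set !inE; apply/andP; split.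
  rewrite (tmrel_sym es' tm); apply/tmrelP; exists x, y; split=> //; apply/(infix2P u).
  by exists i.-1; rewrite prednK // -/s ss; split=> //; apply: ltnW; rewrite ltnS.
by apply/tmrelP; exists x, y; split=> //; apply/(infix2P u); exists i; rewrite -/s ss ltnS.
Qed.

Lemma good_deg (T : finType) (e : rel T) v : good e v -> deg e v <= 3.
Proof.
case=> [d2|[-> _]|[a [b [c [N _ _ _ _]]]]] //; first exact: leq_trans d2 _.
rewrite /deg N; apply: leq_trans (leq_card_setU _ _).1 _.
by rewrite cards2 cards1; case: (_ != _).
Qed.

Lemma set2_eq_card (T : finType) (A : {set T}) a b : A \subset [set a; b] -> 1 < #|A| -> A = [set a; b].
Proof.
by move=> s A2; apply/eqP; rewrite eqEcard s /= cards2; apply: leq_trans A2; case: (_ != _).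
Qed.

Section Chords.
Variables (T : finType) (e h : rel T).
Hypotheses (es : symmetric e) (ei : irreflexive e) (gd : forall v, good e v)
  (hs : symmetric h) (he : subrel h e) (h1 : forall x, deg h x != 1).

Let h2 x : 0 < deg h x -> 1 < deg h x.
Proof. by have := h1 x; case: (deg h x) => [|[]]. Qed.

Lemma deg_pos x y : h x y -> 0 < deg h x.
Proof. by move=> hxy; apply/card_gt0P; exists y; rewrite inE. Qed.

Lemma chord_deg u v : 0 < deg h u -> e u v -> ~~ h u v -> 2 < deg e u.
Proof.
move=> /h2 u2 euv; apply: contraNltn => d2.
have -> : h u v = (v \in [set y | h u y]) by rewrite inE.
suff -> : [set y | h u y] = [set y | e u y] by rewrite inE.
apply/eqP; rewrite eqEcard; apply/andP; split; last exact: leq_trans d2 u2.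
by apply/subsetP=> y; rewrite !inE; apply: he.
Qed.

Let third u v : e u v -> 2 < deg e u -> 2 < deg e v ->
  exists a c, [/\ [set y | e u y] = [set a; v; c], e v c, ~~ e a v & ~~ e a c].
Proof.
move=> euv du dv; case: (gd u) => [|[_ /(_ v euv)]|[a [b [c [N bc ab ac da]]]]].
- by rewrite leqNgt du.
- by rewrite leqNgt dv.
have : v \in [set a; b; c] by rewrite -N inE.
rewrite !inE => /orP[/orP[]|] /eqP ev; subst v; first by rewrite leqNgt dv in da.
  by exists a, c.
by exists a, b; rewrite N es bc ab ac; split=> //; rewrite setUAC.
Qed.

(** Both ends of a chord have degree at least 3 in e, so neither is a claw vertex and both are
    triangle vertices. The two adjacent pairs among their neighbours give one common neighbour c. It
    has degree 2 in h, for otherwise it would be a claw vertex next to u. *)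
Lemma chord u v : (forall x, 2 < deg h x -> claw_vertex e x) ->
  0 < deg h u -> 0 < deg h v -> e u v -> ~~ h u v ->
  exists a c, [/\ [set y | h u y] = [set a; c], ~~ e a c, e u c & [set y | h c y] = [set u; v]].
Proof.
move=> claw u0 v0 euv huv; have evu : e v u by rewrite es.
have hvu : ~~ h v u by rewrite hs.
have du := chord_deg u0 euv huv; have dv := chord_deg v0 evu hvu.
have [a [c [Nu evc nav nac]]] := third euv du dv.
have [a' [c' [Nv euc' nau' nac']]] := third evu dv du.
have sub x y (b d : T) : [set z | e x z] = [set b; y; d] -> ~~ h x y -> [set z | h x z] \subset [set b; d].
  move=> N nxy; apply/subsetP=> z; rewrite inE => hxz; have := he hxz.
  have -> : e x z = (z \in [set z | e x z]) by rewrite inE.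
  rewrite N !inE => /orP[/orP[->|/eqP ezy]|->]; rewrite ?orbT //.
  by rewrite ezy (negbTE nxy) in hxz.
have Hu := set2_eq_card (sub _ _ _ _ Nu huv) (h2 u0).
have Hv := set2_eq_card (sub _ _ _ _ Nv hvu) (h2 v0).
have evc' : e v c' by have : c' \in [set y | e v y]; [rewrite Nv !inE eqxx orbT | rewrite inE].
have euc : e u c by have : c \in [set y | e u y]; [rewrite Nu !inE eqxx orbT | rewrite inE].
have ecc : c' = c.
  have : c' \in [set a; v; c] by rewrite -Nu inE.
  rewrite !inE => /orP[/orP[]|] /eqP// ec; first by rewrite -ec es evc' in nav.
  by rewrite ec ei in evc'.
subst c'.
have huc : h u c by have : c \in [set y | h u y]; [rewrite Hu !inE eqxx orbT | rewrite inE].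
have hvc : h v c by have : c \in [set y | h v y]; [rewrite Hv !inE eqxx orbT | rewrite inE].
exists a, c; split=> //; apply/esym/eqP; rewrite eqEcard; apply/andP; split.
  by rewrite subUset !sub1set !inE !(hs c) huc.
rewrite cards2; have -> : u != v by apply: contraTneq euv => ->; rewrite ei.
rewrite leqNgt; apply/negP=> /claw[_ /(_ u)]; rewrite es euc => /(_ isT).
by rewrite leqNgt du.
Qed.

(* Each chord u v of h closes a triangle with a vertex c of R whose only neighbours in h are
   u and v. Once R is deleted, u and v have degree at most 2, and the edge uv replaces the path ucv. *)
Section ClawCase.
Hypothesis claw : forall x, 2 < deg h x -> claw_vertex e x.

Let X := [set x | 0 < deg h x].
Let R := [set c | [exists u, exists v, [&& [set y | h c y] == [set u; v], e u v & ~~ h u v]]].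

Let R_nbrs c : c \in R -> exists u v,
  [/\ [set y | h c y] = [set u; v], e u v, u \in X :\: R & v \in X :\: R].
Proof.
suff H u v : [set y | h c y] = [set u; v] -> e u v -> ~~ h u v -> u \in X :\: R.
  rewrite inE => /existsP[u /existsP[v /and3P[/eqP N euv huv]]]; exists u, v; split=> //.
    exact: H N euv huv.
  by apply: (H v u); rewrite 1?setUC 1?es 1?hs.
move=> N euv huv; have huc : h u c by rewrite hs; have := set21 u v; rewrite -N inE.
have hvc : h v c by rewrite hs; have := set22 u v; rewrite -N inE.
have [a [d [Nu nad _ _]]] := chord claw (deg_pos huc) (deg_pos hvc) euv huv.
rewrite in_setD [u \in X]inE (deg_pos huc) andbT; apply/negP.
rewrite inE => /existsP[u' /existsP[v' /and3P[/eqP N' euv' _]]].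
have := set21 u' v'; have := set22 u' v'; rewrite -N' Nu !inE => /orP[]/eqP ev /orP[]/eqP eu; subst u' v'.
- by rewrite ei in euv'.
- by rewrite es euv' in nad.
- by rewrite euv' in nad.
by rewrite ei in euv'.
Qed.

(** Each vertex of R is folded onto one of its two neighbours in h. At most x and its three
    neighbours in h are folded onto x: hence the factor 4. *)
Lemma big_claw n : big h (4 * n) -> big (restr e (X :\: R)) n.
Proof.
pose rho a := if a \in R then odflt a [pick u | h a u] else a.
have rs : symmetric (restr e (X :\: R)) by apply: restr_sym.
have rhoR a : a \in R -> h a (rho a) /\
    forall b, h a b -> b \in X :\: R /\ ((b == rho a) || restr e (X :\: R) (rho a) b).
  move=> aR; have [u [v [N euv uX vX]]] := R_nbrs aR; rewrite /rho aR.
  have mem b : h a b -> (b = u) \/ (b = v).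
    by move=> hab; have : b \in [set u; v]; [rewrite -N inE | rewrite !inE => /orP[]/eqP; [left|right]].
  case: pickP => [w haw|/(_ u)] /=; last by have := set21 u v; rewrite -N inE => ->.
  split=> // b hab; case: (mem b hab) (mem w haw) => -> [] ->; split; rewrite ?eqxx //.
    by apply/orP; right; apply/and3P; rewrite es.
  by apply/orP; right; apply/and3P.
have rho_id a : a \notin R -> rho a = a by rewrite /rho => /negbTE->.
apply: (big_transfer (Phi := fun a => [set rho a])) => //.
- by move=> a; apply: conn1.
- suff H a b : a \in R -> h a b -> conn (restr e (X :\: R)) [set rho a; rho b].
    move=> a b hab; have [aR|aR] := boolP (a \in R); first exact: H.
    have [bR|bR] := boolP (b \in R); first by rewrite setUC; apply: H; rewrite // hs.
    rewrite !rho_id //; apply: conn_edge => //; have hba : h b a by rewrite hs.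
    by apply/and3P; rewrite !in_setD aR bR [a \in X]inE [b \in X]inE (deg_pos hab) (deg_pos hba) he.
  move=> aR hab; have [_ /(_ b hab)[bX /orP[/eqP eb|eb]]] := rhoR a aR.
    have -> : rho b = rho a by rewrite rho_id ?eb //; move: bX; rewrite eb => /setDP[].
    by rewrite setUid conn1.
  by apply: conn_edge => //; rewrite (rho_id b) //; case/setDP: bX.
move=> x; have [x3|x3] := leqP (deg h x) 3; last first.
  by have := good_deg (gd x); have := deg_mono x he; lia.
apply: leq_trans (_ : #|x |: [set y | h x y]| <= _); last first.
  by apply: leq_trans (leq_card_setU _ _).1 _; rewrite cards1.
apply: subset_leq_card; apply/subsetP=> a; rewrite !inE => /eqP xa.
have [aR|/rho_id ra] := boolP (a \in R); last by rewrite xa ra eqxx.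
by have [+ _] := rhoR a aR; rewrite -xa hs => ->; rewrite orbT.
Qed.

(** A vertex of degree at most 2 in h that still has a chord has lost the neighbour c in R which
    closed the triangle. *)
Lemma claw_only x : deg (restr e (X :\: R)) x <= 2 \/ claw_vertex (restr e (X :\: R)) x.
Proof.
have [d2|d2] := pselect (deg (restr e (X :\: R)) x <= 2); first by left.
have [dh|/claw/(claw_restr (X :\: R))//] := leqP (deg h x) 2.
have [v ev hv] : exists2 v, restr e (X :\: R) x v & ~~ h x v.
  apply: contrapT => none; have : deg (restr e (X :\: R)) x <= deg h x; last by lia.
  apply: subset_leq_card; apply/subsetP=> v; rewrite [in X in X -> _]inE [in X in _ -> X]inE => ev.
  by apply: contraT => hv; case: none; exists v.
have /and3P[/setDP[xX xR] /setDP[vX vR] exv] := ev.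
move: (xX) (vX); rewrite [x \in X]inE [v \in X]inE => x0 v0.
have [a [c [_ _ exc Nc]]] := chord claw x0 v0 exv hv.
have cR : c \in R.
  rewrite inE; apply/existsP; exists x; apply/existsP; exists v; by rewrite Nc exv hv eqxx.
have d3 := good_deg (gd x); rewrite /deg (cardsD1 c) inE exc add1n ltnS in d3.
left; apply: leq_trans d3; apply: subset_leq_card; apply/subsetP=> y.
rewrite [in X in X -> _]inE => /and3P[_ /setDP[_ yR] exy].
by rewrite !inE exy andbT; apply: contraNneq yR => ->.
Qed.

End ClawCase.

Section TriangleCase.
Hypothesis triangle : forall x, 2 < deg h x -> triangle_vertex e x.

(** A vertex with a chord has degree at least 3 in e, as does the other end of the chord. So it is
    not a claw vertex and must be a triangle vertex. *)
Lemma triangle_only x : let e' := restr e [set x | 0 < deg h x] in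
  deg e' x <= 2 \/ triangle_vertex e' x.
Proof.
move=> e'; have [d2|d2] := pselect (deg e' x <= 2); first by left.
have [dh|/triangle/(triangle_restr [set x | 0 < deg h x])//] := leqP (deg h x) 2.
have [v ev hv] : exists2 v, e' x v & ~~ h x v.
  apply: contrapT => none; have : deg e' x <= deg h x; last by lia.
  apply: subset_leq_card; apply/subsetP=> v; rewrite [in X in X -> _]inE [in X in _ -> X]inE => ev.
  by apply: contraT => hv; case: none; exists v.
have /and3P[+ + exv] := ev; rewrite !inE => x0 v0.
case: (gd x) => [|[_ /(_ v exv)]|/(triangle_restr [set x | 0 < deg h x])//].
  by rewrite leqNgt (chord_deg x0 exv hv).
by rewrite leqNgt (@chord_deg v x) // 1?es 1?hs.
Qed.

End TriangleCase.

End Chords.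

Theorem claw_or_triangle g n : exists N, forall (T : finType) (e : rel T),
  symmetric e -> irreflexive e ->
  (forall x, deg (restr e [set y | 2 < deg e y]) x <= g) -> big e N ->
  exists X : {set T}, let k := restr e X in big k n /\
    ((forall x, deg k x <= 2 \/ claw_vertex k x) \/ (forall x, deg k x <= 2 \/ triangle_vertex k x)).
Proof.
have [M mono] := monochromatic (4 * n.+1); have [N HN] := good_induced g M.
exists N => T e es ei dg /(HN T e es ei dg)[X [bX gX]]; set k := restr e X in bX gX.
have ks : symmetric k by apply: restr_sym.
have ki : irreflexive k by move=> x; apply/negP=> /restr_sub; rewrite ei.
(* A good vertex of degree 3 which is not a triangle vertex is a claw vertex, so the two colours are
   the two types. *)
have [c [h0 [h0s h0k h0n h03]]] := mono T k (fun x => `[< triangle_vertex k x >]) ks bX.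
have h0i : irreflexive h0 by move=> x; apply/negP=> /h0k; rewrite ki.
have [|h [hs hh0 hn h1]] := big_minimal h0s h0i _ h0n; first by lia.
have hk : subrel h k by move=> x y /hh0/h0k.
have col x : 2 < deg h x -> `[< triangle_vertex k x >] = c.
  by have := h03 x; have := deg_mono x hh0; case: eqP => //= _; lia.
have sX : [set x | 0 < deg h x] \subset X.
  by apply/subsetP=> x; rewrite inE => /card_gt0P[y]; rewrite inE => /hk/and3P[].
case: c col {h03} => col.
  have tr x : 2 < deg h x -> triangle_vertex k x by move=> /col/asboolP.
  exists [set x | 0 < deg h x]; rewrite /= -(restr_restr _ sX) -/k; split; last first.
    by right=> x; apply: (triangle_only ks gX hs hk h1 tr).
  apply: (big_le _ (big_mono _ hn)); first by lia.
  by move=> x y hxy; apply/and3P; rewrite !inE (deg_pos hxy) (@deg_pos _ h y x) 1?hs // hk.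
have cl x : 2 < deg h x -> claw_vertex k x.
  move=> dx; have := col x dx; case: asboolP => // nt _; case: (gX x) => // d2.
  by have := deg_mono x hk; lia.
have bc := big_claw ks ki gX hs hk h1 cl hn; have co := claw_only ks ki gX hs hk h1 cl.
set X' := _ :\: _ in bc co; have sX' : X' \subset X by apply: subset_trans (subsetDl _ _) sX.
exists X'; rewrite /= -(restr_restr _ sX') -/k; split; first by apply: big_le bc.
by left.
Qed.

(** * Line graphs *)

Lemma conn_clique (T : finType) (e : rel T) (A : {set T}) : A != set0 ->
  {in A &, forall x y, x != y -> e x y} -> conn e A.
Proof.
move=> A0 cl; apply/connP; split=> // x y xA yA; have [->|xy] := eqVneq x y; first exact: connect0.
by apply: connect1; apply/and3P; split=> //; apply: cl.
Qed.

(* The lines are the maximal cliques; two of them share at most one vertex, and no vertex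
   lies on three of them. *)
Section Lines.
Variables (T : finType) (k : rel T).

Definition line x y : {set T} := [set x; y] :|: [set z | k x z && k y z].

Definition line_set (A : {set T}) : bool := [exists x, exists y, k x y && (A == line x y)].

(** The graph whose line graph is sought. Its vertex type is all of [{set T}], where the sets that
    are not lines are isolated. *)
Definition meet_rel : rel {set T} := [rel A B | [&& A != B, line_set A, line_set B & A :&: B != set0]].

Hypotheses (ks : symmetric k) (ki : irreflexive k)
  (typ : forall x, deg k x <= 2 \/ triangle_vertex k x).

Lemma line_setP A : reflect (exists x y, k x y /\ A = line x y) (line_set A).
Proof.
apply: (iffP existsP) => [[x /existsP[y /andP[kxy /eqP ->]]]|[x [y [kxy ->]]]]; first by exists x, y.
by exists x; apply/existsP; exists y; rewrite kxy eqxx.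
Qed.

Let neq x y : k x y -> x != y.
Proof. by apply: contraTneq => ->; rewrite ki. Qed.

(** If x has degree at most 2 there is no room for y, z and z'. At a triangle vertex there is only
    one pair of adjacent neighbours. *)
Lemma common_nbr x y z z' : k x y -> k x z -> k y z -> k x z' -> k y z' -> z = z'.
Proof.
move=> xy xz yz xz' yz'; case: (typ x) => [d2|[a [b [c [N bc ab ac da]]]]].
  apply/eqP; apply: contraTT d2 => nz; rewrite -ltnNge.
  apply: leq_trans (_ : #|[set z; y; z']| <= _).
    by rewrite setUC cardsU1 !inE cards2 !(eq_sym z') (negbTE nz) (negbTE (neq yz')) eq_sym (neq yz).
  by apply: subset_leq_card; rewrite !subUset !sub1set !inE xy xz.
have mem t : k x t -> [\/ t = a, t = b | t = c].
  move=> xt; have : t \in [set a; b; c] by rewrite -N inE.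
  by rewrite !inE => /orP[/orP[]|] /eqP; [constructor 1 | constructor 2 | constructor 3].
have ba : ~~ k b a by rewrite ks.
have ca : ~~ k c a by rewrite ks.
case: (mem y xy) (mem z xz) (mem z' xz') => ey [] ez [] ez' //; subst y z z'.
all: by move: yz yz'; rewrite ?ki ?(negbTE ab) ?(negbTE ac) ?(negbTE ba) ?(negbTE ca).
Qed.

Lemma lineC x y : line x y = line y x.
Proof. by rewrite /line setUC [in RHS]setUC (setUC [set x]); congr (_ :|: _); apply/setP=> z; rewrite !inE andbC. Qed.

Lemma line_third x y z : k x y -> k x z -> k y z -> line x y = [set x; y; z].
Proof.
move=> xy xz yz; apply/setP=> t; rewrite !inE; congr (_ || _).
by apply/andP/eqP => [[xt yt]|-> //]; apply: common_nbr xy xt yt xz yz.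
Qed.

Lemma line_eq x y u v : k x y -> u \in line x y -> v \in line x y -> u != v ->
  k u v /\ line x y = line u v.
Proof.
move=> xy; have [[z xz yz]|none] := pselect (exists2 z, k x z & k y z).
  have [yx zx zy] : [/\ k y x, k z x & k z y] by rewrite !(ks _ x) (ks z).
  rewrite (line_third xy xz yz) !inE.
  move=> /orP[/orP[]|] /eqP-> /orP[/orP[]|] /eqP->; rewrite ?eqxx // => _; split=> //; symmetry.
  - by apply: line_third.
  - by rewrite (line_third xz xy zy) setUAC.
  - by rewrite lineC; apply: line_third.
  - by rewrite (line_third yz yx zx) setUC setUA.
  - by rewrite lineC (line_third xz xy zy) setUAC.
  by rewrite lineC (line_third yz yx zx) setUC setUA.
have E : line x y = [set x; y].
  by apply/setP=> t; rewrite !inE; case: andP => [[xt yt]|_]; [case: none; exists t | rewrite orbF].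
rewrite {1 2}E !inE => /orP[]/eqP-> /orP[]/eqP->; rewrite ?eqxx //.
by rewrite lineC ks.
Qed.

Lemma mem_line x y : x \in line x y /\ y \in line x y.
Proof. by rewrite !inE !eqxx !orbT. Qed.

Lemma line_set_line A u v : line_set A -> u \in A -> v \in A -> u != v -> k u v /\ A = line u v.
Proof. by case/line_setP=> x [y [xy ->]]; apply: line_eq. Qed.

Lemma card_line_set A : line_set A -> #|A| <= 3.
Proof.
case/line_setP=> x [y [xy ->]]; apply: leq_trans (leq_card_setU _ _).1 _.
rewrite -[3]/(2 + 1) leq_add // ?cards2; first by case: (_ != _).
apply/card_le1_eqP=> z z'; rewrite !inE => /andP[xz yz] /andP[xz' yz'].
exact: common_nbr xy xz' yz' xz yz.
Qed.

Lemma line_sets_at x : exists a b, forall A, line_set A -> x \in A -> A = line x a \/ A = line x b.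
Proof.
suff [a [b H]] : exists a b, forall y, k x y -> line x y = line x a \/ line x y = line x b.
  exists a, b => A lA xA; have [y yA yx] : exists2 y, y \in A & y != x.
    case/line_setP: lA xA => u [v [uv ->]] xA; have [um vm] := mem_line u v.
    by have [<-|xu] := eqVneq u x; [exists v; rewrite // eq_sym neq | exists u].
  have [xy ->] : k x y /\ A = line x y by apply: line_set_line; rewrite // eq_sym.
  exact: H.
case: (typ x) => [d2|[a [b [c [N bc ab ac da]]]]].
  have [[a xa]|none] := pselect (exists a, k x a); last by exists x, x => y xy; case: none; exists y.
  have [[b xb ba]|only] := pselect (exists2 b, k x b & b != a); last first.
    exists a, a => y xy; left; have [->//|ya] := eqVneq y a; case: only; by exists y.
  exists a, b => y xy; have N : [set a; b] = [set y | k x y].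
    apply/eqP; rewrite eqEcard subUset !sub1set !inE xa xb cards2 eq_sym ba; exact: d2.
  by have : y \in [set a; b]; [rewrite N inE | rewrite !inE => /orP[]/eqP->; [left|right]].
have mem y : k x y = (y \in [set a; b; c]) by rewrite -N inE.
have xb : k x b by rewrite mem !inE eqxx orbT.
have xc : k x c by rewrite mem !inE eqxx !orbT.
exists a, b => y; rewrite mem !inE => /orP[/orP[]|] /eqP->; [by left | by right | right].
have [h1 h2] := mem_line x c; have [//|_ ->//] := line_eq (u := x) (v := b) xc h1 _ (neq xb).
by rewrite !inE xb ks bc !orbT.
Qed.

Lemma line_set_two A B C x : meet_rel A B -> x \in A -> x \in B -> line_set C -> x \in C ->
  C \in [set A; B].
Proof.
case/and4P=> AB lA lB _ xA xB lC xC; have [a [b H]] := line_sets_at x; rewrite !inE.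
case: (H A lA xA) (H B lB xB) (H C lC xC) => eA [] eB [] eC; rewrite eC -?eA -?eB ?eqxx ?orbT //.
  by rewrite eA eB eqxx in AB.
by rewrite eA eB eqxx in AB.
Qed.

Lemma meet_inj A B A' B' x : meet_rel A B -> meet_rel A' B' -> x \in A :&: B -> x \in A' :&: B' ->
  [set A; B] = [set A'; B'].
Proof.
move=> m m' /setIP[xA xB] /setIP[xA' xB']; have /and4P[_ lA lB _] := m; have /and4P[_ lA' lB' _] := m'.
apply/eqP; rewrite eqEsubset !subUset !sub1set.
by rewrite !(line_set_two m' xA' xB') // !(line_set_two m xA xB).
Qed.

(** A vertex in the intersection of two lines stands for the edge between them. This is the
    adjacency of the line graph: A and B are the only lines through x, and adjacent vertices span a
    line through both. *)
Lemma meet_adj A B A' B' x y : meet_rel A B -> meet_rel A' B' -> x \in A :&: B -> y \in A' :&: B' ->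
  x != y -> k x y = ([set A; B] :&: [set A'; B'] != set0).
Proof.
move=> m m' /setIP[xA xB] /setIP[yA' yB'] xy; have /and4P[_ lA lB _] := m; have /and4P[_ lA' lB' _] := m'.
apply/idP/set0Pn => [kxy|[C /setIP[CA CA']]].
  have lC : line_set (line x y) by apply/line_setP; exists x, y.
  have [xl yl] := mem_line x y; exists (line x y).
  by rewrite inE (line_set_two m xA xB) // (line_set_two m' yA' yB').
have [lC xC] : line_set C /\ x \in C by move: CA; rewrite !inE => /orP[]/eqP->.
have yC : y \in C by move: CA'; rewrite !inE => /orP[]/eqP->.
by have [] := line_set_line lC xC yC xy.
Qed.

Lemma meet_sym : symmetric meet_rel.
Proof. by move=> A B; rewrite /meet_rel /= eq_sym setIC; case: (line_set A); rewrite ?andbF. Qed.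

Lemma meet_irr : irreflexive meet_rel.
Proof. by move=> A; rewrite /meet_rel /= eqxx. Qed.

Lemma big_meet n : big k (3 * n) -> big meet_rel n.
Proof.
pose L v := [set A | line_set A && (v \in A)].
(* A vertex on no line gets the dummy [[set v]], since bags must be non-empty. A line has at most
   three vertices, which gives the factor 3. *)
pose Phi v := if L v == set0 then [set [set v]] else L v.
have cP v : conn meet_rel (Phi v).
  rewrite /Phi; case: eqP => [_|/eqP L0]; first exact: conn1.
  apply: conn_clique => // A B; rewrite !inE => /andP[lA vA] /andP[lB vB] AB.
  by apply/and4P; split=> //; apply/set0Pn; exists v; rewrite inE vA.
apply: (big_transfer (Phi := Phi) meet_sym cP) => // [x y xy|A].
  have [xl yl] := mem_line x y; have lC : line_set (line x y) by apply/line_setP; exists x, y.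
  have mem v : v \in line x y -> line x y \in Phi v.
    move=> vl; have h : line x y \in L v by rewrite inE lC.
    by rewrite /Phi; case: eqP => // e; rewrite e inE in h.
  exact: conn_unionI meet_sym (cP x) (cP y) (mem x xl) (mem y yl).
have mem v : A \in Phi v -> v \in A /\ #|A| <= 3.
  rewrite /Phi; case: eqP => _; rewrite inE; first by move=> /eqP->; rewrite inE cards1.
  by case/andP=> lA vA; split=> //; apply: card_line_set.
have [->|/set0Pn[v]] := eqVneq [set a | A \in Phi a] set0; first by rewrite cards0.
rewrite inE => /mem[_ A3]; apply: leq_trans A3; apply: subset_leq_card.
by apply/subsetP=> u; rewrite inE => /mem[].
Qed.

End Lines.

(** * Walls *)

Section WallModel.
Variable k : nat.
Implicit Types (x y z : Gamma k) (v w : wall k).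

Let row x : nat := row_of x.
Let col x : nat := col_of x.

Definition wall_pos v : Gamma k := val (val v).

Lemma wall_pos_inj : injective wall_pos.
Proof. by move=> v w /val_inj/val_inj. Qed.

Let arc x y := (row y == row x) && (col y == (col x).+1) ||
  [&& row y == (row x).+1, col y == col x & odd (row x + col x)].

Lemma GammaE x y : (x -- y) = arc x y || arc y x.
Proof. by []. Qed.

Lemma Gamma_eq x y : row x = row y -> col x = col y -> x = y.
Proof.
by case: x y => [a b] [c d] [h1] h2; congr pair; apply: val_inj.
Qed.

Lemma row_bounds x : 0 < row x <= k.
Proof. by rewrite /row /row_of /= ltn_ord. Qed.

Lemma col_bound x : col x < 2 * k.
Proof. exact: ltn_ord. Qed.

Lemma Gamma_at i j : 0 < i <= k -> j < 2 * k -> exists x, row x = i /\ col x = j.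
Proof.
case: i => // i /= ik jk; exists ((Ordinal ik, Ordinal jk) : grid_vertex k) => //.
Qed.

(** These are exactly the vertices of [Gamma k] that survive in the wall, by [wall_vertical] and
    [wall_at]. *)
Definition vertical x : Prop := exists2 y, x -- y & row y <> row x.

Lemma verticalP x : vertical x <->
  odd (row x + col x) && (row x < k) || ~~ odd (row x + col x) && (1 < row x).
Proof.
have := row_bounds x; have := col_bound x => cb rb; split.
  case=> y; have := row_bounds y; rewrite GammaE /arc; lia.
case/orP=> /andP[od lt].
  have [||y [ry cy]] := @Gamma_at (row x).+1 (col x); [lia | lia |].
  by exists y; [rewrite GammaE /arc ry cy !eqxx od orbT | rewrite ry; lia].
have [||y [ry cy]] := @Gamma_at (row x).-1 (col x); [lia | lia |].
by exists y; [rewrite GammaE /arc ry cy; lia | rewrite ry; lia].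
Qed.

Lemma deg_not1 (G : sgraph) (x y z : G) : x -- y -> x -- z -> y != z -> degree x != 1.
Proof.
move=> xy xz yz; apply/negP=> /cards1P[u /setP N].
have := N y; have := N z; rewrite !inE xy xz => /esym/eqP ez /esym/eqP ey.
by rewrite ey ez eqxx in yz.
Qed.

Lemma vertical_deg x : vertical x -> degree x != 1.
Proof.
case=> y xy ry; have := row_bounds x; have cb := col_bound x => rb.
have [z xz rz] : exists2 z, x -- z & row z = row x.
  have [c1|c1] := posnP (col x).
    have [||z [rz cz]] := @Gamma_at (row x) (col x).+1; [lia | lia |].
    by exists z; rewrite // GammaE /arc rz cz !eqxx.
  have [||z [rz cz]] := @Gamma_at (row x) (col x).-1; [lia | lia |].
  by exists z; rewrite // GammaE /arc rz cz; lia.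
by apply: (deg_not1 xy xz); apply: contra_not_neq ry => ->.
Qed.

Lemma trimmed_at x : degree x != 1 -> exists t : trimmed_Gamma k, val t = x.
Proof.
move=> dx; have xt : x \in [set x : Gamma k | degree x != 1] by rewrite inE.
by exists (exist _ x xt).
Qed.

Lemma wall_vertical v : vertical (wall_pos v).
Proof.
have := valP v; rewrite inE inE; set t := val v => h; have rb := row_bounds (wall_pos v).
have [e|ne] := boolP ((row_of (val t) == 1) || (row_of (val t) == k)); last first.
  apply/verticalP; move: ne; rewrite -/(row (wall_pos v)); lia.
move: h; rewrite e /= negb_forall => /existsP[y]; rewrite negb_imply => /andP[ty /eqP ry].
by exists (val y).
Qed.

Lemma wall_at x : vertical x -> exists v, wall_pos v = x.
Proof.
move=> vx; have [t tx] := trimmed_at (vertical_deg vx).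
have [y xy ry] := vx; have vy : vertical y.
  by exists x; [rewrite sedge_sym | apply: nesym].
have [s sy] := trimmed_at (vertical_deg vy).
have tS : t \in ~: suppressed_set k.
  rewrite inE inE negb_and negb_forall; apply/orP; right; apply/existsP; exists s.
  have ts : val t -- val s by rewrite tx sy.
  by rewrite negb_imply; apply/andP; split; [exact: ts | rewrite tx sy; apply/eqP].
by exists (exist _ t tS).
Qed.

(* In the second case z is a suppressed vertex. *)
Lemma wall_edge v w : v -- w -> (wall_pos v -- wall_pos w) \/
  exists z, [/\ wall_pos v -- z, z -- wall_pos w, row z = row (wall_pos v),
    row z = row (wall_pos w) & forall u, wall_pos u <> z].
Proof.
case/andP=> _ /orP[vw|/exists_inP[s sS]]; first by left.
have := sS; rewrite inE => /andP[_ /forallP all] /andP[sv sw]; right; exists (val s); split=> //.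
- by rewrite sedge_sym.
- by have := all (val v); rewrite sv /= => /eqP.
- by have := all (val w); rewrite sw /= => /eqP.
by move=> u /val_inj us; have := valP u; rewrite inE us sS.
Qed.

Lemma wall_adj v w : wall_pos v -- wall_pos w -> v -- w.
Proof.
move=> vw; apply/andP; split; last by apply/orP; left.
by apply: contraTneq vw => ->; rewrite sedge_irr.
Qed.

Lemma wall_adj2 v w z : wall_pos v <> wall_pos w -> wall_pos v -- z -> z -- wall_pos w -> ~ vertical z -> v -- w.
Proof.
move=> vw vz zw nz; apply/andP; split; first by apply/eqP => e; apply: vw; rewrite e.
have [|t tz] := @trimmed_at z.
  apply: (@deg_not1 _ _ (wall_pos v) (wall_pos w)); rewrite 1?sedge_sym //; first by rewrite sedge_sym.
  exact/eqP.
have tv : val t -- wall_pos v by rewrite tz sedge_sym.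
have tw : val t -- wall_pos w by rewrite tz.
apply/orP; right; apply/exists_inP; exists t; last by apply/andP.
have rb := row_bounds z; rewrite inE; apply/andP; split.
  rewrite tz -/(row z); apply/negP=> e; apply: nz; apply/verticalP; lia.
apply/forallP=> y; apply/implyP=> ty; apply/eqP; apply: contrapT => ry; apply: nz.
by exists (val y); [rewrite -tz | rewrite -tz].
Qed.

(** Of the next two vertices in a row at least one has a vertical edge, by parity. If only the
    second has one, the first is suppressed. *)
Lemma wall_horizontal v : exists2 w, v -- w & row (wall_pos w) = row (wall_pos v).
Proof.
set x := wall_pos v; have vx : vertical x := wall_vertical v.
suff [a [b [xa ab xb [ra rb] vb]]] : exists a b, [/\ x -- a, a -- b, x <> b, row a = row x /\ row b = row x &
    vertical a \/ vertical b].
  have [va|va] := pselect (vertical a).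
    by have [w ew] := wall_at va; exists w; [apply: wall_adj; rewrite ew | rewrite ew].
  case: vb => // /wall_at[w ew]; exists w; last by rewrite ew.
  by apply: (wall_adj2 (z := a)); rewrite ?ew.
have rb := row_bounds x; have cb := col_bound x; have hx := (verticalP x).1 vx.
have vert a b : row a = row x -> row b = row x -> col a = (col b).+1 \/ col b = (col a).+1 ->
    vertical a \/ vertical b.
  move=> ra rb' c; have [va|/negP] := boolP (odd (row a + col a) && (row a < k) || ~~ odd (row a + col a) && (1 < row a)).
    by left; apply/verticalP.
  by move=> p; right; apply/verticalP; rewrite ra rb' in p *; lia.
have [c2|c2] := leqP 2 (col x).
  have [||a [ra ca]] := @Gamma_at (row x) (col x).-1; [lia | lia |].
  have [||b [rb' cb']] := @Gamma_at (row x) (col x).-2; [lia | lia |].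
  exists a, b; split=> //; first by rewrite GammaE /arc ra ca; lia.
  - by rewrite GammaE /arc ra ca rb' cb'; lia.
  - by move=> e; rewrite -e in cb'; lia.
  by apply: vert => //; lia.
have [||a [ra ca]] := @Gamma_at (row x) (col x).+1; [lia | lia |].
have [||b [rb' cb']] := @Gamma_at (row x) (col x).+2; [lia | lia |].
exists a, b; split=> //; first by rewrite GammaE /arc ra ca; lia.
- by rewrite GammaE /arc ra ca rb' cb'; lia.
- by move=> e; rewrite -e in cb'; lia.
by apply: vert => //; lia.
Qed.

Lemma wall_deg v : 1 < deg (@sedge (wall k)) v.
Proof.
have [y vy ry] := wall_vertical v; have vy' : vertical y.
  by exists (wall_pos v); [rewrite sedge_sym | apply: nesym].
have [u eu] := wall_at vy'; have [w vw rw] := wall_horizontal v.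
have uw : u != w by apply/eqP=> e; apply: ry; rewrite -eu e.
have vu : v -- u by apply: wall_adj; rewrite eu.
apply: leq_trans (_ : #|[set u; w]| <= _); first by rewrite cards2 uw.
by apply: subset_leq_card; rewrite subUset !sub1set !inE vu vw.
Qed.

Definition hole i j : bool := [forall v, ~~ ((row (wall_pos v) == i) && (col (wall_pos v) == j))].

Definition wall_arc v w : Prop :=
  row (wall_pos w) = row (wall_pos v) /\
    (col (wall_pos w) = (col (wall_pos v)).+1 \/
     col (wall_pos w) = (col (wall_pos v)).+2 /\ hole (row (wall_pos v)) (col (wall_pos v)).+1) \/
  [/\ row (wall_pos w) = (row (wall_pos v)).+1, col (wall_pos w) = col (wall_pos v) &
      odd (row (wall_pos v) + col (wall_pos v))].

Lemma hole_pos i j v : hole i j -> row (wall_pos v) = i -> col (wall_pos v) = j -> False.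
Proof. by move=> /forallP/(_ v) h h1 h2; rewrite h1 h2 !eqxx in h. Qed.

Lemma wall_arcP v w : v -- w -> wall_arc v w \/ wall_arc w v.
Proof.
move=> vw; have ne : wall_pos v <> wall_pos w.
  by move=> /wall_pos_inj e; rewrite e sedge_irr in vw.
case: (wall_edge vw) => [|[z [vz zw r1 r2 nz]]].
  rewrite GammaE /arc /wall_arc => /orP[/orP[/andP[/eqP-> /eqP->]|/and3P[/eqP-> /eqP-> ->]]|].
  - by left; left; split=> //; left.
  - by left; right.
  move=> /orP[/andP[/eqP-> /eqP->]|/and3P[/eqP-> /eqP-> ->]].
    by right; left; split=> //; left.
  by right; right.
have hz j : col z = j -> hole (row z) j.
  move=> <-; apply/forallP=> u; apply/negP=> /andP[/eqP h1 /eqP h2].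
  by apply: (nz u); apply: Gamma_eq.
have neq : col (wall_pos v) <> col (wall_pos w).
  by move=> e; apply: ne; apply: Gamma_eq; rewrite // -r1 -r2.
have [c|c] : col (wall_pos v) = (col z).+1 /\ col z = (col (wall_pos w)).+1 \/
             col (wall_pos w) = (col z).+1 /\ col z = (col (wall_pos v)).+1.
- by move: vz zw; rewrite !GammaE /arc; lia.
- by right; left; rewrite -r1 -r2; split=> //; right; rewrite r2; split; [lia | rewrite -r2; apply: hz; lia].
by left; left; rewrite -r1 -r2; split=> //; right; split; [lia | apply: hz; lia].
Qed.

Lemma wall_subcubic : subcubic (@sedge (wall k)).
Proof.
pose slot x y := if col y == col x then 2 else if col y < col x then 0 else 1.
exists (fun v w => inord (slot (wall_pos v) (wall_pos w))) => v w w' vw vw' sl.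
have {}sl : slot (wall_pos v) (wall_pos w) = slot (wall_pos v) (wall_pos w').
  have slot3 x y : slot x y < 3 by rewrite /slot; do 2 case: ifP => //.
  by have := congr1 val sl; rewrite /= !inordK.
have : let c := col (wall_pos v) in let d := col (wall_pos w) in let d' := col (wall_pos w') in
    d = c /\ d' = c \/ d < c /\ d' < c \/ c < d /\ c < d'.
  by move: sl; rewrite /slot /=; case: eqP => ?; case: eqP => ?; case: leqP => ?; case: leqP => ? //; lia.
have b1 i j := @hole_pos i j w; have b2 i j := @hole_pos i j w'.
move=> /= sl2; suff [h1 h2] : row (wall_pos w) = row (wall_pos w') /\ col (wall_pos w) = col (wall_pos w').
  by apply: wall_pos_inj; apply: Gamma_eq.
case: (wall_arcP vw) => [[[ra [ca|[ca ha]]]|[ra ca oa]]|[[ra [ca|[ca ha]]]|[ra ca oa]]];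
case: (wall_arcP vw') => [[[ra' [ca'|[ca' ha']]]|[ra' ca' oa']]|[[ra' [ca'|[ca' ha']]]|[ra' ca' oa']]];
  first [by split; lia | by exfalso; lia | by exfalso; apply: (b1 _ _ ha'); lia
        | by exfalso; apply: (b2 _ _ ha); lia].
Qed.

(* Shifting row i by 2k - i columns turns the vertical edges of Gamma into those of the grid.
   A suppressed vertex is added to the branch set of its left neighbour. *)
Lemma wall_hex : minor (@sedge (wall k)) (@hex (2 * k).+2).
Proof.
(* A row of the hexagonal grid is numbered by q: the crossing [q./2] is entered at even q and left
   at odd q. *)
pose n := (2 * k).+2; pose at_ i q : hex_vertex n := (inord i, inord q./2, odd q).
have at_nat i q : i < n -> q < 2 * n -> hex_nat (at_ i q) = (i, q./2, odd q).
  by move=> h1 h2; rewrite /hex_nat /= !inordK //; lia.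
pose q v := col (wall_pos v) + 2 * k - row (wall_pos v).
have bd v : [/\ 0 < row (wall_pos v) <= k, col (wall_pos v) < 2 * k, row (wall_pos v) < n, q v < 2 * n & (q v).+1 < 2 * n].
  have rb := row_bounds (wall_pos v); have cb := col_bound (wall_pos v); rewrite /q /n; split; lia.
have right_ i j : i < n -> j.+1 < 2 * n -> hex (at_ i j) (at_ i j.+1).
  move=> h1 h2; apply/orP; left; rewrite !at_nat // 1?ltnW // /hex_arc /=.
  by case: (boolP (odd j)) => o; rewrite ?o /= !xpair_eqE; lia.
have down i j : i.+1 < n -> j < 2 * n -> odd j -> hex (at_ i j) (at_ i.+1 j.-1).
  move=> h1 h2 o; apply/orP; left; rewrite !at_nat //; [|lia|lia].
  by rewrite /hex_arc /= o !xpair_eqE; lia.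
pose base v := at_ (row (wall_pos v)) (q v); pose next v := at_ (row (wall_pos v)) (q v).+1.
pose gap v := hole (row (wall_pos v)) (col (wall_pos v)).+1.
pose Phi v := if gap v then [set base v; next v] else [set base v].
have bP v : base v \in Phi v by rewrite /Phi; case: ifP; rewrite !inE eqxx.
have nP v : gap v -> next v \in Phi v by rewrite /Phi => ->; rewrite !inE eqxx orbT.
have inP v a : a \in Phi v -> a = base v \/ gap v /\ a = next v.
  by rewrite /Phi; case: ifP => g; rewrite !inE; [move=> /orP[]/eqP; [left|right] | move/eqP; left].
exists Phi; split.
- move=> v; rewrite /Phi; case: ifP => _; last exact: conn1.
  by apply: conn_edge; [exact: hex_sym | have [_ _ h1 _ h2] := bd v; exact: right_].
- move=> v w vw; rewrite -setI_eq0; apply/eqP/setP=> a; rewrite inE [RHS]inE; apply/negP=> /andP[av aw].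
  have [r1 c1 h1 h2 h3] := bd v; have [r2 c2 h1' h2' h3'] := bd w.
  have inj i j i' j' : i < n -> i' < n -> j < 2 * n -> j' < 2 * n -> at_ i j = at_ i' j' -> i = i' /\ j = j'.
    by move=> l1 l2 l3 l4 /(congr1 (@hex_nat n)); rewrite !at_nat // => -[-> e1 e2]; lia.
  case: (inP v a av) => [ev|[gv ev]]; case: (inP w a aw) => [ew|[gw ew]]; rewrite ev in ew.
  + have [e1 e2] := inj _ _ _ _ h1 h1' h2 h2' ew; case/eqP: vw; apply: wall_pos_inj; apply: Gamma_eq => //.
    move: e2; rewrite /q; lia.
  + have [e1 e2] := inj _ _ _ _ h1 h1' h2 h3' ew; apply: (hole_pos (v := v) gw) => //.
    move: e2; rewrite /q; lia.
  + have [e1 e2] := inj _ _ _ _ h1 h1' h3 h2' ew; apply: (hole_pos (v := w) gv) => //.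
    move: e2; rewrite /q; lia.
  have [e1 e2] := inj _ _ _ _ h1 h1' h3 h3' ew; case/eqP: vw; apply: wall_pos_inj; apply: Gamma_eq => //.
  move: e2; rewrite /q; lia.
suff H v w : wall_arc v w -> exists a b, [/\ a \in Phi v, b \in Phi w & hex a b].
  move=> v w /wall_arcP[/H//|/H[a [b [aw bv ab]]]]; exists b, a; split=> //.
  by rewrite (@hex_sym n).
have [r1 c1 h1 h2 h3] := bd v; have [r2 c2 h1' h2' h3'] := bd w.
case=> [[rw [cw|[cw hv]]]|[rw cw od]].
- exists (base v), (base w); split=> //; have -> : base w = at_ (row (wall_pos v)) (q v).+1; last exact: right_.
  by rewrite /base rw; congr at_; rewrite /q rw cw; lia.
- exists (next v), (base w); split=> //; first exact: nP.
  have -> : base w = at_ (row (wall_pos v)) (q v).+2; last by apply: right_ => //; rewrite /q /n in h3 *; lia.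
  by rewrite /base rw; congr at_; rewrite /q rw cw; lia.
exists (base v), (base w); split=> //.
have -> : base w = at_ (row (wall_pos v)).+1 (q v).-1; last by apply: down => //; rewrite -?rw // /q; lia.
by rewrite /base rw; congr at_; rewrite /q rw cw; lia.
Qed.

End WallModel.

(** * From models to induced subgraphs, and the conclusion *)

Lemma contains_inducedW (G H : sgraph) (phi : H -> G) : injective phi ->
  (forall a b, (phi a -- phi b) = (a -- b)) -> contains_induced G H.
Proof.
move=> phiI phiE; pose S := phi @: setT; have phiS a : phi a \in S by apply: imset_f.
exists S, (fun a => exist _ (phi a) (phiS a)); split; last exact: phiE.
apply: inj_card_bij => [a b /(congr1 val)/phiI //|].
by rewrite card_sig (eq_card (B := mem S)) // card_imset // cardsT.
Qed.

Lemma infix2_map (T T' : eqType) (g : T -> T') u v s : injective g ->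
  infix [:: g u; g v] (map g s) = infix [:: u; v] s.
Proof.
move=> gI; apply/(infix2P (g u))/(infix2P u) => -[i [si h1 h2]]; exists i.
  rewrite size_map in si; rewrite !(nth_map u) // in h1 h2; last exact: ltnW.
  by split=> //; apply: gI.
by rewrite size_map; split; rewrite // (nth_map u) ?h1 ?h2 // ltnW.
Qed.

Section SubdivisionGraph.
Variables (H : sgraph) (U : finType) (K : rel U) (f : H -> U) (p : H -> H -> seq U).
Hypotheses (Ki : irreflexive K) (tm : tmodel (@sedge H) K f p).

Let r := tmrel (@sedge H) f p.
(** A subdivision has no vertices off its paths, so the vertex type is cut down to the support of
    the model. *)
Let S := [set u | [exists x, u == f x] || [exists x, exists y, (x -- y) && (u \in p x y)]].

Let SP u : reflect ((exists x, u = f x) \/ (exists x y, x -- y /\ u \in p x y)) (u \in S).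
Proof.
rewrite inE; apply: (iffP orP) => [[/existsP[x /eqP ->]|/existsP[x /existsP[y /andP[]]]]|[[x ->]|[x [y [xy up]]]]].
- by left; exists x.
- by right; exists x, y.
- by left; apply/existsP; exists x.
by right; apply/existsP; exists x; apply/existsP; exists y; rewrite xy.
Qed.

Definition model_rel : rel {u | u \in S} := [rel a b | r (val a) (val b)].

Fact model_sym : symmetric model_rel.
Proof. by move=> a b; apply: (tmrel_sym (@sedge_sym H) tm). Qed.

Fact model_irr : irreflexive model_rel.
Proof. by move=> a; have [/(tmrel_sub tm)|/negbTE//] := boolP (r (val a) (val a)); rewrite Ki. Qed.

Definition model_graph : sgraph := SGraph model_sym model_irr.

Lemma model_subdivision : is_subdivision H model_graph.
Proof.
have [fI hr hu hf [hd _]] := tm.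
have fS x : f x \in S by apply/SP; left; exists x.
pose f' x : model_graph := exist _ (f x) (fS x).
pose p' x y : seq model_graph := pmap insub (p x y).
have p'E x y : x -- y -> map val (p' x y) = p x y.
  move=> xy; rewrite (pmap_filter (@insubK _ _ _)); apply/all_filterP/allP => u up /=.
  by rewrite isSome_insub; apply/SP; right; exists x, y.
have vI : injective (val : model_graph -> U) := val_inj.
exists f', p'; split; first by move=> x y /(congr1 val)/fI.
have pE x y (v : model_graph) : x -- y -> (v \in p' x y) = (val v \in p x y).
  by move=> xy; rewrite -(p'E x y xy) (mem_map vI).
split.
- move=> x y xy; apply: (inj_map vI); rewrite map_rev !p'E //; first exact: hr.
  by rewrite sedge_sym.
- by move=> x y xy; rewrite -(map_inj_uniq vI) p'E //; apply: hu.
- by move=> x y z xy; rewrite pE //; apply: hf.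
- by move=> x y x' y' v xy xy'; rewrite !pE //; apply: hd.
split=> [v|u v].
  have /SP[[x ex]|[x [y [xy vp]]]] := valP v; [left | right].
    by exists x; apply: vI.
  by exists x, y; rewrite pE.
have E x y : x -- y -> infix [:: u; v] (f' x :: rcons (p' x y) (f' y)) = infix [:: val u; val v] (thread f p x y).
  by move=> xy; rewrite -(infix2_map _ _ _ vI) /= map_rcons p'E.
split=> [/tmrelP[x [y [xy h]]]|[x [y [xy h]]]]; first by exists x, y; rewrite E.
by apply/tmrelP; exists x, y; rewrite -E.
Qed.

Lemma model_degree (a : model_graph) : (forall x : H, 1 < deg (@sedge H) x) -> 1 < deg r (val a).
Proof.
move=> d2; apply: (tmrel_degree (@sedge_sym H) (@sedge_irr H) tm d2).
exact/SP/valP.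
Qed.

End SubdivisionGraph.

Lemma gamma_deg (G : sgraph) (x : G) :
  deg (restr (@sedge G) [set y : G | 2 < deg (@sedge G) y]) x <= gamma 3 G.
Proof.
set S := [set y | _]; have [xS|xS] := boolP (x \in S); last first.
  rewrite /deg (_ : [set y | _] = set0) ?cards0 //.
  by apply/setP=> y; rewrite !inE /restr /= (negbTE xS).
pose a : induced S := exist _ x xS.
apply: leq_trans (_ : degree a <= _); last exact: (leq_bigmax a).
rewrite /degree -(card_imset _ val_inj); apply: subset_leq_card; apply/subsetP=> y.
rewrite inE => /and3P[_ yS xy]; apply/imsetP; exists (exist _ y yS) => //.
by rewrite inE.
Qed.

Section Induced.
Variables (G H : sgraph) (X : {set G}).

Let k := restr (@sedge G) X.
Let ks : symmetric k. Proof. by apply: restr_sym; apply: sedge_sym. Qed.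
Let ki : irreflexive k. Proof. by move=> x; apply/negP=> /restr_sub; rewrite sedge_irr. Qed.

(** All degrees in the model are at least 2, so both ends of a chord would have degree at least 3 in
    k, which is impossible next to a claw vertex. *)
Lemma induced_subdivision f p : (forall x, deg k x <= 2 \/ claw_vertex k x) ->
  (forall x : H, 1 < deg (@sedge H) x) -> tmodel (@sedge H) k f p ->
  exists F : sgraph, is_subdivision H F /\ contains_induced G F.
Proof.
move=> typ d2 tm; exists (model_graph ki tm); split; first exact: model_subdivision.
apply: (@contains_inducedW G (model_graph ki tm) val); first exact: val_inj.
have sub := tmrel_sub tm.
have inX (a : model_graph ki tm) : val a \in X.
  have := model_degree a d2; case/ltnW/card_gt0P=> v; rewrite inE => /sub.
  by case/and3P.
move=> a b; apply/idP/idP => [ab|/sub/restr_sub //].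
have kab : k (val a) (val b) by apply/and3P.
apply: contraT => nab.
have big_deg (c d : model_graph ki tm) : k (val c) (val d) -> ~~ (c -- d) -> 2 < deg k (val c).
  move=> kcd ncd; apply: leq_ltn_trans (model_degree c d2) _; apply: proper_card; apply/properP; split.
    by apply/subsetP=> v; rewrite !inE; apply: sub.
  by exists (val d); rewrite inE.
have da := big_deg a b kab nab.
have db : 2 < deg k (val b).
  by apply: (big_deg b a); [rewrite ks | rewrite (@sedge_sym (model_graph ki tm))].
case: (typ (val a)) => [|[_ /(_ _ kab)]]; by rewrite leqNgt ?da ?db.
Qed.

(** Every edge of the subdivision joins two lines and is represented by a vertex of their
    intersection. By [meet_inj] and [meet_adj] these vertices induce the line graph, even if the
    subdivision is not induced. *)
Lemma induced_line_graph f p : (forall x, deg k x <= 2 \/ triangle_vertex k x) ->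
  tmodel (@sedge H) (meet_rel k) f p ->
  exists F : sgraph, is_subdivision H F /\ contains_induced G (line_graph F).
Proof.
move=> typ tm; have mi := meet_irr k; set F := model_graph mi tm.
exists F; split; first exact: model_subdivision.
have sub (A B : F) : A -- B -> meet_rel k (val A) (val B) by apply: tmrel_sub tm _ _.
have /choice[phi phiP] : forall a : line_graph F, exists x : G, exists A B : F,
    [/\ A -- B, val a = [set A; B] & x \in val A :&: val B].
  move=> a; have /existsP[A /existsP[B /andP[AB /eqP ea]]] := valP a.
  by have /and4P[_ _ _ /set0Pn[x xAB]] := sub A B AB; exists x, A, B.
have imE (A B : F) : val @: [set A; B] = [set val A; val B] by rewrite imsetU !imset_set1.
have vI : injective (val : F -> {set G}) := val_inj.
have phiI : injective phi.
  move=> a b eab; have [A [B [AB ea xA]]] := phiP a; have [A' [B' [AB' eb xB]]] := phiP b.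
  apply: val_inj; rewrite ea eb; apply: (imset_inj vI); rewrite !imE.
  by apply: (meet_inj ks ki typ (sub _ _ AB) (sub _ _ AB') xA); rewrite eab.
apply: (contains_inducedW phiI) => a b; have [<-|ab] := eqVneq a b; first by rewrite !sedge_irr.
have [A [B [AB ea xA]]] := phiP a; have [A' [B' [AB' eb xB]]] := phiP b.
have nab : phi a != phi b by rewrite (inj_eq phiI).
have := meet_adj ks ki typ (sub _ _ AB) (sub _ _ AB') xA xB nab.
rewrite -!imE -imsetI; last by move=> ? ? _ _; apply: vI.
have inX (C D : F) x : C -- D -> x \in val C :&: val D -> x \in X.
  move=> /sub/and4P[_ lC _ _] /setIP[xC _].
  have /line_setP[u [v [uv eC]]] := lC; have [um vm] := mem_line k u v.
  have [y yC xy] : exists2 y, y \in val C & x != y.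
    rewrite eC; have [exu|xu] := eqVneq x u; last by exists u.
    by exists v => //; apply: contraTneq uv => <-; rewrite exu ki.
  by have [/and3P[]] := line_set_line ks ki typ lC xC yC xy.
rewrite imset_eq0 -ea -eb /k /restr /= (inX A B) // (inX A' B') //= => ->.
by rewrite /line_rel /= ab.
Qed.

End Induced.

Theorem theorem7p1 :
  forall k g : nat, 0 < k -> 0 < g ->
  exists w : nat, forall G : sgraph,
    gamma 3 G <= g -> w < treewidth G ->
    exists F : sgraph, is_subdivision (wall k) F /\
      (contains_induced G F \/ contains_induced G (line_graph F)).
Proof.
(* The size [(2 * k).+2] is that of [wall_hex], and the factor 3 is lost in [big_meet]. The
   successor in [3 * N.+1] provides the positive order that [treewidth_big] demands. *)
move=> k g _ _; have [M HM] := hex_minor (2 * k).+2; have [N HN] := claw_or_triangle g (3 * M).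
exists (3 * N.+1) => G gG tw.
have es := @sedge_sym G; have ei := @sedge_irr G.
have [|X [bX typ]] := HN G (@sedge G) es ei (fun x => leq_trans (gamma_deg x) gG).
  by apply: (big_le (leqnSn N)); apply: treewidth_big.
have ks : symmetric (restr (@sedge G) X) by apply: restr_sym.
have ki : irreflexive (restr (@sedge G) X) by move=> x; apply/negP=> /restr_sub; rewrite ei.
have model (U : finType) (K : rel U) : symmetric K -> big K M ->
    exists f p, tmodel (@sedge (wall k)) K f p.
  move=> Ks /(HM U K Ks) mh; apply: topological_of_minor => //.
  - exact: sedge_sym.
  - exact: sedge_irr.
  - exact: wall_subcubic.
  exact: minor_trans Ks (wall_hex k) mh.
case: typ => typ.
  have [|f [p tm]] := model G _ ks; first by apply: big_le bX; lia.
  have [F [sF iF]] := induced_subdivision typ (@wall_deg k) tm.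
  by exists F; split=> //; left.
have [f [p tm]] := model _ _ (@meet_sym G _) (big_meet ks ki typ bX).
have [F [sF iF]] := induced_line_graph typ tm.
by exists F; split=> //; right.
Qed.
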